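(* Let $G$ be a regular Lie group with Lie algebra $\mathfrak g$, and let $(M,x_0)$ be a simply connected pointed manifold, possibly infinite dimensional. Then there exists a unique smooth mapping (between Frölicher spaces), called the evolution operator, $$\operatorname{Evol}=\operatorname{Evol}^{(M,x_0)}_G:\Omega^1_{\mathrm{flat}}(M,\mathfrak g)\to C^\infty(M,G)$$ which satisfies $$\delta^r\circ\operatorname{Evol}=\operatorname{Id}\quad\text{and}\quad \operatorname{Evol}(\xi)(x_0)=e\ \text{ for all }\xi\in\Omega^1_{\mathrm{flat}}(M,\mathfrak g).$$ Moreover, $\operatorname{Evol}$ is a natural transformation $\Omega^1_{\mathrm{flat}}(\;\cdot\;,\operatorname{Lie}(\;\cdot\;))\to C^\infty(\;\cdot\;,\;\cdot\;)$ between two functors, contravariant in the manifold and covariant in the group, from the product of the category of simply connected pointed smooth manifolds and the category of regular Lie groups into the category of Frölicher spaces. That is, for every smooth base-point-preserving map $h:(N,y_0)\to(M,x_0)$ between simply connected pointed manifolds and every smooth homomorphism $\varphi:G\to H$ between regular Lie groups with $\varphi'=T_e\varphi:\mathfrak g\to\mathfrak h$, we have $$C^\infty(h,\varphi)\circ\operatorname{Evol}_G^{(M,x_0)}=\operatorname{Evol}_H^{(N,y_0)}\circ\,\Omega^1_{\mathrm{flat}}(h,\varphi'),$$ where $C^\infty(h,\varphi)(f)=\varphi\circ f\circ h$ and $\Omega^1_{\mathrm{flat}}(h,\varphi')(\xi)=\varphi'\circ h^*\xi$. In detail, for all $\xi\in\Omega^1_{\mathrm{flat}}(M,\mathfrak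 g)$, $$\operatorname{Evol}^{(N,y_0)}_G(h^*\xi)=\operatorname{Evol}^{(M,x_0)}_G(\xi)\circ h\quad\text{and}\quad \varphi\circ\operatorname{Evol}^{(M,x_0)}_G(\xi)=\operatorname{Evol}^{(M,x_0)}_H(\varphi'\circ\xi).$$
   Context: Manifolds and Lie groups may be infinite dimensional and are modeled on convenient vector spaces (locally convex spaces in which every Mackey-Cauchy sequence converges), in the sense of convenient calculus (Kriegl–Michor): a mapping is smooth if it maps smooth curves to smooth curves. For a Lie group $G$ with Lie algebra $\mathfrak g$ and unit $e$, write $\mu(x,y)=xy=\mu_x(y)=\mu^y(x)$ for multiplication and left/right translations. The Lie bracket on $\mathfrak g$ is the one coming from left invariant vector fields; thus the right invariant vector fields $R_X(g)=T_e(\mu^g).X$ satisfy $[R_X,R_Y]=-R_{[X,Y]}$. The right Maurer-Cartan form $\kappa^r\in\Omega^1(G,\mathfrak g)$ is $\kappa^r_x(\zeta)=T_x(\mu^{x^{-1}}).\zeta$ for $\zeta\in T_xG$. For a smooth map $f:M\to G$ the right logarithmic derivative is $\delta^rf=f^*\kappa^r\in\Omega^1(M,\mathfrak g)$, i.e. $\delta^rf(\zeta_x)=T_{f(x)}(\mu^{f(x)^{-1}}).T_xf.\zeta_x$. Regular Lie group: $G$ is regular if for each $X\in C^\infty(\mathbb R,\mathfrak g)$ there is $g\in C^\infty(\mathbb R,G)$ with $g(0)=e$ and $\partial_tg(t)=T_e(\mu^{g(t)}).X(t)$ (such $g$ is then unique), and the map $\operatorname{evol}^r_G:C^\infty(\mathbb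 R,\mathfrak g)\to G$, $X\mapsto g(1)$, is smooth. For $\mathfrak g$-valued forms $\varphi\in\Omega^p(M,\mathfrak g)$, $\psi\in\Omega^q(M,\mathfrak g)$, $$[\varphi,\psi]^{\mathfrak g}_\wedge(\zeta_1,\dots,\zeta_{p+q})=\frac1{p!q!}\sum_\sigma\operatorname{sign}(\sigma)\,[\varphi(\zeta_{\sigma1},\dots,\zeta_{\sigma p}),\psi(\zeta_{\sigma(p+1)},\dots,\zeta_{\sigma(p+q)})].$$ Flat forms: $\Omega^1_{\mathrm{flat}}(M,\mathfrak g)=\{\xi\in\Omega^1(M,\mathfrak g): d\xi-\tfrac12[\xi,\xi]^{\mathfrak g}_\wedge=0\}$. A Frölicher space is a set with a collection of smooth curves from $\mathbb R$ and smooth real functions determining each other by smoothness of all compositions; a map between Frölicher spaces is smooth if it maps smooth curves to smooth curves. $\Omega^1_{\mathrm{flat}}(M,\mathfrak g)$ carries the Frölicher structure generated by all curves $c:\mathbb R\to\Omega^1_{\mathrm{flat}}(M,\mathfrak g)$ which are smooth into the convenient vector space $\Omega^1(M,\mathfrak g)$, equivalently for which the associated map $\mathbb R\times TM\to\mathfrak g$ is smooth. $C^\infty(M,G)$ carries the canonical Frölicher structure generated by the functions $$C^\infty(M,G)\xrightarrow{C^\infty(c,f)}C^\infty(\mathbb R,\mathbb R)\xrightarrow{\lambda}\mathbb R,\qquad C^\infty(c,f)(k)=f\circ k\circ c,$$ for $c\in C^\infty(\mathbb R,M)$, $f\in C^\infty(G,\mathbb R)$ (or $f$ in a generating set of functions)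 and $\lambda\in C^\infty(\mathbb R,\mathbb R)'$ (a bounded linear functional). *)

(* Defs.v *)
From HB Require Import structures.
From mathcomp Require Import all_boot all_order all_algebra all_fingroup.
From mathcomp Require Import generic_quotient.
From mathcomp Require Import all_classical all_reals topology normedtype.

Set Implicit Arguments.
Unset Strict Implicit.
Unset Printing Implicit Defensive.

Import Order.TTheory GRing.Theory Num.Theory.
Import numFieldNormedType.Exports.

Local Open Scope classical_set_scope.
Local Open Scope ring_scope.
Local Open Scope quotient_scope.

(** * Smooth curves in locally convex spaces, convenient vector spaces

[tvsType R] is the type of locally convex spaces.  The derivatives of
[derive.v] are restricted to normed spaces, hence the definitions below. *)

Section curves.
Context {R : realType} {E : tvsType R}.
Implicit Types (c : R -> E) (t : R) (B : set E).

Definition is_cderiv c t (v : E) :=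
  h^-1 *: (c (t + h) - c t) @[h --> 0^'] --> v.

(* the derivative where it exists, 0 elsewhere *)
Definition cderiv c : R -> E := fun t => xget 0 [set v | is_cderiv c t v].

Definition cderivn n c : R -> E := iter n cderiv c.

(* meant for open [O] *)
Definition smooth_on (O : set R) c :=
  forall n t, O t -> exists v, is_cderiv (cderivn n c) t v.

Definition csmooth c := smooth_on setT c.

(* bounded = absorbed by every neighbourhood of 0 *)
Definition tvs_bounded B :=
  forall U : set E, nbhs 0 U ->
    exists2 r : R, 0 < r & B `<=` [set r *: y | y in U].

Definition mackey_cauchy (x : nat -> E) :=
  exists (B : set E) (mu : nat * nat -> R),
    [/\ tvs_bounded B, mu p @[p --> (\oo, \oo)] --> (0 : R) &
        forall m n, [set mu (m, n) *: b | b in B] (x m - x n)].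

Definition mackey_complete :=
  forall x : nat -> E, mackey_cauchy x -> exists l : E, x n @[n --> \oo] --> l.

(* the c^oo-topology: the final topology with respect to all smooth curves *)
Definition cinf_open (U : set E) :=
  forall c, csmooth c -> open (c @^-1` U).

Lemma cderivn_shift c t n :
  cderivn n (fun s => c (t + s)) = (fun s => cderivn n c (t + s)).
Proof.
elim: n => // n; rewrite /cderivn /= => ->.
apply/funext => s; rewrite /cderiv; congr (xget _ _).
apply/funext => v; rewrite /is_cderiv /=.
by under eq_fun do rewrite addrA.
Qed.

End curves.

Record convenient (R : realType) := Convenient {
  conv_sort :> tvsType R;
  conv_hausdorff : hausdorff_space conv_sort;
  conv_complete : @mackey_complete R conv_sort }.

Lemma smooth_cst (R : realType) (E : convenient R) O (x : E) :
  smooth_on O (fun _ : R => x).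
Proof.
have d0 (y : E) t : is_cderiv (fun _ => y) t 0.
  rewrite /is_cderiv; under eq_fun do rewrite subrr scaler0.
  exact: cvg_cst.
have dn n : exists y : E, cderivn n (fun _ : R => x) = fun _ => y.
  elim: n => [|n [y]]; first by exists x.
  rewrite /cderivn /= => ->; exists 0; apply/funext => t.
  rewrite /cderiv; case: xgetP => [v _|//].
  by move=> vP; exact: (cvg_unique (@conv_hausdorff _ E) vP (d0 y t)).
by move=> n t _; have [y ->] := dn n; exists 0.
Qed.

(** * The convenient vector space C^oo(R, E)

Its topology is that of uniform convergence of each derivative on compact
sets. *)

Section Cinf_line.
Context {R : realType} {E : tvsType R}.

Record cinf_line := CinfLine {
  cl_fun :> R -> E;
  cl_smooth : csmooth cl_fun }.

Definition cinf_cvg (f : R -> R -> E) (F : set_system R) (g : R -> E) :=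
  forall k (K : set R) (U : set E), compact K -> nbhs 0 U ->
    \forall h \near F, forall t, K t -> U (cderivn k (f h) t - cderivn k g t).

(* [D n] is the n-th derivative of the curve [c] in C^oo(R, E) *)
Definition cinf_line_smooth (c : R -> cinf_line) :=
  exists D : nat -> R -> cinf_line, D 0%N = c /\
    forall n s,
      cinf_cvg (fun h t => h^-1 *: (D n (s + h) t - D n s t)) 0^' (D n.+1 s).

Definition cinf_line_bounded (B : set cinf_line) :=
  forall k (K : set R), compact K ->
    tvs_bounded [set cderivn k (cl_fun f) t | f in B & t in K].

End Cinf_line.
Arguments cinf_line {R} E.

(* the elements of C^oo(R, R)' *)
Definition bounded_functional (R : realType) (l : cinf_line R^o -> R) :=
  (forall (a : R) (f g h : cinf_line R^o),
     (forall t, h t = a * f t + g t) -> l h = a * l f + l g) /\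
  (forall B, cinf_line_bounded B -> tvs_bounded ([set l f | f in B] : set R^o)).

(** * Manifolds modelled on convenient vector spaces

A chart is a total function whose values outside its domain are irrelevant. *)

Record atlas (R : realType) (T : Type) := Atlas {
  aidx : Type;
  amodel : aidx -> convenient R;
  adom : aidx -> set T;
  achart : forall i, T -> amodel i;
  achart_inv : forall i, amodel i -> T;
  acover : forall x, exists i, adom i x;
  achartK : forall i x, adom i x -> achart_inv (achart i x) = x;
  aimage_open : forall i j, cinf_open (achart i @` (adom i `&` adom j));
  atrans_smooth : forall i j (c : R -> amodel i),
    csmooth c -> range c `<=` achart i @` (adom i `&` adom j) ->
    csmooth (fun t => achart j (achart_inv (c t))) }.
Arguments adom {R T} a i _.
Arguments achart {R T} a i _.
Arguments achart_inv {R T} a i _.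

Definition mspace (R : realType) (T : Type) (A : atlas R T) : Type := T.

Section natural_topology.
Context (R : realType) (T : Type) (A : atlas R T).

HB.instance Definition _ := gen_eqMixin (mspace A).
HB.instance Definition _ := gen_choiceMixin (mspace A).

(* the identification topology with respect to the charts *)
Definition natural_open (V : set (mspace A)) :=
  forall i, cinf_open (achart A i @` (adom A i `&` V)).

Let natural_openT : natural_open setT.
Proof.
by move=> i; have := @aimage_open _ _ A i i; rewrite setIid setIT.
Qed.

Let natural_openI : setI_closed natural_open.
Proof.
move=> V W oV oW i c sc.
have -> : c @^-1` (achart A i @` (adom A i `&` (V `&` W))) =
    c @^-1` (achart A i @` (adom A i `&` V)) `&`
    c @^-1` (achart A i @` (adom A i `&` W)).
  apply/seteqP; split=> t /=.
    by move=> [x [dx [Vx Wx]] <-]; split; exists x.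
  move=> [[x [dx Vx] xt] [y [dy Wy] yt]]; exists x => //; split=> //; split=> //.
  suff -> : x = y by [].
  by rewrite -(achartK dx) -(achartK dy) xt yt.
by apply: openI; [exact: oV|exact: oW].
Qed.

Let natural_open_bigU (I : Type) (f : I -> set (mspace A)) :
  (forall i, natural_open (f i)) -> natural_open (\bigcup_i f i).
Proof.
move=> of_ i c sc.
have -> : c @^-1` (achart A i @` (adom A i `&` \bigcup_k f k)) =
    \bigcup_k (c @^-1` (achart A i @` (adom A i `&` f k))).
  apply/seteqP; split=> t /=.
    by move=> [x [dx [k _ fx]] xt]; exists k => //; exists x.
  by move=> [k _ [x [dx fx] xt]]; exists x => //; split=> //; exists k.
by apply: bigcup_open => k _; exact: of_.
Qed.

HB.instance Definition _ := isOpenTopological.Build (mspace A)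
  natural_openT natural_openI natural_open_bigU.

End natural_topology.

Record manifold (R : realType) := Manifold {
  msort :> Type;
  matlas : atlas R msort;
  manifold_hausdorff : hausdorff_space (mspace matlas) }.

Section manifold_notions.
Context {R : realType} (M : manifold R).

Definition chart_idx := aidx (matlas M).
Definition model (i : chart_idx) : convenient R := amodel i.
Definition chart_dom (i : chart_idx) : set M := adom (matlas M) i.
Definition chart (i : chart_idx) : M -> model i := achart (matlas M) i.
Definition chart_inv (i : chart_idx) : model i -> M :=
  @achart_inv _ _ (matlas M) i.

Definition mtop := mspace (matlas M).

(* simply connected, in the natural topology *)
Definition simply_connected :=
  let I := `[(0 : R), 1] in
  (forall x y : mtop, exists g : R -> mtop,
     [/\ {within [set` I], continuous g}, g 0 = x & g 1 = y]) /\
  (forall g : R -> mtop, {within [set` I], continuous g} -> g 0 = g 1 ->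
     exists H : R * R -> mtop,
       [/\ {within [set` I] `*` [set` I], continuous H},
           forall t, t \in I -> H (0, t) = g t,
           forall t, t \in I -> H (1, t) = g 0 &
           forall s, s \in I -> H (s, 0) = g 0 /\ H (s, 1) = g 0]).

Definition smooth_curve (c : R -> M) :=
  forall i, open (c @^-1` chart_dom i) /\
            smooth_on (c @^-1` chart_dom i) (fun t => chart i (c t)).

Record scurve := Scurve {
  sc_fun :> R -> M;
  sc_smooth : smooth_curve sc_fun }.

HB.instance Definition _ := gen_eqMixin scurve.
HB.instance Definition _ := gen_choiceMixin scurve.

Lemma smooth_curve_cst (x : M) : smooth_curve (fun _ => x).
Proof.
move=> i; split; last exact: smooth_cst.
have [xi|xi] := pselect (chart_dom i x).
  rewrite (_ : _ @^-1` _ = setT); first exact: openT.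
  by apply/seteqP; split.
rewrite (_ : _ @^-1` _ = set0); first exact: open0.
by apply/seteqP; split.
Qed.

Definition scst (x : M) := Scurve (smooth_curve_cst x).

Lemma smooth_curve_shift (c : R -> M) t :
  smooth_curve c -> smooth_curve (fun s => c (t + s)).
Proof.
move=> sc i; have [oc sci] := sc i; split.
  have : open ((fun s => t + s) @^-1` (c @^-1` chart_dom i)).
    apply: open_comp => // s _ /=.
    by apply: cvgD; [exact: cvg_cst|exact: cvg_id].
  exact.
move=> n s cs; rewrite (cderivn_shift (fun s => chart i (c s))).
have [v vP] := sci n (t + s) cs; exists v.
by move: vP; rewrite /is_cderiv; under eq_fun do rewrite -addrA.
Qed.

Definition sshift (c : scurve) t := Scurve (smooth_curve_shift t (sc_smooth c)).

(** Kinematic tangent bundle: velocities of smooth curves. *)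

Definition same_velocity (c c' : scurve) : bool :=
  `[< c 0 = c' 0 /\ forall i, chart_dom i (c 0) ->
      cderiv (fun t => chart i (c t)) 0 = cderiv (fun t => chart i (c' t)) 0 >].

Lemma same_velocity_refl : reflexive same_velocity.
Proof. by move=> c; apply/asboolP. Qed.

Lemma same_velocity_sym : symmetric same_velocity.
Proof.
move=> c c'; apply/asboolP/asboolP => -[c0 cc']; split=> // i.
  by rewrite -c0 => /cc'.
by rewrite -c0 => /cc'.
Qed.

Lemma same_velocity_trans : transitive same_velocity.
Proof.
move=> c c' c'' /asboolP[c0 cc'] /asboolP[c0' cc'']; apply/asboolP.
split=> [|i di]; first by rewrite c0.
by rewrite cc' // cc'' // -c0.
Qed.

Canonical same_velocity_equiv := EquivRel same_velocity
  same_velocity_refl same_velocity_sym same_velocity_trans.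

Definition tangent := {eq_quot same_velocity_equiv}.

HB.instance Definition _ := Choice.on tangent.
HB.instance Definition _ := EqQuotient.on tangent.

(* [velocity c t] is c'(t) *)
Definition velocity (c : scurve) (t : R) : tangent := \pi_tangent (sshift c t).

Definition tbase (z : tangent) : M := repr z 0.

(* the tangent map of [chart i]; meaningful when [chart_dom i (tbase z)] *)
Definition tchart (i : chart_idx) (z : tangent) : model i :=
  cderiv (fun t => chart i (repr z t)) 0.

(* the inverse of [tchart i] over the point with coordinate [y] *)
Definition tchart_inv (i : chart_idx) (y v : model i) : tangent :=
  xget (\pi_tangent (scst (chart_inv y)))
       [set z | tbase z = chart_inv y /\ tchart i z = v].

(* smooth curves of the manifold TM, whose charts are the [tchart i] *)
Definition tsmooth_curve (z : R -> tangent) :=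
  smooth_curve (tbase \o z) /\
  forall i, smooth_on ((tbase \o z) @^-1` chart_dom i) (tchart i \o z).

(** Differential forms. *)

(* [z3] = [a z1 + z2] in the tangent space at [x] *)
Definition tangent_lincomb (x : M) (a : R) (z1 z2 z3 : tangent) :=
  [/\ tbase z1 = x, tbase z2 = x, tbase z3 = x &
      forall i, chart_dom i x -> tchart i z3 = a *: tchart i z1 + tchart i z2].

Definition one_form (E : convenient R) (w : tangent -> E) :=
  (forall x a z1 z2 z3,
     tangent_lincomb x a z1 z2 z3 -> w z3 = a *: w z1 + w z2) /\
  (forall z, tsmooth_curve z -> csmooth (w \o z)).

(* the exterior derivative of [w] in the chart [i], which at a point y is
   d(w_i(.) v2)(y)(v1) - d(w_i(.) v1)(y)(v2) *)
Definition ext_d (E : convenient R) (i : chart_idx) (w : tangent -> E)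
    (z1 z2 : tangent) : E :=
  let y := chart i (tbase z1) in
  let v1 := tchart i z1 in
  let v2 := tchart i z2 in
  cderiv (fun s => w (tchart_inv (y + s *: v1) v2)) 0
  - cderiv (fun s => w (tchart_inv (y + s *: v2) v1)) 0.

(* [phi, psi]_wedge for forms of degrees p and q with values in an algebra
   with product [br] *)
Definition wedge_bracket (E : convenient R) (br : E -> E -> E) (p q : nat)
    (phi : ('I_p -> tangent) -> E) (psi : ('I_q -> tangent) -> E) :
    ('I_(p + q) -> tangent) -> E :=
  fun z => ((p`! * q`!)%N%:R)^-1 *:
    \sum_(s : 'S_(p + q)) (-1) ^+ s *:
      br (phi (fun a => z (s (lshift q a)))) (psi (fun b => z (s (rshift p b)))).

End manifold_notions.

Arguments chart_idx {R} M.
Arguments chart_dom {R M} i _.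
Arguments chart {R M} i _.
Arguments chart_inv {R M} i _.
Arguments tchart {R M} i z.
Arguments tchart_inv {R M} i y v.
Arguments ext_d {R M E} i w z1 z2.

(** Smooth mappings. *)

Record smap (R : realType) (M N : manifold R) := Smap {
  sm_fun :> M -> N;
  sm_smooth : forall c, smooth_curve c -> smooth_curve (sm_fun \o c) }.

Section smooth_mappings.
Context {R : realType}.
Implicit Types M N P : manifold R.

Definition push M N (f : smap M N) (c : scurve M) : scurve N :=
  Scurve (sm_smooth f (sc_smooth c)).

(* the tangent map Tf *)
Definition tmap M N (f : smap M N) (z : tangent M) : tangent N :=
  \pi_(tangent N) (push f (repr z)).

Definition smap_id M : smap M M := @Smap R M M id (fun c sc => sc).

Definition smap_comp M N P (g : smap N P) (f : smap M N) : smap M P :=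
  @Smap R M P (g \o f) (fun c sc => sm_smooth g (sm_smooth f sc)).

(* smooth functions M -> R *)
Record sfun M := Sfun {
  sf_fun :> M -> R^o;
  sf_smooth : forall c : R -> M, smooth_curve c -> csmooth (sf_fun \o c) }.

End smooth_mappings.

(** * Lie groups *)

Record lie_group (R : realType) := LieGroup {
  lg_group : groupType;
  lg_atlas : atlas R lg_group;
  lg_hausdorff : hausdorff_space (mspace lg_atlas);
  lg_manifold := Manifold lg_hausdorff : manifold R;
  lg_mul_smooth : forall c1 c2 : R -> lg_group,
    @smooth_curve R lg_manifold c1 -> @smooth_curve R lg_manifold c2 ->
    @smooth_curve R lg_manifold (fun t => (c1 t * c2 t)%g);
  lg_inv_smooth : forall c : R -> lg_group,
    @smooth_curve R lg_manifold c ->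
    @smooth_curve R lg_manifold (fun t => (c t)^-1%g) }.

Coercion lg_manifold : lie_group >-> manifold.

Section lie_groups.
Context {R : realType} (G : lie_group R).

Definition lg_one : G := (1 : lg_group G)%g.
Definition lg_mul (x y : G) : G := ((x : lg_group G) * (y : lg_group G))%g.
Definition lg_inv (x : G) : G := ((x : lg_group G)^-1)%g.

Lemma ltrans_smooth (a : G) (c : R -> G) :
  smooth_curve c -> smooth_curve (lg_mul a \o c).
Proof. exact: lg_mul_smooth (@smooth_curve_cst R G a). Qed.

Lemma rtrans_smooth (a : G) (c : R -> G) :
  smooth_curve c -> smooth_curve (lg_mul^~ a \o c).
Proof. by move=> sc; exact: lg_mul_smooth sc (@smooth_curve_cst R G a). Qed.

(* the translations mu_a and mu^a *)
Definition ltrans (a : G) : smap G G := Smap (@ltrans_smooth a).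
Definition rtrans (a : G) : smap G G := Smap (@rtrans_smooth a).

(* The Lie algebra T_e G is identified with the model space of a chart at e
   by the tangent map [of_Te] of that chart. *)
Definition unit_chart : chart_idx G := projT1 (cid (acover (matlas G) lg_one)).
Definition Lie : convenient R := model unit_chart.
Definition of_Te (z : tangent G) : Lie := tchart unit_chart z.
Definition to_Te (X : Lie) : tangent G :=
  tchart_inv unit_chart (chart unit_chart lg_one) X.

(* the left invariant field of X, in the chart at e *)
Definition left_field (X : Lie) (y : Lie) : Lie :=
  tchart unit_chart (tmap (ltrans (chart_inv unit_chart y)) (to_Te X)).

(* the value at e of the bracket of vector fields [L_X, L_Y], which in a chart
   is dL_Y(L_X) - dL_X(L_Y) *)
Definition lie_bracket (X Y : Lie) : Lie :=
  let y0 := chart unit_chart lg_one in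
  cderiv (fun s : R => left_field Y (y0 + s *: X)) 0
  - cderiv (fun s : R => left_field X (y0 + s *: Y)) 0.

Definition maurer_cartan (z : tangent G) : Lie :=
  of_Te (tmap (rtrans (lg_inv (tbase z))) z).

Definition rlog_deriv (M : manifold R) (f : smap M G) (z : tangent M) : Lie :=
  maurer_cartan (tmap f z).

(* g(0) = e and g'(t) = T_e(mu^g(t)).X(t) *)
Definition evolves (X : cinf_line Lie) (g : scurve G) :=
  g 0 = lg_one /\ forall t, velocity g t = tmap (rtrans (g t)) (to_Te (X t)).

(* smooth mappings send smooth curves in C^oo(R, Lie G) to smooth curves *)
Definition regular :=
  exists evol : cinf_line Lie -> G,
    (forall X, exists2 g : scurve G, evolves X g & evol X = g 1) /\
    (forall c, cinf_line_smooth c -> smooth_curve (evol \o c)).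

(* d xi - 1/2 [xi, xi]_wedge = 0 *)
Definition flat (M : manifold R) (xi : tangent M -> Lie) :=
  let xi1 := fun z : 'I_1 -> tangent M => xi (z ord0) in
  forall (z1 z2 : tangent M) (i : chart_idx M),
    tbase z1 = tbase z2 -> chart_dom i (tbase z1) ->
    ext_d i xi z1 z2
    - 2^-1 *: wedge_bracket lie_bracket xi1 xi1
                (fun a : 'I_(1 + 1) => if a == ord0 then z1 else z2) = 0.

Record flat_form (M : manifold R) := FlatForm {
  ff_fun :> tangent M -> Lie;
  ff_form : one_form ff_fun;
  ff_flat : flat ff_fun }.

End lie_groups.

Arguments lg_one {R} G.
Arguments of_Te {R} G z.
Arguments to_Te {R} G X.

Record lie_hom (R : realType) (G H : lie_group R) := LieHom {
  lh_map :> smap G H;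
  lh_morph : {morph lh_map : x y / lg_mul x y} }.

(* phi' = T_e phi *)
Definition lie_hom' (R : realType) (G H : lie_group R) (phi : lie_hom G H)
    (X : Lie G) : Lie H :=
  of_Te H (tmap phi (to_Te G X)).

Definition lie_hom_id (R : realType) (G : lie_group R) : lie_hom G G :=
  @LieHom R G G (smap_id G) (fun _ _ => erefl).

Lemma lie_hom_comp_morph (R : realType) (G H K : lie_group R)
    (psi : lie_hom H K) (phi : lie_hom G H) :
  {morph smap_comp psi phi : x y / lg_mul x y}.
Proof. by move=> x y /=; rewrite !lh_morph. Qed.

Definition lie_hom_comp (R : realType) (G H K : lie_group R)
    (psi : lie_hom H K) (phi : lie_hom G H) : lie_hom G K :=
  LieHom (@lie_hom_comp_morph R G H K psi phi).

Record reg_lie_group (R : realType) := RegLieGroup {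
  rl_group :> lie_group R;
  rl_regular : regular rl_group }.

(** * Simply connected pointed manifolds *)

Record sc_manifold (R : realType) := ScManifold {
  scm_manifold :> manifold R;
  scm_pt : scm_manifold;
  scm_sc : simply_connected scm_manifold }.

Record pt_map (R : realType) (N M : sc_manifold R) := PtMap {
  pt_fun :> smap N M;
  pt_base : pt_fun (scm_pt N) = scm_pt M }.

Definition pt_map_id (R : realType) (M : sc_manifold R) : pt_map M M :=
  @PtMap R M M (smap_id M) erefl.

Lemma pt_map_comp_pt (R : realType) (P N M : sc_manifold R)
    (h : pt_map N M) (k : pt_map P N) :
  smap_comp h k (scm_pt P) = scm_pt M.
Proof. by rewrite /= !pt_base. Qed.

Definition pt_map_comp (R : realType) (P N M : sc_manifold R)
    (h : pt_map N M) (k : pt_map P N) : pt_map P M :=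
  PtMap (@pt_map_comp_pt R P N M h k).

(** * Frölicher spaces *)

Record frolicher (R : realType) := Frolicher {
  fr_sort :> Type;
  fr_curves : set (R -> fr_sort);
  fr_funs : set (fr_sort -> R^o);
  fr_curvesE : fr_curves =
    [set c : R -> fr_sort | forall f, fr_funs f -> csmooth (f \o c)];
  fr_funsE : fr_funs =
    [set f : fr_sort -> R^o | forall c, fr_curves c -> csmooth (f \o c)] }.

Definition fr_smooth (R : realType) (X Y : frolicher R) (f : X -> Y) :=
  forall c, fr_curves c -> fr_curves (f \o c).

Section generated.
Context {R : realType} {T : Type}.

Definition funs_of (C : set (R -> T)) : set (T -> R^o) :=
  [set f : T -> R^o | forall c, C c -> csmooth (f \o c)].
Definition curves_of (F : set (T -> R^o)) : set (R -> T) :=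
  [set c : R -> T | forall f, F f -> csmooth (f \o c)].

Lemma funs_curves_funs C : funs_of C = funs_of (curves_of (funs_of C)).
Proof.
apply/seteqP; split=> f Ff c cc; first exact: cc.
by apply: Ff => g; exact.
Qed.

Lemma curves_funs_curves F : curves_of F = curves_of (funs_of (curves_of F)).
Proof.
apply/seteqP; split=> c cc f Ff; first exact: Ff.
by apply: cc => g; exact.
Qed.

Definition frolicher_of_curves (C : set (R -> T)) : frolicher R :=
  @Frolicher R T (curves_of (funs_of C)) (funs_of C) erefl (funs_curves_funs C).

Definition frolicher_of_funs (F : set (T -> R^o)) : frolicher R :=
  @Frolicher R T (curves_of F) (funs_of (curves_of F))
    (curves_funs_curves F) erefl.

End generated.

Section functor_objects.
Context {R : realType}.

(* the curves whose associated map R x TM -> Lie G is smooth *)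
Definition Omega_curves (M : manifold R) (G : lie_group R) :
    set (R -> flat_form G M) :=
  [set c | forall (r : R -> R^o) (z : R -> tangent M),
     csmooth r -> tsmooth_curve z -> csmooth (fun t => c (r t) (z t))].

Definition Omega_flat (M : manifold R) (G : lie_group R) : frolicher R :=
  frolicher_of_curves (@Omega_curves M G).

(* f o k o c *)
Definition Cinf_probe (M G : manifold R) (c : scurve M) (f : sfun G)
    (k : smap M G) : cinf_line R^o :=
  CinfLine (sf_smooth f (sm_smooth k (sc_smooth c))).

Definition Cinf_funs (M G : manifold R) : set (smap M G -> R^o) :=
  [set F | exists (c : scurve M) (f : sfun G) (l : cinf_line R^o -> R),
     bounded_functional l /\ F = fun k => l (Cinf_probe c f k)].

Definition Cinf (M G : manifold R) : frolicher R :=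
  frolicher_of_funs (@Cinf_funs M G).

(* phi' o h^* xi *)
Definition Omega_pull (M N : manifold R) (G H : lie_group R)
    (h : smap N M) (phi : lie_hom G H) (xi : tangent M -> Lie G) :
    tangent N -> Lie H :=
  fun z => lie_hom' phi (xi (tmap h z)).

(* phi o f o h *)
Definition Cinf_map (M N G H : manifold R) (h : smap N M) (phi : smap G H)
    (f : Cinf M G) : Cinf N H :=
  smap_comp phi (smap_comp (f : smap M G) h).

Definition is_Evol (M : sc_manifold R) (G : reg_lie_group R)
    (E : Omega_flat M G -> Cinf M G) :=
  [/\ fr_smooth E,
      forall xi : flat_form G M, rlog_deriv (E xi : smap M G) = xi &
      forall xi : flat_form G M, (E xi : smap M G) (scm_pt M) = lg_one G].

End functor_objects.

Section functors.
Context {R : realType}.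

(* the action on morphisms of a functor to Frölicher spaces, contravariant in
   the manifold and covariant in the group *)
Definition functorial (F : sc_manifold R -> reg_lie_group R -> frolicher R)
    (Fmap : forall (M N : sc_manifold R) (G H : reg_lie_group R),
       pt_map N M -> lie_hom G H -> F M G -> F N H) :=
  [/\ forall (M N : sc_manifold R) (G H : reg_lie_group R)
          (h : pt_map N M) (phi : lie_hom G H),
        fr_smooth (Fmap M N G H h phi),
      forall (M : sc_manifold R) (G : reg_lie_group R) (x : F M G),
        Fmap M M G G (pt_map_id M) (lie_hom_id G) x = x &
      forall (M N P : sc_manifold R) (G H K : reg_lie_group R)
          (h : pt_map N M) (k : pt_map P N)
          (phi : lie_hom G H) (psi : lie_hom H K) (x : F M G),
        Fmap M P G K (pt_map_comp h k) (lie_hom_comp psi phi) x =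
        Fmap N P H K k psi (Fmap M N G H h phi x)].

Definition Cinf_fmap (M N : sc_manifold R) (G H : reg_lie_group R)
    (h : pt_map N M) (phi : lie_hom G H) : Cinf M G -> Cinf N H :=
  Cinf_map h phi.

End functors.

(* Main.v *)
Require Import Defs.
From HB Require Import structures.
From mathcomp Require Import all_boot all_order all_algebra all_fingroup.
From mathcomp Require Import generic_quotient.
From mathcomp Require Import all_classical all_reals topology normedtype.
From mathcomp Require Import convex interval_inference sequences derive realfun exp ring lra.

(** A flat form [xi] is integrated along rays.  In a chart that is star-shaped
about x, put f(y) = evol(t |-> xi(c'(t))), where c is the ray from x to y.
Applied to the family of rays over a curve, the Maurer-Cartan equation shows
that the defect of delta^r f = xi satisfies a homogeneous linear equation along
each ray and vanishes at x; so f is a local solution, it is unique up to right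
multiplication by a constant, and it depends smoothly on [xi] since evol is
smooth.  Developing local solutions along continuous paths gives the same value
on both sides of every small square, hence on homotopic paths, so that on a
simply connected manifold the local solutions fit together.  Smoothness of Evol
at a point propagates along paths through the local formula
Evol(xi)(y) = f(y) Evol(xi)(x), and naturality follows from uniqueness.

The differential calculus rests on mappings of the plane that are smooth along
smooth curves: the special curve lemma makes their iterated directional
derivatives locally bounded, and mixed derivatives are expressed by directional
ones through an identity between finite differences. *)

Set Implicit Arguments.
Unset Strict Implicit.
Unset Printing Implicit Defensive.

Import Order.TTheory GRing.Theory Num.Theory.
Import numFieldNormedType.Exports.

Local Open Scope classical_set_scope.
Local Open Scope ring_scope.

(** A smooth mapping between convenient spaces need not be continuous for the locally convex
    topologies, and no general existence or uniqueness theorem for differential equations holds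
    there. Existence therefore comes only from regularity, and uniqueness from the group: if [g] and
    [h] have the same logarithmic derivative, then h^-1 g has logarithmic derivative 0 and is
    constant. As smoothness is tested along curves, statements about manifolds are pulled back to
    maps of one or two real variables, and the open sets in use are those whose preimages under
    smooth curves are open. Homotopies are only continuous, so no differential equation can be
    written along them; a [lift] of a path records instead that its increments are those of local
    solutions. The Frölicher structure on the mapping space is generated by functionals that are
    merely bounded; they are applied to second order Taylor remainders, which form a bounded set.
    Flatness of a pulled back form is not computed: such a form is the logarithmic derivative of a
    composite of mappings. *)

(* The tactic [lmod_with] below reduces, by reflection, a linear identity in a
   module to the equality of the coefficients. *)
Section linear_expressions.
Context {R : pzRingType} {E : lmodType R}.

Inductive lexp :=
  | LAtom of nat | LZero | LAdd of lexp & lexp | LOpp of lexp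
  | LScale of R & lexp.

Fixpoint leval (s : seq E) e : E :=
  match e with
  | LAtom n => nth 0 s n
  | LZero => 0
  | LAdd a b => leval s a + leval s b
  | LOpp a => - leval s a
  | LScale c a => c *: leval s a
  end.

Fixpoint lcoef e n : R :=
  match e with
  | LAtom m => if Nat.eqb m n then 1 else 0
  | LZero => 0
  | LAdd a b => lcoef a n + lcoef b n
  | LOpp a => - lcoef a n
  | LScale c a => c * lcoef a n
  end.

Fixpoint lequal e1 e2 n :=
  if n is k.+1 then lequal e1 e2 k /\ lcoef e1 k = lcoef e2 k else True.

Lemma leval_coef s e : leval s e = \sum_(i < size s) lcoef e i *: s`_i.
Proof.
elim: e => [n||a IHa b IHb|a IHa|c a IHa] /=; rewrite ?IHa ?IHb.
- have [ns|sn] := ltnP n (size s).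
    rewrite (bigD1 (Ordinal ns)) //= PeanoNat.Nat.eqb_refl scale1r big1 ?addr0 //.
    move=> i; case: (PeanoNat.Nat.eqb_spec n i) => [ni|_ _]; last exact: scale0r.
    by case/eqP; apply: val_inj.
  rewrite nth_default // big1 // => i _.
  case: (PeanoNat.Nat.eqb_spec n i) => [ni|_]; last exact: scale0r.
  by have := ltn_ord i; rewrite -ni ltnNge sn.
- by rewrite big1 // => i _; exact: scale0r.
- by rewrite -big_split /=; apply: eq_bigr => i _; rewrite scalerDl.
- by rewrite -sumrN; apply: eq_bigr => i _; rewrite scaleNr.
- by rewrite scaler_sumr; apply: eq_bigr => i _; rewrite scalerA.
Qed.

Lemma lequalP s e1 e2 : lequal e1 e2 (size s) -> leval s e1 = leval s e2.
Proof.
move=> e12; rewrite !leval_coef; apply: eq_bigr => i _; congr (_ *: _).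
move: (nat_of_ord i) (ltn_ord i) => k.
elim: (size s) e12 => // n IH [/IH {}IH en].
by rewrite ltnS leq_eqVlt => /predU1P[->|].
Qed.

End linear_expressions.

Ltac lmod_mem x l :=
  lazymatch l with
  | nil => constr:(false)
  | x :: _ => constr:(true)
  | _ :: ?l' => lmod_mem x l'
  end.
Ltac lmod_index x l :=
  lazymatch l with
  | x :: _ => constr:(O)
  | _ :: ?l' => let n := lmod_index x l' in constr:(S n)
  end.
Ltac lmod_atoms l t :=
  lazymatch t with
  | @GRing.add _ ?a ?b => let l' := lmod_atoms l a in lmod_atoms l' b
  | @GRing.opp _ ?a => lmod_atoms l a
  | @GRing.scale _ _ ?c ?a => lmod_atoms l a
  | @GRing.zero _ => l
  | _ => lazymatch lmod_mem t l with true => l | false => constr:(t :: l) end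
  end.
Ltac lmod_reify R l t :=
  lazymatch t with
  | @GRing.add _ ?a ?b =>
    let a' := lmod_reify R l a in let b' := lmod_reify R l b in
    constr:(@LAdd R a' b')
  | @GRing.opp _ ?a => let a' := lmod_reify R l a in constr:(@LOpp R a')
  | @GRing.scale _ _ ?c ?a =>
    let a' := lmod_reify R l a in constr:(@LScale R c a')
  | @GRing.zero _ => constr:(@LZero R)
  | _ => let n := lmod_index t l in constr:(@LAtom R n)
  end.
Ltac lmod_with R E :=
  lazymatch goal with |- @eq _ ?a ?b =>
    let l := lmod_atoms (@nil E) a in let l := lmod_atoms l b in
    let a' := lmod_reify R l a in let b' := lmod_reify R l b in
    change (@leval R E l a' = @leval R E l b');
    apply: lequalP; cbv [lequal lcoef size Nat.eqb]; repeat split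
  end.

(** * Induction over intervals and continuous seminorms *)

Structure htvs (R : realType) := Htvs {
  htvs_tvs :> tvsType R;
  htvs_hausdorff : hausdorff_space htvs_tvs }.
(** The two canonical instances let one calculus serve both convenient spaces and the real line
    [R^o]. *)
Canonical htvs_conv (R : realType) (E : convenient R) : htvs R :=
  Htvs (@conv_hausdorff R E).
Canonical htvs_R (R : realType) : htvs R :=
  @Htvs R (GRing_regular__canonical__tvs_Tvs R) (@norm_hausdorff R R^o).

(** Compactness of an interval as an induction principle: a relation between endpoints that is
    additive over adjacent intervals and holds on all small intervals around each point holds on the
    whole interval. It replaces subdivisions and Lebesgue numbers everywhere below. The proof takes
    the supremum of the points reached from [a]. *)
Lemma cousin (R : realType) (a b : R) (P : R -> R -> Prop) : a <= b ->
  (forall x y z, a <= x -> x <= y -> y <= z -> z <= b ->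
     P x y -> P y z -> P x z) ->
  (forall t, a <= t -> t <= b -> exists2 d, 0 < d &
     forall x y, a <= x -> x <= t -> t <= y -> y <= b ->
       t - d < x -> y < t + d -> P x y) ->
  P a b.
Proof.
move=> ab Pt Pl.
have Paa : P a a.
  have [d d0 /(_ a a)] := Pl a (lexx a) ab.
  by apply=> //; lra.
pose S := [set y | [/\ a <= y, y <= b & P a y]].
have Sa : S a by split.
have hS : has_sup S by split; [exists a | exists b => y []].
set c := sup S.
have ac : a <= c by apply: sup_upper_bound.
have cb : c <= b by apply: ge_sup; [exists a | move=> y []].
have [d d0 Pd] := Pl c ac cb.
have Pac : P a c.
  have [y [ay yb Py] cy] := sup_adherent d0 hS.
  have yc : y <= c by apply: sup_upper_bound => //; split.
  by apply: (Pt a y c) => //; apply: Pd => //; rewrite -/c; lra.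
case: (ltP c b) => [cb'|bc]; last first.
  by have -> : b = c by apply/le_anti; rewrite cb bc.
have := ltxx c; suff -> : c < c by [].
(* A reachable point strictly beyond the supremum [c], unless [c] is already [b]. *)
pose y := Num.min b (c + d / 2).
have cy : c < y by rewrite lt_min cb' /=; lra.
apply: (lt_le_trans cy); apply: sup_upper_bound => //.
have yb : y <= b by rewrite ge_min lexx.
split; [lra | by [] |].
apply: (Pt a c y) => //; first exact: ltW.
apply: Pd => //; [exact: ltW | lra |].
have : y <= c + d / 2 by rewrite ge_min lexx orbT.
by rewrite -/c; lra.
Qed.

Section seminorms.
Context {R : realType} {E : tvsType R}.

(** All estimates are made with continuous seminorms rather than neighbourhoods; continuity at 0 is
    enough to state, by subadditivity, and local convexity supplies enough of them ([csn_ex]). *)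
Record csn := Csn {
  csn_fun :> E -> R;
  csnD : forall x y, csn_fun (x + y) <= csn_fun x + csn_fun y;
  csnZ : forall a x, csn_fun (a *: x) = `|a| * csn_fun x;
  csn_nbhs : forall e, 0 < e -> nbhs 0 [set x | csn_fun x < e] }.

Implicit Types p : csn.

Lemma csn0 p : p 0 = 0.
Proof. by rewrite -(scale0r 0) csnZ normr0 mul0r. Qed.

Lemma csnN p x : p (- x) = p x.
Proof. by rewrite -scaleN1r csnZ normrN normr1 mul1r. Qed.

Lemma csnB p x y : p (x - y) <= p x + p y.
Proof. by rewrite -(csnN p y) csnD. Qed.

Lemma csnC p x y : p (x - y) = p (y - x).
Proof. by rewrite -csnN opprB. Qed.

Lemma csn_ge0 p x : 0 <= p x.
Proof. by have := csnB p x x; rewrite subrr csn0; lra. Qed.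

Lemma csn_tri p x y z : p (x - z) <= p (x - y) + p (y - z).
Proof. by rewrite -[x - z](subrKA y) csnD. Qed.

Section gauge.
Variable W : set E.
Hypotheses (W0 : nbhs 0 W)
  (Wc : forall x y (t : R), 0 <= t -> t <= 1 -> W x -> W y -> W (t *: x + (1 - t) *: y))
  (WN : forall x, W x -> W (- x)).

(** With [g], this is the Minkowski functional of the absolutely convex neighbourhood [W]. *)
Let A x := [set r : R | 0 < r /\ W (r^-1 *: x)].
Let g x := inf (A x).

Let A_ex x : A x !=set0.
Proof.
have := @scale_continuous R E (0, x) W; rewrite /= scale0r => /(_ W0).
move=> [[B1 B2] [/= b1 b2] BW].
have [d' d0' dB] := (nbhs_ballP _ _).1 b1.
pose d : R := d'; have d0 : 0 < d := d0'.
exists (d / 2)^-1; split; first by rewrite invr_gt0; lra.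
rewrite invrK; apply: (BW (d / 2, x)); split => /=; last exact: nbhs_singleton.
by apply: dB; rewrite /ball /= sub0r normrN -/d gtr0_norm; lra.
Qed.

Let A_lb x : has_inf (A x).
Proof. by split=> //; exists 0 => r [/ltW]. Qed.

Let Wz : W 0. Proof. exact: nbhs_singleton. Qed.

Let g_lt x (r : R) : g x < r -> A x r.
Proof.
move=> gr; have e0 : 0 < r - g x by rewrite subr_gt0.
have [s [s0 Ws] sr] := inf_adherent e0 (A_lb x).
have {}sr : s < r by move: sr; rewrite /g; lra.
have r0 : 0 < r by exact: lt_trans sr.
split=> //.
have -> : r^-1 *: x = (s / r) *: (s^-1 *: x) + (1 - s / r) *: 0.
  rewrite scaler0 addr0 scalerA mulrAC divff ?mul1r //; exact: lt0r_neq0.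
apply: Wc => //; first by apply: divr_ge0; exact: ltW.
by rewrite ler_pdivrMr // mul1r ltW.
Qed.

Let g_le x (r : R) : A x r -> g x <= r.
Proof. by move=> Ar; apply: ge_inf => //; have [] := A_lb x. Qed.

Let g_ge0 x : 0 <= g x.
Proof. by apply: lb_le_inf => // r [/ltW]. Qed.

Let gD x y : g (x + y) <= g x + g y.
Proof.
apply/ler_addgt0Pr => e e0.
have [r0 Wr] : A x (g x + e / 2) by apply: g_lt; lra.
have [s0 Ws] : A y (g y + e / 2) by apply: g_lt; lra.
apply: g_le; set r := g x + e / 2 in r0 Wr; set s := g y + e / 2 in s0 Ws.
have -> : g x + g y + e = r + s by rewrite /r /s; field.
split; first exact: addr_gt0.
have rs : r + s != 0 by apply/lt0r_neq0/addr_gt0.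
have rn := lt0r_neq0 r0; have sn := lt0r_neq0 s0.
have -> : (r + s)^-1 *: (x + y) =
    (r / (r + s)) *: (r^-1 *: x) + (1 - r / (r + s)) *: (s^-1 *: y).
  by rewrite !scalerA scalerDr; congr (_ *: _ + _ *: _); field; rewrite ?rn ?sn rs.
apply: Wc => //; first by apply: divr_ge0; lra.
have rs0 := addr_gt0 r0 s0.
by rewrite ler_pdivrMr // mul1r; lra.
Qed.

Let gZle a x : a != 0 -> g (a *: x) <= `|a| * g x.
Proof.
move=> a0; have na : 0 < `|a| by rewrite normr_gt0.
rewrite mulrC -ler_pdivrMr //; apply/ler_addgt0Pr => e e0.
rewrite ler_pdivrMr //.
have [r0 Wr] : A x (g x + e) by apply: g_lt; lra.
set r := g x + e in r0 Wr *; apply: g_le; split; first exact: mulr_gt0.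
rewrite scalerA invfM.
case: (ltP 0 a) => [a1|a1].
  by rewrite (gtr0_norm a1) -mulrA mulVf // mulr1.
by rewrite (ler0_norm a1) invrN mulrN mulNr -mulrA mulVf // mulr1 scaleNr; exact: WN.
Qed.

Let gZ a x : g (a *: x) = `|a| * g x.
Proof.
have [->|a0] := eqVneq a 0.
  rewrite scale0r normr0 mul0r; apply/le_anti; rewrite g_ge0 andbT.
  apply/ler_addgt0Pr => e e0; apply: g_le; split; first by lra.
  by rewrite scaler0.
apply/le_anti; rewrite gZle //=.
have na : 0 < `|a| by rewrite normr_gt0.
rewrite mulrC -ler_pdivlMr // mulrC -normfV.
have := @gZle a^-1 (a *: x); rewrite scalerA mulVf // scale1r; apply.
by rewrite invr_eq0.
Qed.

Let g_nbhs e : 0 < e -> nbhs 0 [set x | g x < e].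
Proof.
move=> e0; have e2 : e / 2 != 0 by apply/lt0r_neq0; lra.
apply: filterS (nbhs0Z e2 W0) => _ [w Ww <-] /=.
apply: (@le_lt_trans _ _ (e / 2)); last lra.
apply: g_le; split; first by lra.
by rewrite scalerA mulVf // scale1r.
Qed.

Lemma gauge_ex : exists p, forall x, p x < 1 -> W x.
Proof.
exists (Csn gD gZ g_nbhs) => x /= /g_lt [_]; by rewrite invr1 scale1r.
Qed.

End gauge.

Lemma csn_ex (U : set E) : nbhs 0 U -> exists p, forall x, p x < 1 -> U x.
Proof.
move=> U0; have [B Bc [Bo Bb]] := @locally_convex R E.
have [V [BV V0] VU] := Bb 0 U U0.
have nV : nbhs 0 V by apply: open_nbhs_nbhs; split=> //; exact: Bo.
have cV (x y : E) (t : R) : 0 <= t -> t <= 1 -> V x -> V y -> V (t *: x + (1 - t) *: y).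
  move=> t0 t1 Vx Vy; have /Bc cB : V \in B by rewrite inE.
  have := cB x y (Itv01 t0 t1); rewrite !inE /=; exact.
(* Intersecting with the opposite set gives the symmetry under x -> -x that homogeneity of the gauge
   requires. *)
pose W := V `&` [set - x | x in V].
have [|x y t t0 t1 [Vx [x' Vx' xe]] [Vy [y' Vy' ye]]|x [Vx [y Vy yx]]|p pW] :=
  @gauge_ex W.
- by apply: filterI => //; exact: nbhs0N.
- split; first exact: cV.
  exists (t *: x' + (1 - t) *: y'); first exact: cV.
  by rewrite opprD -!scalerN xe ye.
- by split; [rewrite -yx opprK | exists x].
- by exists p => x /pW [/VU].
Qed.

Lemma csn_eq0 (HE : hausdorff_space E) x : (forall p, p x = 0) -> x = 0.
Proof.
move=> px; apply: HE => A B xA B0.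
have [p pA] : exists p, forall z, p z < 1 -> A (x + z).
  have h := nbhsB (- x) xA; rewrite addNr in h; apply: csn_ex.
  by apply: filterS h => _ [z Az <-] /=; rewrite addNKr.
exists 0; split; last exact: nbhs_singleton.
by have := pA (- x); rewrite subrr csnN px ltr01; exact.
Qed.

End seminorms.
Arguments csn {R} E.

Lemma csn_norm_subproof (R : realType) e : 0 < e ->
  nbhs (0 : R^o) [set x : R^o | `|x| < e].
Proof.
by move=> e0; apply/nbhs_ballP; exists e => // y; rewrite /ball /= sub0r normrN.
Qed.

Definition csn_norm (R : realType) : csn R^o :=
  @Csn R R^o (fun x => `|x|) (@ler_normD R R^o) (@normrM R)
  (@csn_norm_subproof R).

Lemma near0P (R : realType) (P : R -> Prop) :
  (\forall h \near 0^', P h) <->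
  exists2 d : R, 0 < d & forall h : R, `|h| < d -> h != 0 -> P h.
Proof.
split=> [/nbhs_ballP [d d0 H]|[d d0 H]].
  by exists d => // h hd h0; apply: H => //; rewrite /ball /= sub0r normrN.
apply/nbhs_ballP; exists d => // h.
by rewrite /ball /= sub0r normrN => hd h0; exact: H.
Qed.

Lemma nearP (R : realType) (t : R) (P : R -> Prop) :
  (\forall s \near t, P s) <->
  exists2 d : R, 0 < d & forall h : R, `|h| < d -> P (t + h).
Proof.
split=> [/nbhs_ballP [d d0 H]|[d d0 H]].
  by exists d => // h hd; apply: H; rewrite /ball /= opprD addNKr normrN.
apply/nbhs_ballP; exists d => // s.
by rewrite /ball /= distrC => /H; rewrite subrKC.
Qed.

(** * Derivatives of curves in locally convex spaces *)

Section derivatives.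
Context {R : realType} {E : tvsType R}.
Implicit Types (f g : R -> E) (t : R) (p : csn E).

(** The derivative in remainder form, one seminorm at a time. Multiplying through by [h] removes the
    division and the punctured neighbourhood, so [h = 0] is no special case. *)
Definition der f t (v : E) := forall p (e : R), 0 < e ->
  exists2 d : R, 0 < d &
    forall h : R, `|h| < d -> p (f (t + h) - f t - h *: v) <= e * `|h|.

Lemma derP f t v : is_cderiv f t v <-> der f t v.
Proof.
split=> [fv p e e0|fv].
  have U0 : nbhs v [set y | p (y - v) < e].
    have := nbhsT v (csn_nbhs p e0); apply: filterS => _ [y py <-] /=.
    by rewrite addrAC subrr add0r.
  have /near0P [d d0 H] := fv _ U0.
  exists d => // h hd; have [->|h0] := eqVneq h 0.
    by rewrite addr0 subrr scale0r subr0 csn0 normr0 mulr0.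
  have := H h hd h0; rewrite /= => /ltW ph.
  have -> : f (t + h) - f t - h *: v = h *: (h^-1 *: (f (t + h) - f t) - v).
    by lmod_with R E; field.
  by rewrite csnZ mulrC ler_wpM2r.
move=> U /= vU; have vU' := nbhsB (- v) vU; rewrite addNr in vU'.
have [p pU] := csn_ex vU'.
have e0 : 0 < 1 / 2 :> R by lra.
have [d d0 H] := fv p _ e0.
apply/near0P; exists d => // h hd h0.
have : p (h^-1 *: (f (t + h) - f t) - v) < 1.
  have -> : h^-1 *: (f (t + h) - f t) - v = h^-1 *: (f (t + h) - f t - h *: v).
    by lmod_with R E; field.
  rewrite csnZ normfV mulrC ltr_pdivrMr ?normr_gt0 //.
  by apply: (le_lt_trans (H h hd)); rewrite ltr_pM2r ?normr_gt0 //; lra.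
by move=> /pU [z Uz]; rewrite addrC => /addIr zE; rewrite /= -zE.
Qed.

Lemma der_near f g t v : (\forall s \near t, f s = g s) -> der f t v -> der g t v.
Proof.
move=> /nearP [d d0 fg] fv p e e0; have [d1 d10 H] := fv p e e0.
exists (Num.min d1 d); first by rewrite lt_min d10.
move=> h; rewrite lt_min => /andP[h1 h2].
have := fg 0; rewrite addr0 normr0 => /(_ d0) <-.
by rewrite -(fg h) //; exact: H.
Qed.

Lemma der_cst (x : E) t : der (fun _ => x) t 0.
Proof.
move=> p e e0; exists 1 => // h _.
by rewrite subrr scaler0 subr0 csn0 mulr_ge0 // ltW.
Qed.

Lemma derD f g t v w : der f t v -> der g t w ->
  der (fun s => f s + g s) t (v + w).
Proof.
move=> fv gw p e e0; have e2 : 0 < e / 2 by lra.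
have [d1 d10 H1] := fv p _ e2; have [d2 d20 H2] := gw p _ e2.
exists (Num.min d1 d2); first by rewrite lt_min d10.
move=> h; rewrite lt_min => /andP[/H1 h1 /H2 h2].
have -> : f (t + h) + g (t + h) - (f t + g t) - h *: (v + w) =
    (f (t + h) - f t - h *: v) + (g (t + h) - g t - h *: w).
  by lmod_with R E; ring.
by apply: le_trans (csnD _ _ _) _; lra.
Qed.

Lemma der_bound f t v p : der f t v -> exists2 d : R, 0 < d &
  forall h, `|h| < d -> p (f (t + h) - f t) <= (p v + 1) * `|h|.
Proof.
move=> fv; have [d d0 H] := fv p 1 ltr01; exists d => // h hd.
have := csnD p (f (t + h) - f t - h *: v) (h *: v).
by rewrite subrK csnZ => b; have := H h hd; lra.
Qed.

Lemma der_cont f t v p e : 0 < e -> der f t v -> exists2 d : R, 0 < d &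
  forall h, `|h| < d -> p (f (t + h) - f t) <= e.
Proof.
move=> e0 /(der_bound p) [d d0 H]; have pv := csn_ge0 p v.
exists (Num.min d (e / (p v + 1))).
  by rewrite lt_min d0 divr_gt0 //; lra.
move=> h; rewrite lt_min => /andP[hd]; rewrite ltr_pdivlMr; last lra.
by move=> he; apply: le_trans (H h hd) _; rewrite mulrC ltW.
Qed.

End derivatives.

Section derivative_rules.
Context {R : realType} {E : tvsType R}.
Implicit Types (f g : R -> E) (t : R) (p : csn E).

Lemma der_scale (a : R -> R^o) (a' : R) f t v : der a t a' -> der f t v ->
  der (fun s => a s *: f s) t (a t *: v + a' *: f t).
Proof.
move=> da df p e e0; set K : R := `|a t| + p (f t) + 1 + `|a'|.
have pf0 := csn_ge0 p (f t).
have at0 : 0 <= `|a t : R| by []. have a'0 := normr_ge0 a'.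
pose d := e / (3 * K).
have K1 : 1 <= K by rewrite /K; lra.
have dK : d * K = e / 3 by rewrite /d; field; apply/lt0r_neq0; lra.
have d0 : 0 < d by apply: divr_gt0 => //; lra.
have [d1 d10 H1] := da (csn_norm R) _ d0.
have [d2 d20 H2] := df p _ d0.
have [d3 d30 H3] := der_cont p d0 df.
have [d4 d40 H4] := der_bound (csn_norm R) da.
exists (Num.min (Num.min d1 d2) (Num.min d3 d4)).
  by rewrite !lt_min d10 d20 d30.
move=> h; rewrite !lt_min => /andP[/andP[/H1 h1 /H2 h2] /andP[/H3 h3 /H4 h4]].
rewrite /= in h1 h4.
(* Two first order remainders and one product of increments. [K] dominates every factor that occurs,
   so each of the three is at most K d |h| = (e / 3) |h|. *)
have -> : a (t + h) *: f (t + h) - a t *: f t - h *: (a t *: v + a' *: f t) =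
    (a t *: (f (t + h) - f t - h *: v) + (a (t + h) - a t - h *: a') *: f t) +
    (a (t + h) - a t) *: (f (t + h) - f t).
  by lmod_with R E; rewrite /GRing.scale /=; ring.
apply: le_trans (csnD _ _ _) _.
apply: (@le_trans _ _ (K * (d * `|h|) + K * (d * `|h|) + K * (d * `|h|))).
  have dh : 0 <= d * `|h| by rewrite mulr_ge0 // ltW.
  apply: lerD; first apply: le_trans (csnD _ _ _) _; first apply: lerD.
  - rewrite csnZ; apply: ler_pM => //; last by rewrite /K; lra.
    exact: csn_ge0.
  - rewrite csnZ mulrC; apply: ler_pM => //; by rewrite /K; lra.
  - rewrite csnZ; apply: (@le_trans _ _ ((`|a' : R| + 1) * `|h| * d)).
      by apply: ler_pM => //; exact: csn_ge0.
    rewrite -mulrA (mulrC `|h|); apply: ler_wpM2r => //; rewrite /K; lra.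
by rewrite mulrA (mulrC K) dK; lra.
Qed.

Lemma derZ (a : R) f t v : der f t v -> der (fun s => a *: f s) t (a *: v).
Proof.
move=> df; have := der_scale (der_cst a t) df.
by rewrite scale0r addr0.
Qed.

Lemma derN f t v : der f t v -> der (fun s => - f s) t (- v).
Proof.
move=> /(derZ (-1)); rewrite scaleN1r.
by under eq_fun do rewrite scaleN1r.
Qed.

Lemma derB f g t v w : der f t v -> der g t w ->
  der (fun s => f s - g s) t (v - w).
Proof. by move=> fv /derN; exact: derD. Qed.

Lemma der_comp (a : R -> R^o) (a' : R) f t v : der a t a' -> der f (a t) v ->
  der (fun s => f (a s)) t (a' *: v).
Proof.
move=> da df p e e0; have pv0 := csn_ge0 p v.
have a'0 := normr_ge0 a'.
pose d := e / 2 / (`|a'| + 1); have d0 : 0 < d by do 2 (apply: divr_gt0; try lra).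
have dE : d * (`|a'| + 1) = e / 2 by rewrite /d divfK //; apply/lt0r_neq0; lra.
have [d1 d10 H1] := df p _ d0.
pose k := e / 2 / (p v + 1); have k0 : 0 < k by do 2 (apply: divr_gt0; try lra).
have kE : k * (p v + 1) = e / 2 by rewrite /k divfK //; apply/lt0r_neq0; lra.
have [d2 d20 H2] := da (csn_norm R) _ k0.
have d12 : 0 < d1 / 2 by lra.
have [d3 d30 H3] := der_cont (csn_norm R) d12 da.
have [d4 d40 H4] := der_bound (csn_norm R) da.
exists (Num.min (Num.min d2 d3) d4); first by rewrite !lt_min d20 d30.
move=> h; rewrite !lt_min => /andP[/andP[/H2 h2 /H3 h3] /H4 h4].
rewrite /= in h2 h3 h4; have h0 := normr_ge0 h.
have {}h3 : `|a (t + h) - a t : R| < d1 by lra.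
have := H1 _ h3; rewrite subrKC => {}H1.
have -> : f (a (t + h)) - f (a t) - h *: (a' *: v) =
    (f (a (t + h)) - f (a t) - (a (t + h) - a t : R) *: v) +
    (a (t + h) - a t - h *: a') *: v.
  by lmod_with R E; rewrite /GRing.scale /=; ring.
apply: le_trans (csnD _ _ _) _; rewrite csnZ.
have -> : e * `|h| = d * (`|a'| + 1) * `|h| + k * (p v + 1) * `|h|.
  by rewrite dE kE; field.
apply: lerD.
  by apply: le_trans H1 _; rewrite -mulrA ler_pM2l.
apply: (@le_trans _ _ (k * `|h| * p v)); first exact: ler_wpM2r.
by have := mulr_ge0 (ltW k0) h0; nra.
Qed.

Lemma der_id t : der (fun s : R => s : R^o) t 1.
Proof.
move=> p e e0; exists 1 => // h _.
rewrite (_ : _ - _ = 0 :> R^o) ?csn0 ?mulr_ge0 // ?ltW //.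
by rewrite /GRing.scale /= mulr1 (addrC t) addrK subrr.
Qed.

Lemma der_shift f t s v : der f (t + s) v -> der (fun r => f (r + s)) t v.
Proof.
move=> fv p e e0; have [d d0 H] := fv p e e0.
by exists d => // h /H; rewrite (addrAC t h s).
Qed.

Lemma der_line (v : E) t : der (fun s => s *: v) t v.
Proof.
have := der_scale (der_id t) (der_cst v t).
by rewrite scaler0 add0r scale1r.
Qed.

(** The mean value inequality without integrals: the bound with a slightly larger constant is local,
    by definition of the derivative, and additive over intervals, so [cousin] applies. The slack e /
    (b - a + 1) contributes at most [e] in total. *)
Lemma mvt f (a b M : R) p : a <= b ->
  (forall t, a <= t -> t <= b -> exists2 v, der f t v & p v <= M) ->
  p (f b - f a) <= M * (b - a).
Proof.
move=> ab H; apply/ler_addgt0Pr => e e0.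
pose M' := M + e / (b - a + 1).
have e'0 : 0 < e / (b - a + 1) by apply: divr_gt0 => //; lra.
apply: (@le_trans _ _ (M' * (b - a))); last first.
  rewrite /M' mulrDl lerD2l mulrAC ler_pdivrMr; last lra.
  by rewrite ler_wpM2l; lra.
apply: (@cousin _ a b (fun x y => p (f y - f x) <= M' * (y - x))) => //.
  move=> x y z ax xy yz zb h1 h2.
  by apply: le_trans (csn_tri p _ (f y) _) _; lra.
move=> t at' tb; have [v fv pv] := H t at' tb.
have [d d0 Hd] := fv p _ e'0.
have Hb h : `|h| < d -> p (f (t + h) - f t) <= M' * `|h|.
  move=> /Hd b1; have := csnD p (f (t + h) - f t - h *: v) (h *: v).
  have := normr_ge0 h; rewrite subrK csnZ /M'; nra.
exists d => // x y ax xt ty yb dx dy.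
have := Hb (y - t); have := Hb (x - t); rewrite !subrKC.
have -> : `|x - t| = t - x by rewrite ler0_norm; lra.
have -> : `|y - t| = y - t by rewrite ger0_norm; lra.
move=> b1 b2; apply: le_trans (csn_tri p _ (f t) _) _.
rewrite (csnC _ (f t)); have : t - x < d by lra.
have : y - t < d by lra.
by move=> /b2 {}b2 /b1 {}b1; lra.
Qed.

Lemma mvt_abs f (t h M : R) p :
  (forall s, `|s| <= `|h| -> exists2 v, der f (t + s) v & p v <= M) ->
  p (f (t + h) - f t) <= M * `|h|.
Proof.
move=> H; case: (leP 0 h) => h0.
  have := @mvt f t (t + h) M p; rewrite (ger0_norm h0) addrAC subrr add0r.
  apply; first lra.
  move=> s ts sh; have := H (s - t); rewrite subrKC; apply.
  by rewrite (ger0_norm h0) ger0_norm; lra.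
have := @mvt f (t + h) t M p; rewrite (ltr0_norm h0) csnC opprD addNKr.
apply; first lra.
move=> s ts sh; have := H (s - t); rewrite subrKC; apply.
rewrite (ltr0_norm h0) ler0_norm; lra.
Qed.

End derivative_rules.

Section hausdorff_derivatives.
Context {R : realType} {E : htvs R}.
Implicit Types (f : R -> E) (t : R).

Lemma der_uniq f t v w : der f t v -> der f t w -> v = w.
Proof.
move=> fv fw; apply/eqP; rewrite -subr_eq0; apply/eqP/(csn_eq0 (@htvs_hausdorff R E)) => p.
apply/le_anti; rewrite csn_ge0 andbT; apply/ler_addgt0Pr => e e0.
rewrite add0r; have e2 : 0 < e / 2 by lra.
have [d1 d10 H1] := fv p _ e2; have [d2 d20 H2] := fw p _ e2.
pose h := Num.min d1 d2 / 2.
have m0 : 0 < Num.min d1 d2 by rewrite lt_min d10.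
have h0 : 0 < h by rewrite /h; lra.
have hm : h < Num.min d1 d2 by rewrite /h; lra.
move: hm; rewrite lt_min => /andP[hd1 hd2].
have := H1 h; have := H2 h; rewrite (gtr0_norm h0) => /(_ hd2) b2 /(_ hd1) b1.
have := csnB p (f (t + h) - f t - h *: w) (f (t + h) - f t - h *: v) => b3.
have bE : h *: (v - w) = f (t + h) - f t - h *: w - (f (t + h) - f t - h *: v).
  by lmod_with R E; ring.
rewrite -bE csnZ (gtr0_norm h0) in b3.
by rewrite -(ler_pM2l h0); lra.
Qed.


Lemma der_cderiv f t v : der f t v -> cderiv f t = v.
Proof.
move=> fv; rewrite /cderiv; case: xgetP => [w _ /derP fw|/(_ v)].
  exact: der_uniq fw fv.
by have /derP := fv.
Qed.


Lemma der0_cst f (a b : R) : (forall t, a <= t -> t <= b -> der f t 0) ->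
  forall s t, a <= s -> s <= b -> a <= t -> t <= b -> f s = f t.
Proof.
move=> f0.
have H s t : a <= s -> s <= t -> t <= b -> f s = f t.
  move=> as' st tb; apply/esym/eqP; rewrite -subr_eq0; apply/eqP/(csn_eq0 (@htvs_hausdorff R E)) => p.
  apply/le_anti; rewrite csn_ge0 andbT.
  have := @mvt R E f s t 0 p st; rewrite mul0r; apply => r sr rt.
  by exists 0; [apply: f0; lra | rewrite csn0].
move=> s t as' sb at' tb; case: (leP s t) => st; first exact: H.
by apply/esym/H => //; exact: ltW.
Qed.


End hausdorff_derivatives.

(** * Smooth curves and their closure properties *)

Section smooth_curves.
Context {R : realType} {E : htvs R}.
Implicit Types (f g : R -> E) (a : R -> R^o) (t : R).

(** In a Hausdorff space derivatives are unique, so exhibiting a sequence of successive derivatives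
    determines the chosen values [cderivn]. *)
Lemma csmoothP f : csmooth f <-> exists D : nat -> R -> E,
  D 0%N = f /\ forall n t, der (D n) t (D n.+1 t).
Proof.
split=> [sf|[D [D0 DS]]].
  exists (fun n => cderivn n f); split=> // n t.
  have [v /derP fv] := sf n t I.
  by rewrite /cderivn /= (der_cderiv fv).
have DE n : cderivn n f = D n.
  elim: n => [|n IH]; first by rewrite D0.
  rewrite /cderivn /= -/(cderivn n f) IH; apply/funext => t.
  exact: der_cderiv.
by move=> n t _; exists (D n.+1 t); apply/derP; rewrite DE.
Qed.

Lemma csmooth_dern f n t : csmooth f -> der (cderivn n f) t (cderivn n.+1 f t).
Proof.
move=> sf; have [v /derP fv] := sf n t I.
by rewrite /cderivn /= (der_cderiv fv).
Qed.

Lemma csmooth_der f t : csmooth f -> der f t (cderiv f t).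
Proof. exact: (@csmooth_dern f 0). Qed.

Lemma cderivnSr n f : cderivn n (cderiv f) = cderivn n.+1 f.
Proof. by rewrite /cderivn -iterSr. Qed.

Lemma csmooth_cderiv f : csmooth f -> csmooth (cderiv f).
Proof.
move=> sf n t _; exists (cderivn n.+2 f t); apply/derP.
by rewrite cderivnSr; exact: csmooth_dern.
Qed.

Lemma cderivn_near n f g t : (\forall s \near t, f s = g s) ->
  \forall s \near t, cderivn n f s = cderivn n g s.
Proof.
move=> /nearP [d d0 fg]; apply/nearP; exists d => //.
elim: n => // n IH h hd; rewrite /cderivn /= /cderiv; congr xget.
have hd' : 0 < d - `|h| by lra.
have fgn : \forall s \near t + h, cderivn n f s = cderivn n g s.
  apply/nearP; exists (d - `|h|) => // k kd; rewrite -addrA; apply: IH.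
  by apply: le_lt_trans (ler_normD _ _) _; lra.
apply/funext => v; apply/propext; rewrite -!/(cderivn n _) /=.
split=> /derP fv; apply/derP; apply: der_near fv => //.
by apply: filterS fgn.
Qed.

Lemma smooth_on_local (O : set R) f :
  (forall t, O t -> exists2 g, csmooth g & \forall s \near t, f s = g s) ->
  smooth_on O f.
Proof.
move=> H n t Ot; have [g sg fg] := H t Ot.
exists (cderivn n.+1 g t); apply/derP; apply: der_near (csmooth_dern n t sg).
have := cderivn_near n fg; by apply: filterS => s ->.
Qed.

End smooth_curves.

Section smooth_spans.
Context {R : realType} {E : htvs R}.
Implicit Types (f g : R -> E) (a : R -> R^o) (t : R).

Inductive smooth_span (G : set (R -> E)) : (R -> E) -> Prop :=
  | span_gen g : G g -> smooth_span G g
  | span_scale a f : csmooth a -> smooth_span G f ->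
      smooth_span G (fun t => a t *: f t)
  | span_add f g : smooth_span G f -> smooth_span G g ->
      smooth_span G (fun t => f t + g t).

(** If the derivative of every member of [G] lies in the module spanned by [G] over the smooth
    scalar functions, then by the Leibniz rule the whole span is stable under derivation. This
    proves smoothness without a formula for the higher derivatives. *)
Lemma span_smooth (G : set (R -> E)) :
  (forall g, G g -> exists2 g', smooth_span G g' & forall t, der g t (g' t)) ->
  forall f, smooth_span G f -> csmooth f.
Proof.
move=> HG.
have HS f : smooth_span G f ->
    exists2 f', smooth_span G f' & forall t, der f t (f' t).
  elim=> [g /HG //|a {}f sa Gf [f' Gf' ff']|{}f g Gf [f' Gf' ff'] Gg [g' Gg' gg']].
    exists (fun t => a t *: f' t + cderiv a t *: f t).
      by apply: span_add; apply: span_scale => //; exact: csmooth_cderiv.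
    by move=> t; apply: der_scale => //; exact: csmooth_der.
  by exists (fun t => f' t + g' t); [exact: span_add | move=> t; exact: derD].
move=> f Gf.
have Gn n : smooth_span G (cderivn n f).
  elim: n => // n IH; have [g Gg fg] := HS _ IH.
  suff -> : cderivn n.+1 f = g by [].
  by apply/funext => t; exact: der_cderiv.
move=> n t _; have [g Gg fg] := HS _ (Gn n).
by exists (g t); apply/derP.
Qed.

Lemma csmooth_family (G : set (R -> E)) :
  (forall g, G g -> exists2 g', smooth_span G g' & forall t, der g t (g' t)) ->
  forall f, G f -> csmooth f.
Proof. by move=> HG f Gf; apply: (span_smooth HG); exact: span_gen. Qed.

Lemma csmooth_step f g : (forall t, der f t (g t)) -> csmooth g -> csmooth f.
Proof.
move=> fg sg; apply/csmoothP; exists (fun n => if n is k.+1 then cderivn k g else f).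
by split=> // -[|n] t; [exact: fg | exact: csmooth_dern].
Qed.

Lemma csmooth_cst (x : E) : csmooth (fun _ : R => x).
Proof.
apply/csmoothP; exists (fun n _ => if n is 0%N then x else 0).
by split=> // n t; case: n => [|n]; exact: der_cst.
Qed.

End smooth_spans.

Section smooth_rules.
Context {R : realType} {E : htvs R}.
Implicit Types (f g : R -> E) (a : R -> R^o) (t : R).

Lemma csmoothD f g : csmooth f -> csmooth g -> csmooth (fun t => f t + g t).
Proof.
move=> sf sg; apply: (span_smooth (G := [set h | csmooth h])) => [h sh|].
  exists (cderiv h); first exact/span_gen/csmooth_cderiv.
  by move=> t; exact: csmooth_der.
by apply: span_add; exact: span_gen.
Qed.

Lemma csmoothZ a f : csmooth a -> csmooth f -> csmooth (fun t => a t *: f t).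
Proof.
move=> sa sf; apply: (span_smooth (G := [set h | csmooth h])) => [h sh|].
  exists (cderiv h); first exact/span_gen/csmooth_cderiv.
  by move=> t; exact: csmooth_der.
by apply: span_scale => //; exact: span_gen.
Qed.

Lemma csmoothZc (k : R) f : csmooth f -> csmooth (fun t => k *: f t).
Proof.
move=> sf; apply/csmoothP; exists (fun n t => k *: cderivn n f t).
by split=> // n t; apply: derZ; exact: csmooth_dern.
Qed.

Lemma csmoothN f : csmooth f -> csmooth (fun t => - f t).
Proof.
move=> /(csmoothZc (-1)); by under eq_fun do rewrite scaleN1r.
Qed.

Lemma csmoothB f g : csmooth f -> csmooth g -> csmooth (fun t => f t - g t).
Proof. by move=> sf /csmoothN; exact: csmoothD. Qed.

Lemma csmooth_comp_on (O : set R) f a : smooth_on O f -> csmooth a ->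
  (forall t, O (a t)) -> csmooth (fun t => f (a t)).
Proof.
move=> sf sa Oa.
(* The derivative of f^(n) o a is a' times f^(n+1) o a, so this family is stable and no formula for
   iterated derivatives of a composite is required. *)
apply: (csmooth_family (G := [set h | exists n, h = fun t => cderivn n f (a t)]));
  last by exists 0%N.
move=> _ [n ->]; exists (fun t => cderiv a t *: cderivn n.+1 f (a t)).
  by apply: span_scale; [exact: csmooth_cderiv | apply: span_gen; exists n.+1].
move=> t; apply: der_comp; first exact: csmooth_der.
have [v /derP fv] := sf n _ (Oa t).
by rewrite /cderivn /= (der_cderiv fv).
Qed.

Lemma csmooth_comp f a : csmooth f -> csmooth a -> csmooth (fun t => f (a t)).
Proof. by move=> sf sa; exact: (csmooth_comp_on sf). Qed.

End smooth_rules.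

(** * Scalar functions: flat functions, bumps and cutoffs *)

Section scalar_curves.
Context {R : realType}.
Implicit Types (a b : R -> R^o) (t : R).

Lemma csmooth_id : csmooth (fun t : R => t : R^o).
Proof. by apply: (csmooth_step _ (csmooth_cst (1 : R^o))) => t; exact: der_id. Qed.

Lemma csmoothM a b : csmooth a -> csmooth b -> csmooth (fun t => a t * b t : R^o).
Proof. exact: csmoothZ. Qed.

Lemma scaleRE (x : R) (y : R^o) : x *: y = x * y :> R^o.
Proof. by []. Qed.

Lemma is_derive_der (f : R -> R^o) t v : is_derive t 1 f v -> der f t v.
Proof.
move=> [df <-]; apply/derP; rewrite /is_cderiv.
rewrite (_ : (fun h => _) =
  fun h : R => h^-1 *: ((f \o shift t) (h *: (1 : R^o)) - f t)); first exact: df.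
by apply/funext => h; rewrite /= /shift /= [h%:A]mulr1 addrC (addrC t) addrC.
Qed.

Lemma derM a b v w t : der a t v -> der b t w ->
  der (fun s => a s * b s : R^o) t (a t * w + v * b t).
Proof. exact: der_scale. Qed.

Lemma der_pow a v n t : der a t v ->
  der (fun s => a s ^+ n : R^o) t (n%:R * a t ^+ n.-1 * v).
Proof.
move=> av; elim: n => [|n IH].
  by rewrite !mul0r; under eq_fun do rewrite expr0; exact: der_cst.
have := derM av IH; under eq_fun do rewrite -exprS.
suff -> : a t * (n%:R * a t ^+ n.-1 * v) + v * a t ^+ n =
  n.+1%:R * a t ^+ n.+1.-1 * v by [].
have E (x y : R) : x * (n%:R * x ^+ n.-1 * y) + y * x ^+ n =
    n.+1%:R * x ^+ n.+1.-1 * y.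
  by case: n {IH} => [|n] /=; rewrite ?exprS ?expr0 -?natr1; ring.
exact: E.
Qed.

Lemma der_invf a v t : a t != 0 -> der a t v ->
  der (fun s => (a s)^-1 : R^o) t (- v / a t ^+ 2).
Proof.
move=> at0 av.
have /is_derive_der : is_derive (a t : R^o) 1 (fun s : R => s^-1) (- (a t : R) ^- 2 *: 1).
  exact: is_deriveV.
by move=> /(der_comp av); rewrite !scaleRE mulr1 mulrN -mulNr.
Qed.

Lemma csmooth_inv a : csmooth a -> (forall t, a t != 0) ->
  csmooth (fun t => (a t)^-1 : R^o).
Proof.
move=> sa a0; apply: (csmooth_family
  (G := [set h | exists n, h = fun t => (a t)^-1 ^+ n : R^o])); last by exists 1%N.
move=> _ [n ->].
have D t : der (fun s => (a s)^-1 ^+ n : R^o) t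
    (- cderiv a t * n%:R * (a t)^-1 ^+ n.+1).
  have := der_pow n (der_invf (a0 t) (csmooth_der t sa)).
  set h := (X in der _ _ X -> _); suff -> : - cderiv a t * n%:R * (a t)^-1 ^+ n.+1 = h.
    by [].
  have E (x y z : R) : x * n%:R * y ^+ n.+1 = n%:R * y ^+ n.-1 * (x * y ^+ 2).
    by case: n @h => [|n] h /=; rewrite !exprS ?expr0; ring.
  by rewrite /h -(exprVn (a t) 2); exact: (E _ _ 0).
exists (fun t => (- cderiv a t * n%:R) *: ((a t)^-1 ^+ n.+1 : R^o)) => //.
apply: span_scale; last by apply: span_gen; exists n.+1.
apply: csmoothM (csmooth_cst _); exact/csmoothN/csmooth_cderiv.
Qed.

(* [flatfun 0] is the function exp(-1/t); the other ones span its derivatives *)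
Definition flatfun (k : nat) (t : R) : R^o :=
  if 0 < t then t^-1 ^+ k * expR (- t^-1) else 0.

(** The term of order k + 2 of the exponential series at 1/t bounds exp(1/t) from below. The order
    is chosen so that a factor t^2 remains, which makes the derivative at 0 vanish. *)
Lemma flatfun_le k (t : R) : 0 < t -> flatfun k t <= (k.+2)`!%:R * t ^+ 2.
Proof.
move=> t0; rewrite /flatfun t0 expRN -[leRHS]mulr1 exprVn.
rewrite ler_pdivrMr ?expR_gt0 //.
have ti : 0 <= t^-1 by rewrite invr_ge0 ltW.
have := expR_ge1Dxn k.+1 ti.
set F : R := (k.+2)`!%:R; have F0 : 0 < F by rewrite ltr0n fact_gt0.
move=> h; apply: (@le_trans _ _ (F * t ^+ 2 * (t^-1 ^+ k.+2 / F))).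
  rewrite exprVn (_ : F * _ * _ = (t ^+ k)^-1) //.
  have tn := lt0r_neq0 t0.
  by rewrite !exprS; field; do ?[apply/andP; split]; rewrite ?expf_neq0 // lt0r_neq0.
rewrite mulr1; apply: ler_wpM2l; last by lra.
by rewrite mulr_ge0 ?exprn_ge0 ?ltW.
Qed.

Lemma flatfun_der k t :
  der (flatfun k) t (flatfun k.+2 t - k%:R * flatfun k.+1 t).
Proof.
case: (ltgtP t 0) => [t0|t0|->].
- rewrite /flatfun (lt_gtF t0) mulr0 subr0.
  apply: der_near (der_cst _ _); apply/nearP; exists (- t); first by lra.
  by move=> h; rewrite ltr_norml => /andP[h1 h2]; rewrite ifF //; apply/negbTE; rewrite -leNgt; lra.
- apply: (@der_near _ _ (fun s => s^-1 ^+ k * expR (- s^-1) : R^o)).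
    apply/nearP; exists t => // h; rewrite ltr_norml => /andP[h1 h2].
    by rewrite /flatfun ifT //; lra.
  have tn := lt0r_neq0 t0.
  have dV : der (fun s : R => s^-1 : R^o) t (- t^-1 ^+ 2).
    by have := der_invf tn (der_id t); rewrite mulN1r exprVn.
  have dE : der (fun s : R => expR (- s^-1) : R^o) t (t^-1 ^+ 2 * expR (- t^-1)).
    have := der_comp (derN dV) (is_derive_der (is_derive_expR (- t^-1))).
    by rewrite opprK.
  have := derM (der_pow k dV) dE; rewrite /flatfun t0.
  set h := (X in der _ _ X -> _).
  set h' := (X in _ -> der _ _ X); suff -> : h' = h by [].
  rewrite /h /h'; move: (expR _) => x; move: (t^-1) => y.
  by case: k @h @h' => [|k] _ _; rewrite /= ?exprS ?expr0; ring.
- rewrite /flatfun ltxx mulr0 subr0 => p e e0.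
  pose F : R := (k.+2)`!%:R * p (1 : R^o) + 1.
  have p0 := csn_ge0 p (1 : R^o).
  have F0 : 0 < F by apply: ltr_wpDl => //; apply: mulr_ge0.
  exists (e / F); first exact: divr_gt0.
  move=> h hF; rewrite add0r -/(flatfun k h) ltxx scaler0 !subr0.
  have [h0|h0] := ltP 0 h; last first.
    by rewrite /flatfun ltNge h0 /= csn0 mulr_ge0 // ltW.
  rewrite -[flatfun k h]mulr1 -[flatfun k h * 1]scaleRE csnZ ger0_norm; last first.
    by rewrite /flatfun h0 mulr_ge0 ?expR_ge0 // exprn_ge0 // invr_ge0 ltW.
  rewrite (gtr0_norm h0) in hF *.
  apply: le_trans (ler_wpM2r p0 (flatfun_le k h0)) _.
  rewrite ltr_pdivlMr // in hF; rewrite /F in hF.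
  move: p0 hF; set P : R := p (1 : R^o); set G : R := _%:R => p0 hF.
  rewrite (_ : G * h ^+ 2 * P = h * (h * (G * P))); last by ring.
  rewrite [leRHS]mulrC; apply: ler_wpM2l; first exact: ltW.
  by move: hF; rewrite mulrDr mulr1; lra.
Qed.

Lemma csmooth_flatfun k : csmooth (flatfun k).
Proof.
apply: (csmooth_family (G := [set h | exists k, h = flatfun k])); last by exists k.
move=> _ [n ->]; exists (fun t => flatfun n.+2 t + (- n%:R : R^o) *: flatfun n.+1 t).
  apply: span_add; first by apply: span_gen; exists n.+2.
  by apply: span_scale (csmooth_cst _) _; apply: span_gen; exists n.+1.
move=> t; have := @flatfun_der n t.
by rewrite scaleRE mulNr.
Qed.

Definition step t : R^o := flatfun 0 t / (flatfun 0 t + flatfun 0 (1 - t)).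

Lemma flatfun0_ge0 t : 0 <= flatfun 0 t.
Proof. by rewrite /flatfun; case: ifP => // _; rewrite mul1r expR_ge0. Qed.

Lemma flatfun0_gt0 t : 0 < t -> 0 < flatfun 0 t.
Proof. by rewrite /flatfun => ->; rewrite mul1r expR_gt0. Qed.

Lemma step_den t : 0 < flatfun 0 t + flatfun 0 (1 - t).
Proof.
case: (ltP 0 t) => t0.
  by rewrite ltr_pwDl ?flatfun0_ge0 ?flatfun0_gt0.
by rewrite ltr_wpDl ?flatfun0_ge0 // flatfun0_gt0 //; lra.
Qed.

Lemma csmooth_step_fun : csmooth step.
Proof.
apply: csmoothM; first exact: csmooth_flatfun.
apply: csmooth_inv => [|t]; last exact/lt0r_neq0/step_den.
apply: csmoothD; first exact: csmooth_flatfun.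
apply: csmooth_comp; first exact: csmooth_flatfun.
apply: csmoothB; [exact: csmooth_cst | exact: csmooth_id].
Qed.

Lemma step_le0 t : t <= 0 -> step t = 0.
Proof. by move=> t0; rewrite /step /flatfun ltNge t0 /= mul0r. Qed.

Lemma step_ge1 t : 1 <= t -> step t = 1.
Proof.
move=> t1; have := step_den t; rewrite /step /flatfun [0 < 1 - t]ltNge.
rewrite (_ : 1 - t <= 0); last lra.
by rewrite /= addr0 => h; rewrite divff // lt0r_neq0.
Qed.

Lemma step_ge0 t : 0 <= step t.
Proof. by rewrite divr_ge0 ?flatfun0_ge0 // ltW // step_den. Qed.

Lemma step_le1 t : step t <= 1.
Proof. by rewrite ler_pdivrMr ?step_den // mul1r lerDl flatfun0_ge0. Qed.

Lemma bump_ex (t0 e : R) : 0 < e -> exists b : R -> R^o,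
  [/\ csmooth b, forall s, `|s - t0| <= e / 2 -> b s = 1,
      forall s, e <= `|s - t0| -> b s = 0 & forall s, 0 <= b s <= 1].
Proof.
move=> e0; have e2 : 0 < e ^+ 2 by apply: exprn_gt0.
have en : e != 0 by apply: lt0r_neq0.
(* For |s - t0| <= e / 2 the first factor is at least 3 e^2 / 4, so 4 / (3 e^2) brings the argument
   to at least 1; for |s - t0| >= e it is at most 0. *)
exists (fun s => step ((e ^+ 2 - (s - t0) ^+ 2) * (4 / 3 / e ^+ 2))); split.
- apply: (csmooth_comp csmooth_step_fun); apply: csmoothM (csmooth_cst _).
  apply: csmoothB (csmooth_cst _) _; rewrite /=.
  by apply: csmoothM; exact: csmoothB csmooth_id (csmooth_cst _).
- move=> s; rewrite ler_norml => /andP[h1 h2].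
  rewrite step_ge1 // mulrA ler_pdivlMr // mul1r.
  have : (s - t0) ^+ 2 <= (e / 2) ^+ 2 by rewrite !expr2; nra.
  by rewrite !expr2; lra.
- move=> s h; rewrite step_le0 //; apply: mulr_le0_ge0.
    rewrite subr_le0 -[leRHS]real_normK ?num_real //.
    by rewrite lerXn2r // nnegrE ltW.
  by rewrite divr_ge0 //; lra.
- by move=> s; rewrite step_ge0 step_le1.
Qed.

(** Composing with [th] turns something that is smooth only near [t0] into something smooth on the
    whole line with the same germ at [t0]. Every passage from local to global smoothness below rests
    on this reparametrization. *)
Lemma cutoff_ex (t0 e : R) : 0 < e -> exists th : R -> R^o,
  [/\ csmooth th, forall s, `|s - t0| <= e / 2 -> th s = s &
      forall s, `|th s - t0| < e].
Proof.
move=> e0; have [b [sb b1 b0 bb]] := bump_ex t0 e0.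
exists (fun s => t0 + (s - t0) * b s); split.
- apply: csmoothD (csmooth_cst _) _; apply: csmoothM sb.
  exact: csmoothB csmooth_id (csmooth_cst _).
- by move=> s /b1 ->; rewrite mulr1 subrKC.
- move=> s; have /andP[bs0 bs1] := bb s; rewrite addrAC subrr add0r normrM.
  rewrite (ger0_norm bs0); case: (ltP `|s - t0| e) => h.
    by have := normr_ge0 (s - t0); nra.
  by rewrite b0 // mulr0.
Qed.

End scalar_curves.

(** * Rapidly converging sequences and special curves *)

Section dyadic_sums.
Context {R : realType}.
Implicit Types (p q : nat -> R) (b : R -> R^o) (t : R).

(** Decay faster than every power of 2^-n: each derivative of the n-th dyadic bump costs a factor
    2^n, and [rapid] absorbs all of them. *)
Definition rapid p := forall k (e : R), 0 < e ->
  exists N, forall n, (N <= n)%N -> `|p n| * 2 ^+ (n * k) <= e.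

Lemma rapid_scale p : rapid p -> rapid (fun n => p n * 2 ^+ n).
Proof.
move=> rp k e e0; have [N H] := rp k.+1 e e0; exists N => n /H.
by rewrite normrM [ `|2 ^+ n|]ger0_norm ?exprn_ge0 // mulnS exprD mulrA.
Qed.

Lemma archi_pow2 (e : R) : 0 < e -> exists N, forall n, (N <= n)%N -> 2^-1 ^+ n <= e.
Proof.
move=> e0; have [N HN] : exists N : nat, e^-1 < N%:R.
  exists (Num.bound e^-1); apply: archi_boundP; rewrite invr_ge0; exact: ltW.
exists N => n Nn; rewrite exprVn invf_ple ?posrE ?exprn_gt0 //.
apply: ltW; apply: lt_le_trans HN _; rewrite -natrX ler_nat.
by apply: leq_trans Nn _; exact/ltnW/ltn_expl.
Qed.

Definition eps n : R := 2^-1 ^+ (n * n).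

Lemma eps_gt0 n : 0 < eps n. Proof. by rewrite exprn_gt0 // invr_gt0. Qed.

Lemma rapid_eps : rapid eps.
Proof.
move=> k e e0; have [N H] := archi_pow2 e0.
exists (N + k.+1)%N => n nN; rewrite gtr0_norm ?eps_gt0 //.
apply: le_trans (H n (leq_trans (leq_addr _ _) nN)).
have kn : (k.+1 <= n)%N by apply: leq_trans nN; exact: leq_addl.
rewrite /eps (_ : (n * n = n * (n - k.+1) + (n + n * k))%N); last first.
  by rewrite -mulnS -mulnDr subnK.
rewrite addnA exprD -mulrA (exprVn _ (n * k)) mulVf ?mulr1; last first.
  by rewrite expf_neq0.
rewrite exprD ler_piMl ?exprn_ge0 ?invr_ge0 //.
by rewrite exprn_ile1 ?invr_ge0 // invf_le1 // ler1n.
Qed.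

Lemma rapid_le p q : (forall n, `|p n| <= `|q n|) -> rapid q -> rapid p.
Proof.
move=> pq rq k e e0; have [N H] := rq k e e0; exists N => n /H.
by apply: le_trans; rewrite ler_wpM2r // exprn_ge0.
Qed.

Lemma rapidM p (c : R) : rapid p -> rapid (fun n => p n * c).
Proof.
move=> rp k e e0; have c0 : 0 < `|c| + 1 by rewrite ltr_wpDl.
have [N H] := rp k _ (divr_gt0 e0 c0); exists N => n /H.
rewrite ler_pdivlMr // => h; apply: le_trans h.
rewrite normrM mulrAC; apply: ler_wpM2l; last by rewrite lerDl.
by rewrite mulr_ge0 ?exprn_ge0.
Qed.

(** The series of the functions p_n b(2^n t). For [b] supported in [5/4, 7/4] the terms have
    disjoint supports, so the sum is its only possibly nonzero term and no convergence is involved.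
    If no index qualifies the default 0 is used, and the value is 0 because then b(t) = 0. *)
Definition dsum p b t : R^o :=
  let n := xget 0%N [set n | 1 < 2 ^+ n * t < 2] in p n * b (2 ^+ n * t).

Definition supported b := forall u : R, ~~ (5 / 4 <= u <= 7 / 4) -> b u = 0.

Lemma dsumE p b t n : 1 < 2 ^+ n * t < 2 -> dsum p b t = p n * b (2 ^+ n * t).
Proof.
move=> nt; rewrite /dsum; case: xgetP => [m _ /= mt|/(_ n)]; last by [].
suff -> : m = n by [].
have t0 : 0 < t.
  have /andP[h _] := nt; have := lt_trans ltr01 h.
  by rewrite pmulr_rgt0 // exprn_gt0.
wlog mn : m n nt mt / (m <= n)%N.
  by move=> H; case/orP: (leq_total m n) => mn; [|apply/esym]; exact: H.
move: nt mt; rewrite -(subnK mn) exprD; case: (n - m)%N => [|k] //.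
rewrite exprS -!mulrA; set y := 2 ^+ m * t => /andP[_ h1] /andP[h2 _].
have : 1 <= 2 ^+ k :> R by rewrite exprn_ege1 // ler1n.
by set z := 2 ^+ k in h1 * => hz; exfalso; nra.
Qed.

Lemma dsum0 p b t : supported b -> (forall n, ~~ (5 / 4 <= 2 ^+ n * t <= 7 / 4)) ->
  dsum p b t = 0.
Proof. by move=> sb H; rewrite /dsum sb ?mulr0. Qed.

Lemma csmooth_bounded (E : htvs R) (f : R -> E) (P : csn E) (x y : R) :
  csmooth f -> x <= y -> exists B, forall s, x <= s -> s <= y -> P (f s) <= B.
Proof.
move=> sf xy; apply: (cousin (P := fun x y =>
  exists B, forall s, x <= s -> s <= y -> P (f s) <= B) xy).
  move=> r s t xr rs st ty [B1 H1] [B2 H2]; exists (Num.max B1 B2) => u ru ut.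
  by rewrite le_max; case: (leP u s) => us; [rewrite H1 | rewrite H2 ?orbT // ltW].
move=> t xt ty; have [d d0 H] := der_cont P ltr01 (csmooth_der t sf).
exists d => // r s xr rt ts sy dr ds; exists (1 + P (f t)) => u ru us.
have := csnD P (f u - f t) (f t); rewrite subrK => h; apply: le_trans h _.
rewrite lerD2r; have := H (u - t); rewrite subrKC; apply.
by rewrite ltr_norml; apply/andP; split; lra.
Qed.

Lemma supported_cderiv b : supported b -> supported (cderiv b).
Proof.
move=> sb u u0; apply: der_cderiv.
have [d d0 H] : exists2 d, 0 < d & forall h, `|h| < d ->
    ~~ (5 / 4 <= u + h <= 7 / 4).
  move: u0; rewrite negb_and -!ltNge => /orP[u0|u0].
    exists (5 / 4 - u); first lra.
    move=> h; rewrite ltr_norml => /andP[_ h1].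
    by rewrite negb_and -!ltNge; apply/orP; left; lra.
  exists (u - 7 / 4); first lra.
  move=> h; rewrite ltr_norml => /andP[h1 _].
  by rewrite negb_and -!ltNge; apply/orP; right; lra.
apply: der_near (der_cst (0 : R^o) u); apply/nearP; exists d => // h /H.
by move=> /sb ->.
Qed.

(** Away from 0 the sum is locally a single term or 0. At 0 the decay of [p] enters: if 1 < 2^n h,
    then |p_n| B' <= |p_n| 2^n B' h <= e h as soon as [n] is large, that is, as soon as [h] is
    small. *)
Lemma dsum_der p b t : rapid p -> supported b -> csmooth b ->
  der (dsum p b) t (dsum (fun n => p n * 2 ^+ n) (cderiv b) t).
Proof.
move=> rp sb smb.
have sb' := supported_cderiv sb.
have [t0|t0|->] := ltgtP t 0.
- rewrite dsum0 //; last first.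
    move=> n; rewrite negb_and -!ltNge.
    have h : 2 ^+ n * t < 0 by rewrite pmulr_rlt0 // exprn_gt0.
    by apply/orP; left; lra.
  apply: der_near (der_cst (0 : R^o) t); apply/nearP; exists (- t); first lra.
  move=> h; rewrite ltr_norml => /andP[h1 h2]; rewrite dsum0 // => n.
  have h3 : 2 ^+ n * (t + h) < 0 by rewrite pmulr_rlt0 ?exprn_gt0 //; lra.
  by rewrite negb_and -!ltNge; apply/orP; left; lra.
- have [[n nt]|nn] := pselect (exists n, 1 < 2 ^+ n * t < 2).
    rewrite (dsumE _ _ nt).
    have n0 : 0 < 2 ^+ n :> R by rewrite exprn_gt0.
    apply: (@der_near _ _ (fun s => p n *: b (2 ^+ n * s))).
      apply/nearP; set d := Num.min (2 ^+ n * t - 1) (2 - 2 ^+ n * t).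
      have d0 : 0 < d.
        by rewrite lt_min; move/andP: nt => [h1 h2]; rewrite !subr_gt0 h1.
      exists (d / 2 ^+ n); first exact: divr_gt0.
      move=> h; rewrite ltr_pdivlMr // lt_min => /andP[h1 h2].
      rewrite (@dsumE _ _ _ n) //.
      move: h1 h2; rewrite -[X in _ * X](gtr0_norm n0) -normrM mulrC.
      rewrite !ltr_norml mulrDr; set x := 2 ^+ n * h; set y := 2 ^+ n * t.
      by move=> /andP[h1 h2] /andP[h3 h4]; apply/andP; split; lra.
    rewrite -mulrA; apply: derZ.
    apply: (der_comp (a := fun s : R => 2 ^+ n * s : R^o)); last exact: csmooth_der.
    by have := derZ (2 ^+ n) (der_id t); rewrite scaleRE mulr1.
  rewrite dsum0 //; last first.
    move=> n; apply/negP => /andP[h1 h2]; apply: nn; exists n.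
    by apply/andP; split; lra.
  (* Changing [t] by less than t/8 cannot bring 2^n t from outside (1, 2) into [5/4, 7/4], since
     (5/4) / (9/8) > 1 and (7/4) / (7/8) = 2. *)
  apply: der_near (der_cst (0 : R^o) t); apply/nearP; exists (t / 8); first lra.
  move=> h; rewrite ltr_norml => /andP[h1 h2]; rewrite dsum0 // => n.
  apply/negP => /andP; rewrite mulrDr.
  have n0 : 0 < 2 ^+ n :> R by rewrite exprn_gt0.
  move: (ltr_pM2l n0 h (t / 8)) (ltr_pM2l n0 (- (t / 8)) h); rewrite h1 h2.
  rewrite mulrN mulrA; set x := 2 ^+ n * t; set y := 2 ^+ n * h => k1 k2 [h3 h4].
  by apply: nn; exists n; apply/andP; rewrite -/x; split; lra.
rewrite (dsum0 _ sb'); last first.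
  by move=> n; rewrite mulr0; apply/negP => /andP[]; lra.
move=> P e e0; have [B HB] := csmooth_bounded P smb (ler1n R 2).
pose B' : R := Num.max 0 B + 1.
have B'0 : 0 < B'.
  by rewrite ltr_wpDl // le_max lexx.
have [N HN] := rp 1%N (e / B') (divr_gt0 e0 B'0).
exists (2^-1 ^+ N); first by rewrite exprn_gt0 // invr_gt0.
move=> h hN; rewrite add0r scaler0 subr0 (@dsum0 _ _ 0) //; last first.
  by move=> n; rewrite mulr0; apply/negP => /andP[]; lra.
rewrite subr0; have [[n nt]|nn] := pselect (exists n, 1 < 2 ^+ n * h < 2); last first.
  rewrite dsum0 ?csn0 //; first by rewrite mulr_ge0 // ltW.
  move=> n; apply/negP => /andP[h1 h2].
  by apply: nn; exists n; apply/andP; split; lra.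
rewrite (dsumE _ _ nt) -scaleRE csnZ; have /andP[n1 n2] := nt.
have n0 : 0 < 2 ^+ n :> R by rewrite exprn_gt0.
have h0 : 0 < h by have := lt_trans ltr01 n1; rewrite pmulr_rgt0.
rewrite (gtr0_norm h0) in hN *.
have Nn : (N <= n)%N.
  rewrite leqNgt; apply/negP => nN; have := ltr_pM2l n0 h (2^-1 ^+ N).
  rewrite hN exprVn -(subnK (ltnW nN)) exprD invfM mulrCA mulfV ?lt0r_neq0 //.
  move: n1; set x := _ * h; rewrite mulr1 => h1 h2.
  have : (2 ^+ (N - n) : R)^-1 <= 1 by rewrite invf_le1 ?exprn_gt0 // exprn_ege1 // ler1n.
  by lra.
have hB : P (b (2 ^+ n * h)) <= B'.
  apply: (@le_trans _ _ B); first by apply: HB; exact: ltW.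
  have : B <= Num.max 0 B by rewrite le_max lexx orbT.
  by rewrite /B'; lra.
have := HN n Nn; rewrite muln1 ler_pdivlMr // => {}HN.
apply: (@le_trans _ _ (`|p n| * B')); first exact: ler_wpM2l.
have : `|p n| * B' <= `|p n| * B' * (2 ^+ n * h).
  by rewrite ler_peMr ?mulr_ge0 // ltW.
move=> /le_trans; apply.
rewrite (_ : _ * _ * _ = `|p n| * 2 ^+ n * B' * h); last by ring.
by rewrite ler_wpM2r // ltW.
Qed.

Lemma csmooth_dsum p b : rapid p -> supported b -> csmooth b -> csmooth (dsum p b).
Proof.
move=> rp sb smb; apply: (csmooth_family (G := [set h | exists p b,
  [/\ rapid p, supported b, csmooth b & h = dsum p b]])); last by exists p, b.
move=> _ [q [c [rq sc smc ->]]].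
exists (dsum (fun n => q n * 2 ^+ n) (cderiv c)); last by move=> t; exact: dsum_der.
apply: span_gen; exists (fun n => q n * 2 ^+ n), (cderiv c); split => //.
- exact: rapid_scale.
- exact: supported_cderiv.
- exact: csmooth_cderiv.
Qed.

Definition dpt n : R := 3 / 2 * 2^-1 ^+ n.

(** The point [dpt n] is the centre of the n-th dyadic support. The bump, equal to 1 within 1/8 of
    3/2, prescribes the values p_n there, and its product with u - 3/2 prescribes the slopes q_n
    2^n; around each centre the sum is exactly affine. *)
Lemma special_scalar p q : rapid p -> rapid q -> exists a : R -> R^o,
  [/\ csmooth a, a 0 = 0 & forall n s, `|s| <= 2^-1 ^+ n / 8 ->
      a (dpt n + s) = p n + q n * 2 ^+ n * s].
Proof.
move=> rp rq; have q0 : 0 < 4^-1 :> R by rewrite invr_gt0.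
have [b [sb b1 b0 bb]] := bump_ex (3 / 2 : R) q0.
have sup0 : supported b.
  move=> u; rewrite negb_and -!ltNge => u0; apply: b0; rewrite ler_normr.
  by case/orP: u0 => u0; apply/orP; [right|left]; lra.
pose c (u : R) : R^o := (u - 3 / 2) * b u.
have sup1 : supported c by move=> u /sup0 bu; rewrite /c bu mulr0.
have sc : csmooth c.
  apply: csmoothM sb; exact: csmoothB csmooth_id (csmooth_cst _).
exists (fun t => dsum p b t + dsum q c t); split.
- by apply: csmoothD; exact: csmooth_dsum.
- rewrite !dsum0 ?addr0 // => n; rewrite mulr0; apply/negP => /andP[]; lra.
move=> n s hs; have n0 : 0 < 2 ^+ n :> R by rewrite exprn_gt0.
have E : 2 ^+ n * (dpt n + s) = 3 / 2 + 2 ^+ n * s.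
  by rewrite mulrDr /dpt mulrCA exprVn divff ?mulr1 // lt0r_neq0.
have {}hs : `|2 ^+ n * s| <= 8^-1.
  rewrite normrM (gtr0_norm n0) mulrC -ler_pdivlMr // mulrC -exprVn.
  exact: hs.
have hs' := hs; move: hs'; rewrite ler_norml => /andP[h1 h2].
have nt : 1 < 2 ^+ n * (dpt n + s) < 2 by rewrite E; apply/andP; split; lra.
rewrite !(dsumE _ _ nt) E /c b1; last first.
  by rewrite addrAC subrr add0r; apply: le_trans hs _; lra.
by rewrite !mulr1 addrAC subrr add0r mulrA.
Qed.

End dyadic_sums.

Section plane.
Context {R : realType}.
Notation V := (R * R)%type.
Implicit Types (x y v : V) (d : R).

Definition box d x y := `|y.1 - x.1| < d /\ `|y.2 - x.2| < d.

Lemma box_le d d' x y : d <= d' -> box d x y -> box d' x y.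
Proof. by move=> dd [h1 h2]; split; apply: lt_le_trans dd. Qed.

Lemma box_refl d x : 0 < d -> box d x x.
Proof. by move=> d0; split; rewrite subrr normr0. Qed.

Lemma box_tri d d' x y z : box d x y -> box d' y z -> box (d + d') x z.
Proof.
move=> [h1 h2] [h3 h4]; rewrite addrC; split.
  by rewrite -(subrKA y.1); apply: le_lt_trans (ler_normD _ _) _; rewrite ltrD.
by rewrite -(subrKA y.2); apply: le_lt_trans (ler_normD _ _) _; rewrite ltrD.
Qed.

Definition vsize v := `|v.1| + `|v.2| + 1.

Lemma vsize_gt0 v : 0 < vsize v.
Proof. by rewrite ltr_wpDl // addr_ge0. Qed.

Lemma box_add d x v (r : R) : `|r| * vsize v < d -> box d x (x + r *: v).
Proof.
move=> h; have r0 := normr_ge0 r; have v1 := normr_ge0 v.1.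
have v2 := normr_ge0 v.2; rewrite /vsize in h.
by split; rewrite /= addrAC subrr add0r normrM; nra.
Qed.

(* the special curve lemma of Kriegl-Michor *)
Lemma special_curve x v (y : nat -> V) : (forall n, box (eps n) x (y n)) ->
  exists a b : R -> R^o, [/\ csmooth a, csmooth b, (a 0, b 0) = x &
    forall n s, `|s| <= 2^-1 ^+ n / 8 ->
      (a (dpt n + s), b (dpt n + s)) = y n + (eps n * 2 ^+ n * s) *: v].
Proof.
move=> bx; have re : rapid (@eps R) := @rapid_eps R.
have r1 : rapid (fun n => (y n).1 - x.1).
  by apply: rapid_le re => n; have [h _] := bx n; rewrite (gtr0_norm (eps_gt0 _)) ltW.
have r2 : rapid (fun n => (y n).2 - x.2).
  by apply: rapid_le re => n; have [_ h] := bx n; rewrite (gtr0_norm (eps_gt0 _)) ltW.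
have [a [sa a0 aE]] := special_scalar r1 (rapidM v.1 re).
have [b [sb b0 bE]] := special_scalar r2 (rapidM v.2 re).
exists (fun t => x.1 + a t), (fun t => x.2 + b t); split.
- exact: csmoothD (csmooth_cst _) sa.
- exact: csmoothD (csmooth_cst _) sb.
- by rewrite a0 b0 !addr0; case: x {bx r1 r2 aE bE}.
move=> n s sn; rewrite (aE _ _ sn) (bE _ _ sn).
apply/pair_equal_spec; split; rewrite /= /GRing.scale /=; ring.
Qed.

Lemma dpt_lt d : 0 < d -> exists N, forall n, (N <= n)%N -> `|dpt n| < d.
Proof.
move=> d0; have [N H] := archi_pow2 (divr_gt0 d0 (ltr0n R 2)).
exists N => n /H; rewrite /dpt => h.
have h0 : 0 < 2^-1 ^+ n :> R by rewrite exprn_gt0 // invr_gt0.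
rewrite gtr0_norm ?mulr_gt0 //; lra.
Qed.

Lemma not_box (P : V -> Prop) x :
  ~ (exists2 d, 0 < d & forall y, box d x y -> P y) ->
  forall d, 0 < d -> exists2 y, box d x y & ~ P y.
Proof.
move=> nP d d0; apply: contrapT => H; apply: nP; exists d => // y xy.
by apply: contrapT => nPy; apply: H; exists y.
Qed.

(** Otherwise some points outside [W] converge to [x] at the rate [eps]; a smooth curve passes
    through all of them and through [x] at time 0, which contradicts the openness of its preimage.
    The special curve is used with direction 0. *)
Lemma cinf_open_plane (W : set V) :
  (forall a b : R -> R^o, csmooth a -> csmooth b -> open [set t | W (a t, b t)]) ->
  forall x, W x -> exists2 d, 0 < d & forall y, box d x y -> W y.
Proof.
move=> Wo x Wx; apply: contrapT => nW.
have /choice [y yP] : forall n, exists y, box (eps n) x y /\ ~ W y.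
  by move=> n; have [y xy nWy] := not_box nW (eps_gt0 n); exists y.
have [a [b [sa sb ab0 abE]]] := special_curve 0 (fun n => (yP n).1).
have : nbhs (0 : R) [set t | W (a t, b t)].
  by apply: open_nbhs_nbhs; split; [exact: Wo | rewrite /= ab0].
move=> /nearP [d d0 H]; have [N HN] := dpt_lt d0.
have := H _ (HN N (leqnn N)); rewrite add0r /=.
have := abE N 0; rewrite !addr0 normr0 => -> //.
by rewrite scaler0 addr0; have [] := yP N.
Qed.

End plane.

(** * Directional derivatives of plane maps *)

Section plane_smooth.
Context {R : realType} {E : htvs R}.
Notation V := (R * R)%type.
Implicit Types (x y u v w : V) (F : V -> E) (p : csn E).

Definition csm2 F := forall a b : R -> R^o, csmooth a -> csmooth b ->
  csmooth (fun t => F (a t, b t)).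

Definition line F x v (r : R) := F (x + r *: v).
Definition ddir k v F x := cderivn k (line F x v) 0.

Lemma csm2_line F x v : csm2 F -> csmooth (line F x v).
Proof.
move=> sF; rewrite (_ : line F x v =
    fun r : R => F (r * v.1 + x.1, r * v.2 + x.2)); last first.
  by apply/funext => r; rewrite /line; congr F; apply/pair_equal_spec; split;
    rewrite /= addrC.
by apply: sF; apply: csmoothD (csmooth_cst _); apply: csmoothM csmooth_id (csmooth_cst _).
Qed.

Lemma ddirE k v F x r : cderivn k (line F x v) r = ddir k v F (x + r *: v).
Proof.
rewrite /ddir; have := cderivn_shift (line F x v) r k.
move=> /(congr1 (fun f => f 0)); rewrite addr0 => <-.
by congr cderivn; apply/funext => s; rewrite /line scalerDl addrA.
Qed.

Lemma ddir_der k v F x r : csm2 F ->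
  der (fun r => ddir k v F (x + r *: v)) r (ddir k.+1 v F (x + r *: v)).
Proof.
move=> sF; rewrite -ddirE; under eq_fun do rewrite -ddirE.
exact/csmooth_dern/csm2_line.
Qed.

Lemma ddir0 v F x : ddir 0 v F x = F x.
Proof. by rewrite /ddir /cderivn /= /line scale0r addr0. Qed.

Lemma cderivn_dilate k (f : R -> E) (c t : R) : csmooth f ->
  cderivn k (fun s => f (c * s)) t = c ^+ k *: cderivn k f (c * t).
Proof.
move=> sf; elim: k t => [|k IH] t; first by rewrite expr0 scale1r.
rewrite {1}/cderivn iterS -/(cderivn k _); apply: der_cderiv.
rewrite (_ : cderivn k _ = fun s => c ^+ k *: cderivn k f (c * s)); last first.
  by apply/funext.
rewrite exprSr -scalerA; apply: derZ.
apply: (der_comp (a := fun s => c * s : R^o)); last exact: csmooth_dern.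
by have := derZ c (der_id t); rewrite scaleRE mulr1.
Qed.

(** If boundedness failed, points y_n -> x would exist where the seminorm of the derivative exceeds
    n / c_n^k. The special curve runs through y_n along [v] with speed c_n, so the k-th derivative
    of [F] along it at [dpt n] is c_n^k times the directional one and exceeds [n], whereas it is
    continuous at 0. *)
Lemma ddir_bounded k v F x p : csm2 F ->
  exists M, exists2 d, 0 < d & forall y, box d x y -> p (ddir k v F y) <= M.
Proof.
move=> sF; apply: contrapT => nB.
pose c n : R := eps n * 2 ^+ n.
have c0 n : 0 < c n by rewrite mulr_gt0 ?eps_gt0 ?exprn_gt0.
have /choice [y yP] : forall n : nat, exists y, box (eps n) x y /\
    ~ p (ddir k v F y) <= n%:R / c n ^+ k.
  move=> n; have [|y xy ny] := @not_box R (fun y => p (ddir k v F y) <= n%:R / c n ^+ k) x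
    _ (eps n) (eps_gt0 n); last by exists y.
  by move=> H; apply: nB; exists (n%:R / c n ^+ k).
have [a [b [sa sb ab0 abE]]] := special_curve v (fun n => (yP n).1).
pose g t := F (a t, b t); have sg : csmooth g by exact: sF.
have gE n : cderivn k g (dpt n) = c n ^+ k *: ddir k v F (y n).
  have -> : cderivn k g (dpt n) = cderivn k (fun s => g (dpt n + s)) 0.
    by rewrite cderivn_shift addr0.
  have : \forall s \near 0, g (dpt n + s) = line F (y n) v (c n * s).
    apply/nearP; exists (2^-1 ^+ n / 8) => [|s /ltW sn].
      by rewrite divr_gt0 // exprn_gt0 // invr_gt0.
    by rewrite add0r /g (abE _ _ sn).
  move=> /(cderivn_near k) /nbhs_singleton ->.
  by rewrite cderivn_dilate ?mulr0 //; exact: csm2_line.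
have [d d0 H] := der_cont p ltr01 (csmooth_dern k 0 sg).
have [N HN] := dpt_lt d0; set B := 1 + p (cderivn k g 0).
have [m Hm] : exists m : nat, B < m%:R.
  exists (Num.bound B); apply: archi_boundP.
  by rewrite addr_ge0 ?csn_ge0.
pose n := maxn N m; have := H (dpt n) (HN n (leq_maxl _ _)).
have := csnD p (cderivn k g (dpt n) - cderivn k g 0) (cderivn k g 0).
rewrite subrK add0r => h1 h2.
have : p (cderivn k g (dpt n)) <= B by apply: le_trans h1 _; rewrite lerD2r.
rewrite gE csnZ ger0_norm ?exprn_ge0 ?(ltW (c0 n)) //.
have ck : 0 < c n ^+ k by rewrite exprn_gt0.
rewrite mulrC -ler_pdivlMr // => h3; apply: (yP n).2; apply: le_trans h3 _.
rewrite ler_pM2r ?invr_gt0 //; apply: ltW; apply: lt_le_trans Hm _.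
by rewrite ler_nat leq_maxr.
Qed.

(** Both first partial derivatives are locally bounded; the mean value inequality is applied along
    the two sides of the corner (x.1, y.2). *)
Lemma csm2_cont0 F x p e : csm2 F -> 0 < e ->
  exists2 d, 0 < d & forall y, box d x y -> p (F y - F x) <= e.
Proof.
move=> sF e0; have [M1 [d1 d10 H1]] := ddir_bounded 1 (1, 0) x p sF.
have [M2 [d2 d20 H2]] := ddir_bounded 1 (0, 1) x p sF.
pose M := Num.max M1 M2; have M1M : M1 <= M by rewrite le_max lexx.
have M2M : M2 <= M by rewrite le_max lexx orbT.
have M0 : 0 <= M.
  by apply: le_trans M1M; apply: le_trans (H1 x (box_refl x d10)); exact: csn_ge0.
pose d := Num.min (Num.min d1 d2) (e / (2 * (M + 1))).
have M10 : 0 < 2 * (M + 1) by lra.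
exists d; first by rewrite !lt_min d10 d20 divr_gt0.
move=> y [y1 y2]; move: (y1) (y2); rewrite !lt_min.
move=> /andP[/andP[y11 y12] y13] /andP[/andP[y21 y22] y23].
apply: le_trans (csn_tri p _ (F (x.1, y.2)) _) _.
have -> : e = (M + 1) * (e / (2 * (M + 1))) + (M + 1) * (e / (2 * (M + 1))).
  by field; lra.
apply: lerD.
  have -> : F y = line F (x.1, y.2) (1, 0) (0 + (y.1 - x.1)).
    rewrite add0r /line; congr F; rewrite [LHS]surjective_pairing.
    by apply/pair_equal_spec; split; rewrite /= /GRing.scale /=; ring.
  have -> : F (x.1, y.2) = line F (x.1, y.2) (1, 0) 0 by rewrite /line scale0r addr0.
  apply: le_trans (mvt_abs (M := M + 1) _) _; last first.
    by rewrite ler_pM2l ?ltW //; lra.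
  move=> s sy; exists (ddir 1 (1, 0) F ((x.1, y.2) + (0 + s) *: (1, 0))).
    rewrite -ddirE; exact/csmooth_der/csm2_line.
  rewrite add0r; apply: (@le_trans _ _ M1); last lra.
  apply: H1; split; rewrite /= /GRing.scale /= ?mulr1 ?mulr0 ?addr0.
    by rewrite addrAC subrr add0r; apply: le_lt_trans sy _.
  by [].
have -> : F (x.1, y.2) = line F x (0, 1) (0 + (y.2 - x.2)).
  rewrite add0r /line; congr F.
  by apply/pair_equal_spec; split; rewrite /= /GRing.scale /=; ring.
have -> : F x = line F x (0, 1) 0 by rewrite /line scale0r addr0.
apply: le_trans (mvt_abs (M := M + 1) _) _; last first.
  by rewrite ler_pM2l ?ltW //; lra.
move=> s sy; exists (ddir 1 (0, 1) F (x + (0 + s) *: (0, 1))).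
  rewrite -ddirE; exact/csmooth_der/csm2_line.
rewrite add0r; apply: (@le_trans _ _ M2); last lra.
apply: H2; split; rewrite /= /GRing.scale /= ?mulr1 ?mulr0 ?addr0.
  by rewrite subrr normr0.
by rewrite addrAC subrr add0r; apply: le_lt_trans sy _.
Qed.

(** By the bound on the derivative of order k + 2, the difference quotient of the k-th derivative
    with a fixed step [h] approximates the derivative of order k + 1 uniformly near [x], with error
    M h < e / 4. For that [h] the quotient is continuous by induction. *)
Lemma ddir_cont k v F x p e : csm2 F -> 0 < e ->
  exists2 d, 0 < d & forall y, box d x y -> p (ddir k v F y - ddir k v F x) <= e.
Proof.
move=> sF; elim: k x e => [|k IH] x e e0.
  have [d d0 H] := csm2_cont0 x p sF e0; exists d => // y.
  by rewrite !ddir0; exact: H.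
have [M' [d d0 H]] := ddir_bounded k.+2 v x p sF.
pose M := M' + 1; have M0 : 0 < M.
  rewrite ltr_wpDl //; apply: le_trans (H x (box_refl x d0)); exact: csn_ge0.
have vs := vsize_gt0 v.
have d2 : 0 < d / 2 / vsize v by rewrite !divr_gt0.
pose h := Num.min (d / 2 / vsize v) (e / (4 * M)) / 2.
have m0 : 0 < Num.min (d / 2 / vsize v) (e / (4 * M)).
  by rewrite lt_min d2 divr_gt0 // mulr_gt0.
have h0 : 0 < h by rewrite /h; lra.
have [hd hM] : h < d / 2 / vsize v /\ M * h < e / 4.
  have : h < Num.min (d / 2 / vsize v) (e / (4 * M)) by rewrite /h; lra.
  rewrite lt_min => /andP[-> /=]; rewrite ltr_pdivlMr ?mulr_gt0 //; lra.
have key y : box (d / 2) x y ->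
    p (ddir k v F (y + h *: v) - ddir k v F y - h *: ddir k.+1 v F y) <= M * h * h.
  move=> xy; pose f r := ddir k v F (y + r *: v) - r *: ddir k.+1 v F y.
  have -> : ddir k v F (y + h *: v) - ddir k v F y - h *: ddir k.+1 v F y =
      f (0 + h) - f 0.
    by rewrite /f !add0r !scale0r addr0 subr0 addrAC.
  have inb (s : R) : `|s| <= h -> box d x (y + s *: v).
    move=> sh; rewrite [d](splitr d); apply: box_tri xy _; apply: box_add.
    by rewrite -ltr_pdivlMr //; apply: le_lt_trans sh _.
  have -> : M * h * h = M * h * `|h| by rewrite gtr0_norm.
  apply: mvt_abs => s; rewrite (gtr0_norm h0) => sh.
  exists (ddir k.+1 v F (y + s *: v) - ddir k.+1 v F y).
    by rewrite add0r; apply: derB; [exact: ddir_der | exact: der_line].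
  have -> : ddir k.+1 v F y = ddir k.+1 v F (y + 0 *: v) by rewrite scale0r addr0.
  have := @mvt_abs R E (fun r => ddir k.+1 v F (y + r *: v)) 0 s M p.
  rewrite add0r => mv; apply: le_trans (mv _) _; last by rewrite ler_pM2l.
  move=> r rs; exists (ddir k.+2 v F (y + (0 + r) *: v)); first exact: ddir_der.
  rewrite add0r; apply: (@le_trans _ _ M'); last by rewrite /M; lra.
  by apply: H; apply: inb; apply: le_trans rs _.
have e4 : 0 < h * (e / 4) by rewrite mulr_gt0 // divr_gt0.
have [d3 d30 H3] := IH (x + h *: v) _ e4.
have [d4 d40 H4] := IH x _ e4.
exists (Num.min (d / 2) (Num.min d3 d4)).
  by rewrite !lt_min d30 d40 divr_gt0.
move=> y xy; have xy2 : box (d / 2) x y.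
  by apply: box_le xy; rewrite ge_min lexx.
have xy3 : box d3 (x + h *: v) (y + h *: v).
  have [h1 h2] : box d3 x y by apply: box_le xy; rewrite !ge_min lexx orbT.
  by split; rewrite /= opprD addrACA subrr addr0.
have xy4 : box d4 x y by apply: box_le xy; rewrite !ge_min lexx !orbT.
have k1 := key y xy2; have k2 := key x (box_refl x (divr_gt0 d0 (ltr0n R 2))).
have k3 := H3 _ xy3; have k4 := H4 _ xy4.
rewrite -(ler_pM2l h0) -{1}(gtr0_norm h0) -csnZ.
set A := ddir k v F (y + h *: v) in k1 k3; set B := ddir k v F y in k1 k4.
set C := ddir k v F (x + h *: v) in k2 k3; set D := ddir k v F x in k2 k4.
set P := ddir k.+1 v F y in k1 *; set Q := ddir k.+1 v F x in k2 *.
have -> : h *: (P - Q) = - (A - B - h *: P) + (C - D - h *: Q) + ((A - C) - (B - D)).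
  by lmod_with R E; ring.
apply: le_trans (csnD _ _ _) _; apply: le_trans (lerD (csnD _ _ _) (csnB _ _ _)) _.
rewrite csnN; nra.
Qed.

End plane_smooth.

(* Djokovic's identity: mixed finite differences are combinations of
   iterated differences in a single direction *)
Section differences.
Context {R : realType} {V : lmodType R} {E : lmodType R}.
Implicit Types (F : V -> E) (l : seq (V * V)).

Fixpoint mixdiff (us : seq V) F x : E :=
  if us is u :: us' then mixdiff us' F (x + u) - mixdiff us' F x else F x.

(** The alternating sum of (-1)^j binom(n, j) G(j), which is (-1)^n times the forward difference;
    hence the factors (-h)^n and (-1)^n below. *)
Fixpoint ndiff n (G : nat -> E) : E :=
  if n is n'.+1 then ndiff n' G - ndiff n' (fun j => G j.+1) else G 0%N.

(* the signed points of the expansion of a mixed difference with directions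
   [q.1 + j *: q.2], as affine functions of [j] *)
Fixpoint dterms l : seq (R * V * V) :=
  if l is q :: l' then
    [seq (z.1.1, z.1.2 + q.1, z.2 + q.2) | z <- dterms l'] ++
    [seq (- z.1.1, z.1.2, z.2) | z <- dterms l']
  else [:: (1, 0, 0)].

Lemma mixdiff_dterms l F x (h j : R) :
  mixdiff [seq h *: q.1 + j *: (h *: q.2) | q <- l] F x =
  \sum_(z <- dterms l) z.1.1 *: F (x + h *: z.1.2 + j *: (h *: z.2)).
Proof.
elim: l x => [|q l IH] x /=.
  by rewrite big_seq1 !scaler0 !addr0 scale1r.
rewrite big_cat /= !big_map !IH; congr (_ + _).
  apply: eq_bigr => z _; congr (_ *: F _) => /=.
  by rewrite !scalerDr; lmod_with R V; ring.
by rewrite -sumrN; apply: eq_bigr => z _; rewrite scaleNr.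
Qed.

Lemma mixdiff_0 us F x : 0 \in us -> mixdiff us F x = 0.
Proof.
elim: us x => // u us IH x; rewrite inE => /predU1P[<-|us0] /=.
  by rewrite addr0 subrr.
by rewrite !IH // subr0.
Qed.

Lemma ndiffB n (G H : nat -> E) : ndiff n (fun j => G j - H j) = ndiff n G - ndiff n H.
Proof.
elim: n G H => //= n IH G H; rewrite !IH.
by rewrite !opprD !opprK addrACA.
Qed.

Lemma ndiff_sum n (I : Type) (s : seq I) (c : I -> R) (G : I -> nat -> E) :
  ndiff n (fun j => \sum_(i <- s) c i *: G i j) = \sum_(i <- s) c i *: ndiff n (G i).
Proof.
elim: n G => //= n IH G; rewrite !IH -sumrB.
by apply: eq_bigr => i _; rewrite scalerBr.
Qed.

Lemma ndiff_first n (G : nat -> E) : (forall j, (0 < j <= n)%N -> G j = 0) ->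
  ndiff n G = G 0%N.
Proof.
have N0 k (H : nat -> E) : (forall j, (j <= k)%N -> H j = 0) -> ndiff k H = 0.
  elim: k H => [|k IH] H H0 /=; first exact: H0.
  by rewrite !IH ?subr0 // => j jk; apply: H0 => //; exact: leqW.
elim: n => //= n IH G0; rewrite IH => [|j /andP[j0 jn]].
  by rewrite N0 ?subr0 // => j jn; apply: G0.
by apply: G0; rewrite j0 leqW.
Qed.

(** The k-th direction, counted from 0, is deformed to u - (j / (k + 1)) u, which vanishes at j = k
    + 1. So for each [j] from 1 to n one direction is 0 and the mixed difference vanishes, and the
    alternating sum over [j] retains only j = 0, the difference to be computed. *)
Fixpoint djok_dirs k (us : seq V) : seq (V * V) :=
  if us is u :: us' then (u, - (k.+1%:R^-1 *: u)) :: djok_dirs k.+1 us' else [::].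

Lemma djokovic us F x (h : R) : mixdiff [seq h *: u | u <- us] F x =
  \sum_(z <- dterms (djok_dirs 0 us)) z.1.1 *:
    ndiff (size us) (fun j => F (x + h *: z.1.2 + j%:R *: (h *: z.2))).
Proof.
rewrite -ndiff_sum.
rewrite (_ : (fun j : nat => _) = fun j : nat => mixdiff
  [seq h *: q.1 + j%:R *: (h *: q.2) | q <- djok_dirs 0 us] F x); last first.
  by apply/funext => j; rewrite mixdiff_dterms.
rewrite ndiff_first => [|j /andP[j0 jn]].
  have H0 k : [seq h *: u | u <- us] =
      [seq h *: q.1 + 0 *: (h *: q.2) | q <- djok_dirs k us].
    by elim: us k => //= u us IH k; rewrite scale0r addr0 -IH.
  by rewrite -H0.
apply: mixdiff_0.
have H k : (k < j <= k + size us)%N ->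
    0 \in [seq h *: q.1 + j%:R *: (h *: q.2) | q <- djok_dirs k us].
  elim: us k {jn} => [|u us IH] k /=; first by rewrite addn0 ltnNge andbC andbN.
  rewrite leq_eqVlt inE => /andP[/predU1P[<-|kj] jk]; apply/orP.
    left; rewrite scalerN scalerA mulrC -scalerA scalerN scalerA.
    by rewrite mulfV ?pnatr_eq0 // scale1r subrr.
  by right; apply: IH; rewrite kj addSnnS.
by apply: H; rewrite j0.
Qed.

Lemma mixdiff_nseq n u F x :
  mixdiff (nseq n u) F x = (-1) ^+ n *: ndiff n (fun j => F (x + j%:R *: u)).
Proof.
elim: n x => [|n IH] x /=; first by rewrite scale0r addr0 expr0 scale1r.
rewrite !IH exprS mulN1r scaleNr -scalerN opprB scalerBr; congr (_ *: ndiff n _ - _).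
by apply/funext => j; rewrite -natr1 scalerDl scale1r -addrA (addrC u).
Qed.

End differences.

Section ndiff_derivatives.
Context {R : realType} {E : htvs R}.

(** Induction on [n]: one difference is moved into the function, replacing each D_k by s -> D_k(s) -
    D_k(s + h), and the mean value inequality compares D_n(s) - D_n(s + h) with - h L. *)
Lemma ndiff_mvt n (D : nat -> R -> E) (p : csn E) (L : E) (e t h : R) :
  (forall k s, der (D k) s (D k.+1 s)) ->
  (forall s, `|s - t| <= n%:R * `|h| -> p (D n s - L) <= e) ->
  p (ndiff n (fun j => D 0%N (t + j%:R * h)) - (- h) ^+ n *: L) <= `|h| ^+ n * e.
Proof.
elim: n D L e => [|n IH] D L e DD H.
  rewrite /= mul0r addr0 !expr0 scale1r mul1r; apply: H.
  by rewrite subrr normr0 mul0r.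
pose D' k s := D k s - D k (s + h).
have -> : ndiff n.+1 (fun j => D 0%N (t + j%:R * h)) =
    ndiff n (fun j => D' 0%N (t + j%:R * h)).
  rewrite /= -ndiffB; congr ndiff; apply/funext => j.
  by rewrite /D' -natr1 mulrDl mul1r addrA.
have -> : (- h) ^+ n.+1 *: L = (- h) ^+ n *: (- h *: L).
  by rewrite exprSr scalerA.
rewrite exprSr -mulrA; apply: IH.
  move=> k s; apply: derB; first exact: DD.
  by apply: der_shift; exact: DD.
move=> s sn; rewrite /D'.
pose f r := D n r - r *: L.
have -> : D n s - D n (s + h) - - h *: L = - (f (s + h) - f s).
  by rewrite /f; lmod_with R E; ring.
rewrite csnN mulrC; apply: mvt_abs => r rh; exists (D n.+1 (s + r) - L).
  by apply: derB; [exact: DD | exact: der_line].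
apply: H; rewrite addrAC; apply: le_trans (ler_normD _ _) _.
by rewrite -natr1 mulrDl mul1r lerD.
Qed.

End ndiff_derivatives.

Section mixed_derivatives.
Context {R : realType} {E : htvs R}.
Notation V := (R * R)%type.
Implicit Types (x y u v w : V) (F : V -> E) (p : csn E).

Lemma line_ndiff F y (a : V) p (L : E) (e h : R) n : csm2 F ->
  (forall s, `|s| <= n%:R * `|h| -> p (ddir n a F (y + s *: a) - L) <= e) ->
  p (ndiff n (fun j => F (y + j%:R *: (h *: a))) - (- h) ^+ n *: L) <= `|h| ^+ n * e.
Proof.
move=> sF H; have := @ndiff_mvt R E n (fun k => cderivn k (line F y a)) p L e 0 h.
rewrite (_ : ndiff _ _ = ndiff n (fun j => F (y + j%:R *: (h *: a)))); last first.
  congr ndiff; apply/funext => j; rewrite /cderivn /= add0r /line scalerA.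
  by [].
apply; first by move=> k s; exact/csmooth_dern/csm2_line.
by move=> s; rewrite subr0 ddirE; exact: H.
Qed.

(** The mixed derivative in the directions [us], written through derivatives in single directions
    with the coefficients of [djokovic]. *)
Definition mixsum (us : seq V) F x : E := (-1) ^+ size us *:
  \sum_(z <- dterms (djok_dirs 0 us)) z.1.1 *: ddir (size us) z.2 F x.

Lemma csn_sum p (I : eqType) (s : seq I) (f : I -> E) (g : I -> R) :
  (forall i, i \in s -> p (f i) <= g i) -> p (\sum_(i <- s) f i) <= \sum_(i <- s) g i.
Proof.
elim: s => [|i s IH] fg; first by rewrite !big_nil csn0.
rewrite !big_cons; apply: le_trans (csnD _ _ _) _; apply: lerD.
  by apply: fg; rewrite mem_head.
by apply: IH => j js; apply: fg; rewrite inE js orbT.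
Qed.

(** The estimate is uniform in the base point [y], which allows many small differences to be added
    along a segment in [mixed_der]. *)
Lemma mixdiff_near us F x p e : csm2 F -> 0 < e -> exists2 d, 0 < d &
  forall y h, box d x y -> `|h| < d ->
    p (mixdiff [seq h *: u | u <- us] F y - h ^+ size us *: mixsum us F x) <=
      e * `|h| ^+ size us.
Proof.
move=> sF e0; set n := size us; set T := dterms (djok_dirs 0 us).
have [c [c0 cT]] : exists c : R, 0 < c /\ \sum_(z <- T) `|z.1.1| * c <= e.
  pose S := \sum_(z <- T) `|z.1.1|.
  have S0 : 0 <= S by apply: sumr_ge0.
  have S1 : 0 < S + 1 by lra.
  exists (e / (S + 1)); split; first exact: divr_gt0.
  by rewrite -mulr_suml mulrA ler_pdivrMr // mulrC ler_pM2l //; rewrite -/S; lra.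
have [d d0 H] : exists2 d, 0 < d & forall y z h s, z \in T -> box d x y -> `|h| < d ->
    `|s| <= n%:R * `|h| -> p (ddir n z.2 F (y + h *: z.1.2 + s *: z.2) - ddir n z.2 F x) <= c.
  elim: T {cT} => [|z T [d d0 IH]]; first by exists 1.
  have v0 := vsize_gt0 z.2; have v1 := vsize_gt0 z.1.2.
  have [d' d'0 H] := ddir_cont n z.2 x p sF c0.
  pose k : R := vsize z.1.2 + n%:R * vsize z.2.
  have k0 : 0 < k.
    by rewrite ltr_wpDr ?vsize_gt0 // mulr_ge0 // ltW // vsize_gt0.
  pose d2 := Num.min (d' / 2) (d' / 4 / k).
  have d20 : 0 < d2 by rewrite lt_min !divr_gt0.
  exists (Num.min d d2); first by rewrite lt_min d0.
  move=> y z' h s; rewrite inE => /predU1P[->|zT] xy; rewrite lt_min => /andP[hd hd2] sh.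
    apply: H; have xy' : box (d' / 2) x y.
      by apply: box_le xy; rewrite !ge_min lexx !orbT.
    rewrite [d'](splitr d') -addrA; apply: box_tri xy' _.
    have hk : `|h| * k < d' / 4.
      move: hd2; rewrite lt_min => /andP[_]; by rewrite ltr_pdivlMr.
    rewrite (_ : d' / 2 = d' / 4 + d' / 4); last by field.
    rewrite addrA; apply: (@box_tri _ _ _ _ (y + h *: z.1.2)); apply: box_add.
      apply: le_lt_trans hk; apply: ler_wpM2l => //.
      by rewrite /k lerDl mulr_ge0 // ltW.
    apply: le_lt_trans hk.
    apply: (@le_trans _ _ (n%:R * `|h| * vsize z.2)); first by rewrite ler_pM2r.
    rewrite mulrAC mulrC; apply: ler_wpM2l => //.
    by rewrite /k lerDr ltW.
  apply: IH => //; apply: box_le xy; by rewrite ge_min lexx.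
exists d => // y h xy hd; rewrite djokovic /mixsum -/n -/T.
rewrite scalerA -exprMn mulrN1 scaler_sumr -sumrB.
apply: (@le_trans _ _ (\sum_(z <- T) (`|z.1.1| * c * `|h| ^+ n))); last first.
  by rewrite -mulr_suml ler_wpM2r // exprn_ge0.
apply: csn_sum => z zT.
rewrite scalerA mulrC -scalerA -scalerBr csnZ -mulrA (mulrC c) ler_wpM2l //.
apply: line_ndiff => // s sh; exact: H.
Qed.

(** Both sides are the limit of the same difference quotient of order [k]. *)
Lemma mixsum_nseq k u F x : csm2 F -> mixsum (nseq k u) F x = ddir k u F x.
Proof.
move=> sF; apply/eqP; rewrite -subr_eq0; apply/eqP/(csn_eq0 (@htvs_hausdorff R E)) => p.
apply/le_anti; rewrite csn_ge0 andbT; apply/ler_addgt0Pr => e e0; rewrite add0r.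
have e2 : 0 < e / 2 by rewrite divr_gt0.
have [d d0 H] := mixdiff_near (nseq k u) x p sF e2.
have [d' d'0 H'] := ddir_cont k u x p sF e2.
have v0 := vsize_gt0 u.
have k1 : 0 < k%:R * vsize u + 1 by rewrite ltr_wpDl // mulr_ge0 // ltW.
pose h := Num.min d (d' / (k%:R * vsize u + 1)) / 2.
have m0 : 0 < Num.min d (d' / (k%:R * vsize u + 1)) by rewrite lt_min d0 divr_gt0.
have h0 : 0 < h by rewrite /h; lra.
have : h < Num.min d (d' / (k%:R * vsize u + 1)) by rewrite /h; lra.
rewrite lt_min ltr_pdivlMr // => /andP[hd hd'].
have := H x h (box_refl x d0); rewrite (gtr0_norm h0) => /(_ hd).
rewrite size_nseq map_nseq mixdiff_nseq => h1.
have : p (ndiff k (fun j => F (x + j%:R *: (h *: u))) - (- h) ^+ k *: ddir k u F x)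
    <= `|h| ^+ k * (e / 2).
  apply: line_ndiff => // s; rewrite (gtr0_norm h0) => sh; apply: H'; apply: box_add.
  apply: le_lt_trans hd'.
  apply: (@le_trans _ _ (k%:R * h * vsize u)); first by rewrite ler_pM2r.
  rewrite (_ : h * (_ + 1) = k%:R * h * vsize u + h); last by ring.
  by rewrite lerDl ltW.
rewrite (gtr0_norm h0) => h2.
have hk : 0 < h ^+ k by rewrite exprn_gt0.
rewrite -(ler_pM2l hk) -{1}(gtr0_norm hk) -csnZ.
set A := ndiff _ _ in h1 h2; set B := mixsum _ _ _ in h1 *; set C := ddir _ _ _ _ in h2 *.
have s1 : (-1) ^+ k * (-1) ^+ k = 1 :> R by rewrite -exprMn mulrNN mulr1 expr1n.
have -> : h ^+ k *: (B - C) = - ((-1) ^+ k *: A - h ^+ k *: B) +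
    (-1) ^+ k *: (A - (- h) ^+ k *: C).
  rewrite (_ : (- h) ^+ k = (-1) ^+ k * h ^+ k); last by rewrite -exprMn mulN1r.
  have qE (q z : R) : q * q = 1 -> q *: (A - (q * z) *: C) = q *: A - z *: C.
    by move=> qq; rewrite scalerBr scalerA mulrA qq mul1r.
  by rewrite qE //; lmod_with R E; ring.
apply: le_trans (csnD _ _ _) _; rewrite csnN csnZ normrX normrN1 expr1n mul1r.
by apply: le_trans (lerD h1 h2) _; lra.
Qed.

(** An increment [b] in direction [w] is cut into [N] steps h = b / N. On each step the mixed
    difference is h^(k+1) m up to e |h|^(k+1); the sum telescopes to the increment of the k-th
    difference [Q h], which is therefore b h^k m up to e |b| |h|^k. Division by h^k and h -> 0 turn
    [Q h] into the k-th derivative along [u]. *)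
Lemma mixed_der k u w F x : csm2 F ->
  der (fun r => ddir k u F (x + r *: w)) 0 (mixsum (w :: nseq k u) F x).
Proof.
move=> sF p e e0.
have [d d0 H] := mixdiff_near (w :: nseq k u) x p sF e0.
have vw := vsize_gt0 w.
exists (Num.min 1 d / vsize w); first by rewrite divr_gt0 // lt_min d0 ltr01.
move=> b; rewrite ltr_pdivlMr // => bd; rewrite add0r scale0r addr0.
have [->|b0] := eqVneq b 0; first by rewrite !scale0r addr0 subrr subr0 csn0 normr0 mulr0.
set m := mixsum _ _ _ in H *; apply/ler_addgt0Pr => n n0.
have bd' : `|b| * vsize w < d by apply: lt_le_trans bd _; rewrite ge_min lexx orbT.
pose Q h y := mixdiff [seq h *: v | v <- nseq k u] F y.
have step h : `|h| < d -> forall N : nat, N%:R * `|h| <= `|b| ->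
    p (Q h (x + (N%:R * h) *: w) - Q h x - (N%:R * h ^+ k.+1) *: m) <=
    N%:R * e * `|h| ^+ k.+1.
  move=> hd; elim=> [|N IH] Nh.
    by rewrite !mul0r !scale0r addr0 subrr subr0 csn0.
  have Nh' : N%:R * `|h| <= `|b|.
    by apply: le_trans Nh; rewrite ler_wpM2r // ler_nat.
  have xN : box d x (x + (N%:R * h) *: w).
    apply: box_add; rewrite normrM [ `|N%:R|]ger0_norm //.
    by apply: le_lt_trans bd'; rewrite ler_pM2r.
  have := H _ h xN hd; rewrite [mixdiff _ _ _]/= /= size_nseq -/(Q h _) -/(Q h _) => h1.
  have -> : N.+1%:R * e * `|h| ^+ k.+1 = N%:R * e * `|h| ^+ k.+1 + e * `|h| ^+ k.+1.
    by rewrite -natr1; ring.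
  have -> : x + (N.+1%:R * h) *: w = x + (N%:R * h) *: w + h *: w.
    by rewrite -natr1 mulrDl mul1r scalerDl addrA.
  apply: le_trans (lerD (IH Nh') h1); apply: le_trans (csnD _ _ _).
  rewrite -natr1 le_eqVlt; apply/orP; left; apply/eqP.
  have alg (A B C M : E) (X c : R) :
      A - C - ((c + 1) * X) *: M = (B - C - (c * X) *: M) + (A - B - X *: M).
    by lmod_with R E; ring.
  by congr (csn_fun p _); exact: alg.
have lim y : forall n, 0 < n -> exists2 d', 0 < d' & forall h, `|h| < d' -> h != 0 ->
    p (Q h y - h ^+ k *: ddir k u F y) <= n * `|h| ^+ k.
  move=> n' n'0; have [d' d'0 H'] := mixdiff_near (nseq k u) y p sF n'0.
  exists d' => // h hd' _; have := H' y h (box_refl y d'0) hd'.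
  by rewrite mixsum_nseq // size_nseq.
have n2 : 0 < n / 2 by rewrite divr_gt0.
have [d1 d10 H1] := lim (x + b *: w) _ n2; have [d2 d20 H2] := lim x _ n2.
pose d3 := Num.min d (Num.min d1 d2).
have d30 : 0 < d3 by rewrite !lt_min d0 d10.
have [N HN] : exists N : nat, `|b| / d3 < N%:R.
  by exists (Num.bound (`|b| / d3)); apply: archi_boundP; rewrite divr_ge0 // ltW.
have N0 : 0 < N%:R :> R by apply: le_lt_trans HN; rewrite divr_ge0 // ltW.
pose h := b / N%:R; have Nn := lt0r_neq0 N0.
have hd3 : `|h| < d3.
  rewrite normrM normfV (gtr0_norm N0).
  by rewrite ltr_pdivrMr // mulrC -ltr_pdivrMr.
have h0 : h != 0 by rewrite mulf_neq0 // invr_eq0.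
have Nh : N%:R * h = b by rewrite /h mulrC divfK.
have Nh' : N%:R * `|h| = `|b|.
  by rewrite -{1}(gtr0_norm N0) -normrM Nh.
move: hd3; rewrite !lt_min => /and3P[hd hd1 hd2].
have k1 := H1 h hd1 h0; have k2 := H2 h hd2 h0.
have := step h hd N; rewrite Nh' lexx => /(_ isT); rewrite Nh => k3.
have hk : 0 < `|h| ^+ k by rewrite exprn_gt0 // normr_gt0.
rewrite -(ler_pM2l hk) -normrX -csnZ normrX.
set A := Q h _ in k1 k3; set B := ddir _ _ _ _ in k1 *; set C := Q h x in k2 k3.
set D := ddir _ _ _ _ in k2 *.
have -> : h ^+ k *: (B - D - b *: m) = - (A - h ^+ k *: B) + (C - h ^+ k *: D) +
    (A - C - (N%:R * h ^+ k.+1) *: m).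
  rewrite -{1}Nh exprSr; by lmod_with R E; ring.
apply: le_trans (csnD _ _ _) _; apply: le_trans (lerD (csnD _ _ _) k3) _.
rewrite csnN; apply: le_trans (lerD (lerD k1 k2) (lexx _)) _.
rewrite -Nh' exprSr; set X := `|h| ^+ k; set Y := `|h|; set Z := N%:R.
by rewrite le_eqVlt; apply/orP; left; apply/eqP; field.
Qed.

End mixed_derivatives.

(** * Partial derivatives of plane maps: symmetry and chain rule *)

Section plane_calculus.
Context {R : realType} {E : htvs R}.
Notation V := (R * R)%type.
Implicit Types (x y u v w : V) (F : V -> E) (p : csn E).

Lemma der_shift0 (f : R -> E) t (v : E) : der (fun r => f (t + r)) 0 v -> der f t v.
Proof.
move=> fv; have := @der_shift R E (fun r => f (t + r)) t (- t) v.
rewrite subrr => /(_ fv); apply: der_near; apply/nearP; exists 1 => // h _.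
by rewrite addrAC subrr add0r.
Qed.

Lemma span_sum (G : set (R -> E)) (I : Type) (s : seq I) (c : I -> R)
    (g : I -> R -> E) g0 : G g0 -> (forall i, G (g i)) ->
  smooth_span G (fun t => \sum_(i <- s) c i *: g i t).
Proof.
move=> G0 Gg; elim: s => [|i s IH].
  rewrite (_ : (fun t => _) = fun t => (0 : R^o) *: g0 t).
    by apply: (span_scale (a := fun=> 0)); [exact: csmooth_cst | exact: span_gen].
  by apply/funext => t; rewrite big_nil scale0r.
under eq_fun do rewrite big_cons; apply: span_add => //.
apply: (span_scale (a := fun=> c i)); [exact: csmooth_cst | exact: span_gen].
Qed.

(** Along a curve the derivative becomes one in the first variable of the plane map H(r, t) =
    F(curve(t) + r u), at the points (0, t). By [mixed_der], differentiating in [t] gives a [mixsum]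
    of [H], a combination of directional derivatives at the same points, so these functions form a
    stable family. *)
Lemma csm2_ddir k u F : csm2 F -> csm2 (ddir k u F).
Proof.
move=> sF a b sa sb.
pose H x := F ((a x.2, b x.2) + x.1 *: u).
have sH : csm2 H.
  move=> a' b' sa' sb'; apply: (sF (fun t => a (b' t) + a' t * u.1) (fun t => b (b' t) + a' t * u.2)).
    by apply: csmoothD; [exact: csmooth_comp | exact: csmoothM sa' (csmooth_cst _)].
  by apply: csmoothD; [exact: csmooth_comp | exact: csmoothM sa' (csmooth_cst _)].
have -> : (fun t => ddir k u F (a t, b t)) = fun t => ddir k (1, 0) H (0, t).
  apply/funext => t; rewrite /ddir; congr (cderivn k _ 0).
  apply/funext => r; rewrite /line /H /= [r *: 0]mulr0 [r *: 1]mulr1 add0r addr0.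
  by [].
apply: (csmooth_family (G := [set h | exists k v, h = fun t => ddir k v H (0, t)]));
  last by exists k, (1, 0).
move=> _ [n [v ->]]; exists (fun t => mixsum ((0, 1) :: nseq n v) H (0, t)).
  apply: (span_scale (a := fun=> (-1) ^+ size ((0, 1) :: nseq n v))).
    exact: csmooth_cst.
  apply: (@span_sum _ _ _ _ _ (fun t => ddir n v H (0, t))); first by exists n, v.
  by move=> z; exists (size ((0, 1) :: nseq n v)), z.2.
move=> t; apply: der_shift0; have := mixed_der n v (0, 1) (0, t) sH.
apply: der_near; apply/nearP; exists 1 => // r _; congr ddir.
by apply/pair_equal_spec; rewrite /= [_ *: 0]mulr0 [_ *: 1]mulr1 !add0r.
Qed.

Lemma mixdiffC u w F x : mixdiff [:: u; w] F x = mixdiff [:: w; u] F x.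
Proof.
have alg (A B C D : E) : A - B - (C - D) = A - C - (B - D).
  by lmod_with R E; ring.
by rewrite /= (addrAC x u w); exact: alg.
Qed.

(** Second differences are symmetric by inspection, and both sides are limits of the same second
    difference divided by h^2. *)
Lemma mixsumC u w F x : csm2 F -> mixsum [:: u; w] F x = mixsum [:: w; u] F x.
Proof.
move=> sF; apply/eqP; rewrite -subr_eq0; apply/eqP/(csn_eq0 (@htvs_hausdorff R E)) => p.
apply/le_anti; rewrite csn_ge0 andbT; apply/ler_addgt0Pr => e e0; rewrite add0r.
have e2 : 0 < e / 2 by rewrite divr_gt0.
have [d d0 H] := mixdiff_near [:: u; w] x p sF e2.
have [d' d'0 H'] := mixdiff_near [:: w; u] x p sF e2.
pose h := Num.min d d' / 2.
have m0 : 0 < Num.min d d' by rewrite lt_min d0.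
have h0 : 0 < h by rewrite /h; lra.
have : h < Num.min d d' by rewrite /h; lra.
rewrite lt_min => /andP[hd hd'].
have := H x h (box_refl x d0); have := H' x h (box_refl x d'0).
rewrite (gtr0_norm h0) => /(_ hd') h1 /(_ hd) h2.
have /= hk : 0 < h ^+ 2 by rewrite exprn_gt0.
rewrite -(ler_pM2l hk) -{1}(gtr0_norm hk) -csnZ.
set B := mixsum _ F x; set C := mixsum _ F x.
pose A := mixdiff [:: h *: u; h *: w] F x.
have {}h1 : p (A - h ^+ 2 *: C) <= e / 2 * h ^+ 2 by rewrite /A mixdiffC; exact: h1.
have {}h2 : p (A - h ^+ 2 *: B) <= e / 2 * h ^+ 2 by exact: h2.
have -> : h ^+ 2 *: (B - C) = (A - h ^+ 2 *: C) - (A - h ^+ 2 *: B).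
  by lmod_with R E; ring.
by apply: le_trans (csnB _ _ _) _; lra.
Qed.

Lemma ddirC u w F x : csm2 F ->
  ddir 1 w (ddir 1 u F) x = ddir 1 u (ddir 1 w F) x.
Proof.
move=> sF; transitivity (mixsum [:: w; u] F x).
  by apply: der_cderiv; exact: (mixed_der 1 u w x sF).
rewrite mixsumC //; apply/esym/der_cderiv; exact: (mixed_der 1 w u x sF).
Qed.

Definition pd1 F x := cderiv (fun r => F (r, x.2)) x.1.
Definition pd2 F x := cderiv (fun r => F (x.1, r)) x.2.

Lemma cderiv_shift (f : R -> E) t : cderiv (fun r => f (t + r)) 0 = cderiv f t.
Proof.
have := cderivn_shift f t 1; move=> /(congr1 (fun g => g 0)).
by rewrite addr0.
Qed.

Lemma pd1E F : pd1 F = ddir 1 (1, 0) F.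
Proof.
apply/funext => x; rewrite /pd1 -cderiv_shift; congr (cderiv _ 0).
apply/funext => r; congr F; apply/pair_equal_spec.
by rewrite /= [_ *: 0]mulr0 [_ *: 1]mulr1 addr0.
Qed.

Lemma pd2E F : pd2 F = ddir 1 (0, 1) F.
Proof.
apply/funext => x; rewrite /pd2 -cderiv_shift; congr (cderiv _ 0).
apply/funext => r; congr F; apply/pair_equal_spec.
by rewrite /= [_ *: 0]mulr0 [_ *: 1]mulr1 addr0.
Qed.

Lemma csm2_pd1 F : csm2 F -> csm2 (pd1 F).
Proof. by rewrite pd1E; exact: csm2_ddir. Qed.

Lemma csm2_pd2 F : csm2 F -> csm2 (pd2 F).
Proof. by rewrite pd2E; exact: csm2_ddir. Qed.

Lemma pd12C F : csm2 F -> pd1 (pd2 F) = pd2 (pd1 F).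
Proof.
by move=> sF; apply/funext => x; rewrite !pd1E !pd2E ddirC.
Qed.

Lemma csm2_fst F t : csm2 F -> csmooth (fun s => F (s, t)).
Proof. by move=> sF; apply: sF; [exact: csmooth_id | exact: csmooth_cst]. Qed.

Lemma csm2_snd F s : csm2 F -> csmooth (fun t => F (s, t)).
Proof. by move=> sF; apply: sF; [exact: csmooth_cst | exact: csmooth_id]. Qed.

Lemma pd1_der F s t : csm2 F -> der (fun r => F (r, t)) s (pd1 F (s, t)).
Proof. by move=> /(csm2_fst t); exact: csmooth_der. Qed.

Lemma pd2_der F s t : csm2 F -> der (fun r => F (s, r)) t (pd2 F (s, t)).
Proof. by move=> /(csm2_snd s); exact: csmooth_der. Qed.

(** The increment is split at (a(t), b(r)). The second part has one variable; the first, with moving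
    second argument, is controlled by the continuity of [pd1 F] at the point. *)
Lemma csm2_chain F (a b : R -> R^o) (a' b' : R) t : csm2 F ->
  der a t a' -> der b t b' ->
  der (fun r => F (a r, b r)) t (a' *: pd1 F (a t, b t) + b' *: pd2 F (a t, b t)).
Proof.
move=> sF da db.
have d2 := der_comp db (pd2_der (a t) (b t) sF).
have d1 : der (fun r => F (a r, b r) - F (a t, b r)) t (a' *: pd1 F (a t, b t)).
  move=> p e e0; set Q := pd1 F (a t, b t).
  have pq := csn_ge0 p Q; have na := normr_ge0 a'.
  pose e1 := e / 2 / (`|a'| + 1); have e10 : 0 < e1 by do 2 (apply: divr_gt0; try lra).
  have e1E : e1 * (`|a'| + 1) = e / 2 by rewrite /e1 divfK // lt0r_neq0 //; lra.
  pose e2 := e / 2 / (p Q + 1); have e20 : 0 < e2 by do 2 (apply: divr_gt0; try lra).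
  have e2E : e2 * (p Q + 1) = e / 2 by rewrite /e2 divfK // lt0r_neq0 //; lra.
  have [d d0 H] := csm2_cont0 (a t, b t) p (csm2_pd1 sF) e10.
  have dd : 0 < d / 2 by lra.
  have [k1 k10 K1] := der_cont (csn_norm R) dd da.
  have [k2 k20 K2] := der_cont (csn_norm R) dd db.
  have [k3 k30 K3] := der_bound (csn_norm R) da.
  have [k4 k40 K4] := da (csn_norm R) _ e20.
  exists (Num.min (Num.min k1 k2) (Num.min k3 k4)); first by rewrite !lt_min k10 k20 k30.
  move=> h; rewrite !lt_min => /andP[/andP[/K1 h1 /K2 h2] /andP[/K3 h3 /K4 h4]].
  rewrite /= in h1 h2 h3 h4; rewrite subrr subr0.
  pose A : R := a (t + h) - a t.
  have -> : F (a (t + h), b (t + h)) - F (a t, b (t + h)) - h *: (a' *: Q) =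
      (F (a (t + h), b (t + h)) - F (a t, b (t + h)) - A *: Q) + (A - h * a') *: Q.
    by lmod_with R E; ring.
  apply: le_trans (csnD _ _ _) _; rewrite csnZ.
  have nh := normr_ge0 h.
  have -> : e * `|h| = e1 * (`|a'| + 1) * `|h| + e2 * (p Q + 1) * `|h|.
    by rewrite e1E e2E; field.
  apply: lerD; last first.
    apply: (@le_trans _ _ (e2 * `|h| * p Q)); first exact: ler_wpM2r.
    by have := mulr_ge0 (ltW e20) nh; nra.
  pose f r := F (r, b (t + h)) - r *: Q.
  have -> : F (a (t + h), b (t + h)) - F (a t, b (t + h)) - A *: Q =
      f (a t + A) - f (a t).
    rewrite /f (_ : a t + A = a (t + h)); last by rewrite /A subrKC.
    have alg (X Y Z : E) (r s : R) : X - Y - (r - s) *: Z = X - r *: Z - (Y - s *: Z).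
      by lmod_with R E; ring.
    exact: alg.
  apply: (@le_trans _ _ (e1 * `|A|)).
    apply: mvt_abs => s sA; exists (pd1 F (a t + s, b (t + h)) - Q).
      by apply: derB; [exact: pd1_der | exact: der_line].
    apply: H; split; rewrite /=; last lra.
    rewrite addrAC subrr add0r; apply: le_lt_trans sA _; rewrite /A; lra.
  by rewrite -mulrA ler_pM2l.
have := derD d1 d2; apply: der_near; apply/nearP; exists 1 => // h _.
by rewrite subrK.
Qed.

(** Cutoffs in both coordinates replace a map known to be smooth only on [W] by one defined and
    smooth on the plane, with the same germ at [x]. *)
Lemma csm2_local (W : set V) F x :
  (forall a b : R -> R^o, csmooth a -> csmooth b -> open [set t | W (a t, b t)]) ->
  (forall a b : R -> R^o, csmooth a -> csmooth b ->
     (forall t, W (a t, b t)) -> csmooth (fun t => F (a t, b t))) ->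
  W x -> exists F' : V -> E, csm2 F' /\
    exists2 d, 0 < d & forall y, box d x y -> F' y = F y.
Proof.
move=> Wo FW Wx; have [d d0 H] := cinf_open_plane Wo Wx.
have [th1 [s1 e1 r1]] := cutoff_ex x.1 d0.
have [th2 [s2 e2 r2]] := cutoff_ex x.2 d0.
exists (fun y => F (th1 y.1, th2 y.2)); split.
  move=> a b sa sb; apply: (FW (fun t => th1 (a t)) (fun t => th2 (b t))).
  - exact: csmooth_comp.
  - exact: csmooth_comp.
  - by move=> t; apply: H; split; [exact: r1 | exact: r2].
exists (d / 2) => [|y [h1 h2]]; first by rewrite divr_gt0.
by rewrite e1 ?e2 ?ltW // -surjective_pairing.
Qed.

End plane_calculus.

(** * Hadamard's lemma and the chain rule for mappings tested on curves *)

Section hadamard.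
Context {R : realType} {E : htvs R}.
Variable d : R -> E.
Hypotheses (sd : csmooth d) (d0 : d 0 = 0).

(* t^(k+1) times the k-th derivative of d(t)/t *)
Fixpoint hada_num k t : E :=
  if k is k'.+1 then t ^+ k *: cderivn k d t - k%:R *: hada_num k' t else d t.

Let pow_der k t : der (fun s : R => s ^+ k : R^o) t (k%:R * t ^+ k.-1).
Proof. by have := der_pow k (der_id t); rewrite mulr1. Qed.

Lemma hada_num_der k t : der (hada_num k) t (t ^+ k *: cderivn k.+1 d t).
Proof.
elim: k => [|k IH] /=; first by rewrite expr0 scale1r; exact: csmooth_der.
have := derB (der_scale (pow_der k.+1 t) (csmooth_dern k.+1 t sd)) (derZ k.+1%:R IH).
by rewrite /= scalerA addrK.
Qed.

Lemma hada_num0 k : hada_num k 0 = 0.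
Proof. by elim: k => //= k ->; rewrite expr0n /= scale0r scaler0 subr0. Qed.

(** The k-th derivative of d(t) / t; the value at 0 is the one given by the Taylor expansion of
    [d]. *)
Definition hada k t : E :=
  if t == 0 then k.+1%:R^-1 *: cderivn k.+1 d 0 else t^-1 ^+ k.+1 *: hada_num k t.

Lemma hada_der k t : der (hada k) t (hada k.+1 t).
Proof.
have [->|t0] := eqVneq t 0; last first.
  apply: (@der_near _ _ (fun s => (s^-1 ^+ k.+1 : R^o) *: hada_num k s)).
    apply/nearP; exists `|t|; first by rewrite normr_gt0.
    move=> h ht; rewrite /hada ifF //; apply/negbTE.
    by apply: contraTneq ht => /eqP; rewrite addrC addr_eq0 => /eqP ->; rewrite normrN ltxx.
  have dV : der (fun s : R => s^-1 : R^o) t (- t^-1 ^+ 2).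
    by have := der_invf t0 (der_id t); rewrite mulN1r exprVn.
  have := der_scale (der_pow k.+1 dV) (hada_num_der k t).
  rewrite /hada (negbTE t0).
  set A := (X in der _ _ X -> _); set B := (X in _ -> der _ _ X).
  suff -> : A = B by [].
  rewrite /A /B /= scalerBr !scalerA; congr (_ *: _ + _).
    by rewrite !exprVn !exprS; field; rewrite t0 expf_neq0.
  rewrite -scaleNr; congr (_ *: _).
  by rewrite !exprVn !exprS; field; rewrite t0 expf_neq0.
set L := hada k.+1 0; have LE : k.+2%:R *: L = cderivn k.+2 d 0.
  by rewrite /L /hada eqxx scalerA divff ?scale1r // pnatr_eq0.
have L0E : k.+1%:R *: hada k 0 = cderivn k.+1 d 0.
  by rewrite /hada eqxx scalerA divff ?scale1r // pnatr_eq0.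
move=> p e e0; have [r r0 H] := csmooth_dern k.+1 0 sd p e0.
exists r => // h hr; rewrite add0r.
have [->|h0] := eqVneq h 0; first by rewrite subrr scale0r subrr csn0 normr0 mulr0.
(* This is s^(k+1) times the remainder to be estimated. Its derivative is s^k times the first order
   remainder of the derivative of order k + 1 of [d], so the mean value inequality yields the factor
   |h|^(k+1) that is divided out. *)
pose f s := hada_num k s - (s ^+ k.+1 : R^o) *: hada k 0 - (s ^+ k.+2 : R^o) *: L.
have fE : f (0 + h) - f 0 = h ^+ k.+1 *: (hada k h - hada k 0 - h *: L).
  rewrite /f hada_num0 !expr0n /= !scale0r !subr0 add0r.
  rewrite [in RHS]/hada (negbTE h0) 2!scalerBr !scalerA -exprSr.
  by rewrite -exprMn divff // expr1n scale1r.
have df s : der f s (s ^+ k *: (cderivn k.+1 d s - cderivn k.+1 d 0 - s *: cderivn k.+2 d 0)).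
  have := derB (derB (hada_num_der k s) (der_scale (pow_der k.+1 s) (der_cst (hada k 0) s)))
     (der_scale (pow_der k.+2 s) (der_cst L s)).
  set A := (X in der _ _ X -> _); set B := (X in _ -> der _ _ X).
  suff -> : A = B by [].
  rewrite /A /B -LE -L0E /= !scaler0 !add0r exprS.
  by lmod_with R E; ring.
have hk : 0 < `|h| ^+ k.+1 by rewrite exprn_gt0 // normr_gt0.
rewrite -(ler_pM2l hk) -normrX -csnZ -fE normrX mulrA.
apply: mvt_abs => s sh; rewrite add0r; eexists; first exact: df.
rewrite csnZ normrX exprSr -mulrA; have := H s (le_lt_trans sh hr).
rewrite add0r => {}H; apply: ler_pM => //; first exact: csn_ge0.
  by rewrite lerXn2r // ?nnegrE.
by apply: le_trans H _; rewrite mulrC ler_pM2r.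
Qed.

Lemma hadamard : exists e : R -> E,
  [/\ csmooth e, forall t, d t = t *: e t & e 0 = cderiv d 0].
Proof.
exists (hada 0); split.
- by apply/csmoothP; exists hada; split=> //; exact: hada_der.
- move=> t; rewrite /hada; have [->|t0] := eqVneq t 0; first by rewrite d0 scale0r.
  by rewrite scalerA expr1 divff // scale1r.
- by rewrite /hada eqxx invr1 scale1r.
Qed.

End hadamard.

Lemma box0 (R : realType) (d r s : R) : `|r| < d -> `|s| < d -> box d (0, 0) (r, s).
Proof. by move=> rd sd; split; rewrite subr0. Qed.

Section chain_rule.
Context {R : realType} {E E' : htvs R}.

Definition smooth_in (O : set E) (h : E -> E') :=
  forall c : R -> E, csmooth c -> (forall t, O (c t)) -> csmooth (h \o c).

(** Write c(t) = c(0) + t e(t) with [e] smooth, by Hadamard's lemma, and put F(r, s) = h(c(0) + r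
    e(s)). The derivative of h o c is the diagonal derivative of the plane map [F]. Its second
    partial vanishes at the origin as F(0, s) is constant, and the first is the derivative along the
    line with direction e(0) = c'(0). *)
Lemma chain_rule (O : set E) (h : E -> E') (c : R -> E) :
  cinf_open O -> smooth_in O h -> csmooth c -> O (c 0) ->
  der (h \o c) 0 (cderiv (fun t => h (c 0 + t *: cderiv c 0)) 0).
Proof.
move=> oO sh sc Oc.
have sc0 : csmooth (fun t => c t - c 0) by exact: csmoothB sc (csmooth_cst _).
have [|e [se eE e0]] := hadamard sc0; first by rewrite subrr.
have {}e0 : e 0 = cderiv c 0.
  rewrite e0; apply: der_cderiv; have := derB (csmooth_der 0 sc) (der_cst (c 0) 0).
  by rewrite subr0.
have {}eE t : c t = c 0 + t *: e t by rewrite -eE subrKC.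
have sg (a b : R -> R^o) : csmooth a -> csmooth b -> csmooth (fun t => c 0 + a t *: e (b t)).
  move=> sa sb; apply: csmoothD (csmooth_cst _) _; apply: csmoothZ => //.
  exact: csmooth_comp.
have [|||F [sF [d d0 FE]]] := @csm2_local R E' [set x | O (c 0 + x.1 *: e x.2)]
    (fun x => h (c 0 + x.1 *: e x.2)) (0, 0).
- by move=> a b sa sb; apply: oO; exact: sg.
- by move=> a b sa sb Oab; apply: (sh _ (sg _ _ sa sb)).
- by rewrite /= scale0r addr0.
have := csm2_chain sF (der_id 0) (der_id 0); rewrite !scale1r.
have -> : pd2 F (0, 0) = 0.
  apply: der_cderiv => /=; apply: der_near (der_cst (h (c 0)) 0).
  apply/nearP; exists d => // r rd; rewrite FE /= ?scale0r ?addr0 //.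
  by rewrite add0r; apply: box0; rewrite ?normr0.
rewrite addr0; have -> : pd1 F (0, 0) = cderiv (fun t => h (c 0 + t *: cderiv c 0)) 0.
  have /der_cderiv <- // := pd1_der 0 0 sF.
  apply/esym/der_cderiv; have := pd1_der 0 0 sF.
  have -> : pd1 F (0, 0) = cderiv (fun r => F (r, 0)) 0 by [].
  apply: der_near; apply/nearP; exists d => // r rd; rewrite FE /= ?e0 //.
  by rewrite add0r; apply: box0; rewrite ?normr0.
apply: der_near; apply/nearP; exists d => // r rd; rewrite FE /=; last first.
  by rewrite add0r; exact: box0.
by rewrite -eE.
Qed.

End chain_rule.

Lemma cinf_line_eq (R : realType) (E : tvsType R) (f g : cinf_line E) : cl_fun f = cl_fun g -> f = g.
Proof.
by case: f g => [f sf] [g sg] /= fg; case: g / fg sg => sg; congr CinfLine; exact: Prop_irrelevance.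
Qed.

(** * Curves in spaces of smooth curves and bounded functionals *)

Section smooth_families.
Context {R : realType} {E : htvs R}.
Notation V := (R * R)%type.
Implicit Types (F : V -> E) (p : csn E).

Lemma cderivn_lincomb n (a b : R) (f g : R -> E) : csmooth f -> csmooth g ->
  cderivn n (fun t => a *: f t + b *: g t) =
  fun t => a *: cderivn n f t + b *: cderivn n g t.
Proof.
move=> sf sg; elim: n => // n IH; rewrite {1}/cderivn iterS -/(cderivn n _) IH.
apply/funext => t; apply: der_cderiv; apply: derD; apply: derZ; exact: csmooth_dern.
Qed.

Lemma cderivn_snd n F s : cderivn n (fun t => F (s, t)) = fun t => iter n pd2 F (s, t).
Proof.
elim: n => // n IH; rewrite /cderivn iterS -/(cderivn n _) IH.
by [].
Qed.

Lemma csm2_iter1 n F : csm2 F -> csm2 (iter n pd1 F).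
Proof. by move=> sF; elim: n => //= n; exact: csm2_pd1. Qed.

Lemma csm2_iter2 n F : csm2 F -> csm2 (iter n pd2 F).
Proof. by move=> sF; elim: n => //= n; exact: csm2_pd2. Qed.

Lemma iter_pd12 n F : csm2 F -> iter n pd2 (pd1 F) = pd1 (iter n pd2 F).
Proof.
move=> sF; elim: n => //= n ->; rewrite pd12C //; exact: csm2_iter2.
Qed.

(** Continuity at each point of the segment is made uniform in [t] by [cousin]; convergence in
    C^oo(R, E) requires this on compact sets. *)
Lemma csm2_unif F p (s B e : R) : csm2 F -> 0 < e ->
  exists2 d, 0 < d & forall t r : R, `|t| <= B -> `|r| < d ->
    p (F (s + r, t) - F (s, t)) <= e.
Proof.
move=> sF e0; have [B0|B0] := leP 0 B; last first.
  by exists 1 => // t r tB; have := le_trans (normr_ge0 t) tB; rewrite leNgt B0.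
pose P x y := exists2 d, 0 < d & forall t r : R, x <= t -> t <= y -> `|r| < d ->
    p (F (s + r, t) - F (s, t)) <= e.
suff [d d0 H] : P (- B) B.
  by exists d => // t r; rewrite ler_norml => /andP[t1 t2]; exact: H.
apply: cousin; first by lra.
  move=> x y z _ xy yz _ [d1 d10 H1] [d2 d20 H2].
  exists (Num.min d1 d2); first by rewrite lt_min d10.
  move=> t r xt tz; rewrite lt_min => /andP[r1 r2].
  by case: (leP t y) => ty; [exact: H1 | apply: H2 => //; exact: ltW].
move=> t _ _; have e2 : 0 < e / 2 by rewrite divr_gt0.
have [d d0 H] := csm2_cont0 (s, t) p sF e2.
exists d => // x y _ xt ty _ dx dy; exists d => // u r xu uy rd.
apply: le_trans (csn_tri p _ (F (s, t)) _) _; rewrite (csnC p (F (s, t))).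
rewrite [e](splitr e); have ut : `|u - t| < d.
  by rewrite ltr_norml; apply/andP; split; lra.
apply: lerD; apply: H; split => //=; last by rewrite subrr normr0.
by rewrite addrAC subrr add0r.
Qed.

Lemma csm2_bounded F p (s r B : R) : csm2 F -> 0 <= r -> 0 <= B ->
  exists M, forall u t : R, `|u - s| <= r -> `|t| <= B -> p (F (u, t)) <= M.
Proof.
move=> sF r0 B0.
pose P x y := exists M, forall u t : R, x <= u -> u <= y -> `|t| <= B -> p (F (u, t)) <= M.
suff [M H] : P (s - r) (s + r).
  by exists M => u t; rewrite ler_norml => /andP[u1 u2]; apply: H; lra.
apply: cousin; first by lra.
  move=> x y z _ xy yz _ [M1 H1] [M2 H2]; exists (Num.max M1 M2) => u t xu uz tB.
  by rewrite le_max; case: (leP u y) => uy; [rewrite H1 | rewrite H2 ?orbT // ltW].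
move=> v _ _; have [d d0 H] := csm2_unif p v B sF ltr01.
have BB : - B <= B by lra.
have [M HM] := csmooth_bounded p (csm2_snd v sF) BB.
exists d => // x y _ xv vy _ dx dy; exists (1 + M) => u t xu uy tB.
have := csnD p (F (u, t) - F (v, t)) (F (v, t)); rewrite subrK => h.
apply: le_trans h _; apply: lerD.
  have := H t (u - v) tB; rewrite subrKC; apply.
  by rewrite ltr_norml; apply/andP; split; lra.
by move: tB; rewrite ler_norml => /andP[t1 t2]; exact: HM.
Qed.

Lemma compact_bound (K : set R) : compact K -> exists2 B, 0 <= B & forall t, K t -> `|t| <= B.
Proof.
move=> /compact_bounded [M [_ HM]]; exists (`|M| + 1) => [|t Kt]; first by rewrite addr_ge0.
by apply: (HM (`|M| + 1)) => //; apply: le_lt_trans (ler_norm M) _; rewrite ltrDl.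
Qed.

Definition cinf_row F (sF : csm2 F) s : cinf_line E := CinfLine (csm2_snd s sF).

(** The half of the exponential law through which the smoothness of [evol] becomes usable: the rows
    of a smooth plane map are a smooth curve in C^oo(R, E), with derivatives the rows of its
    iterated first partials. *)
Lemma csm2_cinf F (sF : csm2 F) : cinf_line_smooth (cinf_row sF).
Proof.
exists (fun n => cinf_row (csm2_iter1 n sF)); split=> [|n s k K U cK U0].
  by apply/funext => s; exact: cinf_line_eq.
rewrite /cinf_row /=; set G := iter n pd1 F.
have sG : csm2 G by exact: csm2_iter1.
have [B B0 KB] := compact_bound cK; have [p pU] := csn_ex U0.
have e0 : 0 < 2^-1 :> R by rewrite invr_gt0.
have sGk := csm2_iter2 k sG; set Gk := iter k pd2 G in sGk.
have [d d0 H] := csm2_unif p s B (csm2_pd1 sGk) e0.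
apply/near0P; exists d => // h hd h0 t Kt; apply: pU.
have -> : cderivn k (fun t => h^-1 *: (G (s + h, t) - G (s, t))) t =
    h^-1 *: (Gk (s + h, t) - Gk (s, t)).
  rewrite (_ : (fun t => _) = fun t => h^-1 *: G (s + h, t) + (- h^-1) *: G (s, t)).
    rewrite cderivn_lincomb; [|exact: csm2_snd|exact: csm2_snd].
    rewrite (cderivn_snd k G (s + h)) (cderivn_snd k G s) -/Gk.
    by rewrite scalerBr scaleNr.
  by apply/funext => u; rewrite scalerBr scaleNr.
rewrite (cderivn_snd k (pd1 G)) iter_pd12 // -/Gk.
have hn : 0 < `|h| by rewrite normr_gt0.
rewrite (_ : _ - _ = h^-1 *: (Gk (s + h, t) - h *: pd1 Gk (s, t) - (Gk (s, t) - 0 *: pd1 Gk (s, t)))); last first.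
  have alg (A C D : E) : h^-1 *: (A - C) - D = h^-1 *: (A - h *: D - (C - 0 *: D)).
    by lmod_with R E; field.
  exact: alg.
rewrite csnZ normfV mulrC ltr_pdivrMr //.
apply: (@le_lt_trans _ _ (2^-1 * `|h|)); last by rewrite ltr_pM2r // invf_lt1 // ltr1n.
have := @mvt_abs R E (fun r => Gk (s + r, t) - r *: pd1 Gk (s, t)) 0 h 2^-1 p.
rewrite add0r addr0; apply => r rh; exists (pd1 Gk (s + r, t) - pd1 Gk (s, t)).
  rewrite add0r; apply: (derB _ (der_line _ _)).

  have := pd1_der (s + r) t sGk; rewrite addrC.
  by move=> /der_shift; under eq_fun do rewrite addrC.
by apply: H; [exact: KB | exact: le_lt_trans hd].
Qed.

Lemma taylor2 F p (s t h M : R) : csm2 F ->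
  (forall r, `|r| <= `|h| -> p (pd1 (pd1 F) (s + r, t)) <= M) ->
  p (F (s + h, t) - F (s, t) - h *: pd1 F (s, t)) <= M * `|h| * `|h|.
Proof.
move=> sF H.
have dF G u r : csm2 G -> der (fun r => G (u + r, t)) r (pd1 G (u + r, t)).
  move=> sG; have := pd1_der (u + r) t sG; rewrite addrC.
  by move=> /der_shift; under eq_fun do rewrite addrC.
have := @mvt_abs R E (fun r => F (s + r, t) - r *: pd1 F (s, t)) 0 h (M * `|h|) p.
rewrite add0r addr0 (_ : _ - _ - _ = F (s + h, t) - F (s, t) - h *: pd1 F (s, t)); last first.
  have alg (A B C : E) : A - h *: C - (B - 0 *: C) = A - B - h *: C.
    by lmod_with R E; ring.
  exact: alg.
apply=> r rh; exists (pd1 F (s + r, t) - pd1 F (s, t)).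
  by rewrite add0r; apply: derB; [exact: dF | exact: der_line].
have M0 : 0 <= M by apply: le_trans (H 0 _); rewrite ?csn_ge0 ?normr0.
apply: (@le_trans _ _ (M * `|r|)); last exact: ler_wpM2l.
have := @mvt_abs R E (fun r => pd1 F (s + r, t)) 0 r M p; rewrite add0r addr0.
apply=> q qr; exists (pd1 (pd1 F) (s + q, t)); last by apply: H; exact: le_trans rh.
by rewrite add0r; apply: dF; exact: csm2_pd1.
Qed.

End smooth_families.

Section functionals.
Context {R : realType}.
Notation V := (R * R)%type.

Lemma der_real (f : R -> R^o) t (v : R) :
  (forall e : R, 0 < e -> exists2 d : R, 0 < d & forall h : R, `|h| < d ->
     `|f (t + h) - f t - h * v| <= e * `|h|) -> der f t v.
Proof.
move=> H p e e0; have p1 := csn_ge0 p (1 : R^o).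
have q0 : 0 < p (1 : R^o) + 1 by rewrite ltr_wpDl.
have [d d0 Hd] := H _ (divr_gt0 e0 q0); exists d => // h /Hd.
set x := f (t + h) - f t - h * v => hx.
have -> : p (f (t + h) - f t - h *: (v : R^o)) = `|x| * p (1 : R^o).
  by rewrite -csnZ [in RHS]scaleRE mulr1.
apply: (@le_trans _ _ (e / (p (1 : R^o) + 1) * `|h| * (p (1 : R^o) + 1))).
  apply: ler_pM => //; by rewrite lerDl.
by rewrite mulrAC divfK // lt0r_neq0.
Qed.

(** Convergence of difference quotients does not pass through [l] directly, as only boundedness is
    given. The Taylor remainders divided by h^2 form a bounded set, so [l] maps the remainder itself
    to O(h^2), and linearity identifies the derivative. *)
Lemma functional_smooth (l : cinf_line R^o -> R) (F : V -> R^o) (sF : csm2 F) :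
  bounded_functional l -> csmooth (fun s => l (cinf_row sF s) : R^o).
Proof.
move=> [llin lbdd].
apply: (csmooth_family (G := [set g | exists F (sF : csm2 F), g = fun s => l (cinf_row sF s) : R^o]));
  last by exists F, sF.
move=> _ [G [sG ->]]; exists (fun s => l (cinf_row (csm2_pd1 sG) s)).
  by apply: span_gen; exists (pd1 G), (csm2_pd1 sG).
move=> s; pose rem h t : R^o :=
  (h ^- 2) *: (G (s + h, t) - G (s, t) - h *: pd1 G (s, t)).
have srem h : csmooth (rem h).
  apply: csmoothZc; apply: csmoothB; last by apply: csmoothZc; exact/csm2_snd/csm2_pd1.
  by apply: csmoothB; exact: csm2_snd.
(* The restriction |h| <= 1 keeps the points s + h in a compact interval, on which the second
   partials are bounded. *)
pose B := [set f | exists2 h, 0 < `|h| <= 1 & f = CinfLine (srem h)].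
have bB : cinf_line_bounded B.
  move=> k K cK U U0; have [b b0 Kb] := compact_bound cK.
  have [p pU] := csn_ex U0; have sGk := csm2_iter2 k sG.
  have [M HM] := csm2_bounded p s (csm2_pd1 (csm2_pd1 sGk)) ler01 b0.
  pose M' := `|M| + 1; have M'0 : 0 < M' by rewrite ltr_wpDl.
  exists M' => // _ [f [h /andP[h0 h1] ->] [t Kt <-]].
  exists (M'^-1 *: cderivn k (rem h) t); last by rewrite scalerA divff ?scale1r // lt0r_neq0.
  apply: pU; rewrite csnZ gtr0_norm ?invr_gt0 // mulrC ltr_pdivrMr // mul1r.
  apply: (@le_lt_trans _ _ M); last by apply: le_lt_trans (ler_norm M) _; rewrite ltrDl.
  have -> : cderivn k (rem h) t = h ^- 2 *:
      (iter k pd2 G (s + h, t) - iter k pd2 G (s, t) - h *: pd1 (iter k pd2 G) (s, t)).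
    rewrite (_ : rem h = fun t => h ^- 2 *: (1 *: G (s + h, t) + (-1) *: G (s, t)) +
        (- (h ^- 2 * h)) *: pd1 G (s, t)); last first.
      by apply/funext => u; rewrite /rem !scaleRE; ring.
    rewrite cderivn_lincomb; last exact/csm2_snd/csm2_pd1; last first.
      by apply: csmoothD; apply: csmoothZc; exact: csm2_snd.
    rewrite cderivn_lincomb; [|exact: csm2_snd|exact: csm2_snd].
    rewrite (cderivn_snd k G (s + h)) (cderivn_snd k G s) (cderivn_snd k (pd1 G) s).
    by rewrite iter_pd12 // !scaleRE; ring.
  rewrite csnZ normfV normrX mulrC ler_pdivrMr ?exprn_gt0 // expr2 mulrA.
  apply: taylor2 => // r rh; apply: HM; last exact: Kb.
  by rewrite addrAC subrr add0r; exact: le_trans h1.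
have U0 : nbhs (0 : R^o) [set x : R^o | `|x| < 1] by exact: csn_norm_subproof.
have [r r0 Hr] := lbdd _ bB _ U0.
apply: der_real => e e0; exists (Num.min 1 (e / r)); first by rewrite lt_min ltr01 divr_gt0.
move=> h; rewrite lt_min => /andP[h1 hr].
have [->|h0] := eqVneq h 0; first by rewrite addr0 subrr mul0r subr0 normr0 mulr0.
have hn : 0 < `|h| by rewrite normr_gt0.
pose f1 := CinfLine (csmoothD (csmoothZc h (csm2_snd s (csm2_pd1 sG))) (csm2_snd s sG)).
have l1 : l f1 = h * l (cinf_row (csm2_pd1 sG) s) + l (cinf_row sG s) by exact: llin.
have l2 : l (cinf_row sG (s + h)) = h ^+ 2 * l (CinfLine (srem h)) + l f1.
  apply: llin => t; rewrite /= /rem !scaleRE; field; exact: h0.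
rewrite l2 l1 (_ : _ - _ - _ = h ^+ 2 * l (CinfLine (srem h))); last by ring.
have [|x /= x1 <-] := Hr (l (CinfLine (srem h))).
  by exists (CinfLine (srem h)) => //; exists h => //; rewrite hn ltW.
rewrite (normrM (h ^+ 2)) normrX (_ : r *: x = r * x) // normrM (gtr0_norm r0).
apply: (@le_trans _ _ (`|h| ^+ 2 * r)).
  by rewrite ler_wpM2l ?exprn_ge0 // -[leRHS]mulr1 ler_pM2l // ltW.
rewrite expr2 mulrAC ler_pM2r // -ler_pdivlMr //; exact: ltW.
Qed.

End functionals.

(** * Curves and tangent vectors in manifolds *)

Local Open Scope quotient_scope.

Section open_sets.
Context {R : realType}.

Lemma openP (O : set R) : open O <-> forall t, O t ->
  exists2 d : R, 0 < d & forall s, `|s - t| < d -> O s.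
Proof.
rewrite openE; split=> [oO t /oO|oO t /oO [d d0 H]].
  by move=> /nearP [d d0 H]; exists d => // s st; have := H _ st; rewrite subrKC.
by apply/nearP; exists d => // h hd; apply: H; rewrite addrAC subrr add0r.
Qed.

Lemma csmooth_open (O : set R) (a : R -> R^o) : csmooth a -> open O -> open (a @^-1` O).
Proof.
move=> sa /openP oO; apply/openP => t /oO [d d0 H].
have d2 : 0 < d / 2 by lra.
have [r r0 Hr] := der_cont (csn_norm R) d2 (csmooth_der t sa).
exists r => // s /Hr; rewrite subrKC /= => h; apply: H; lra.
Qed.

Lemma smooth_on_ext (E : htvs R) (O : set R) (f : R -> E) t :
  open O -> smooth_on O f -> O t -> exists th : R -> R^o,
  [/\ csmooth th, forall s, O (th s), \forall s \near t, th s = s &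
      csmooth (fun s => f (th s))].
Proof.
move=> /openP oO sf Ot; have [d d0 H] := oO t Ot.
have [th [sth e1 e2]] := cutoff_ex t d0.
have Oth s : O (th s) by exact/H/e2.
exists th; split=> //; last exact: csmooth_comp_on sf sth Oth.
apply/nearP; exists (d / 2) => [|h hd]; first by rewrite divr_gt0.
by apply: e1; rewrite addrAC subrr add0r ltW.
Qed.

(** A curve that meets [O] at time [t] is reparametrized near [t] so as to stay in [O]; so testing
    [P] on curves inside [O] suffices. *)
Lemma cinf_open_local (E : htvs R) (O : set E) (P : set E) :
  cinf_open O -> (forall c : R -> E, csmooth c -> (forall t, O (c t)) ->
    open [set t | P (c t)]) -> cinf_open [set x | O x /\ P x].
Proof.
move=> oO OP c sc; apply/openP => t [Ot Pt].
have sc' : smooth_on (c @^-1` O) c by move=> n s _; exact: sc.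
have [th [sth Oth tht scth]] := smooth_on_ext (oO c sc) sc' Ot.
have [d d0 Hd] := (openP _).1 (oO c sc) t Ot.
have Pth : P (c (th t)) by rewrite (nbhs_singleton tht).
have [r r0 Hr] := (openP _).1 (OP _ scth Oth) t Pth.
have /nearP [q q0 Hq] := tht.
exists (Num.min d (Num.min r q)); first by rewrite !lt_min d0 r0.
move=> s; rewrite !lt_min => /and3P[/Hd Os /Hr Ps sq]; split=> //.
by move: Ps; rewrite /= -{1}(subrKC t s) (Hq _ sq) subrKC.
Qed.

End open_sets.

Section curves_in_manifolds.
Context {R : realType} {M : manifold R}.
Implicit Types (c : R -> M) (i j : chart_idx M) (a : R -> R^o).

Definition chart_img i : set (model i) := chart i @` chart_dom i.

Lemma chartK i x : chart_dom i x -> chart_inv i (chart i x) = x.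
Proof. exact: achartK. Qed.

Lemma chart_img_chart i x : chart_dom i x -> chart_img (chart i x).
Proof. by move=> ix; exists x. Qed.

Lemma chart_img_dom i (y : model i) : chart_img y -> chart_dom i (chart_inv i y).
Proof. by move=> [x ix <-]; rewrite chartK. Qed.

Lemma chart_invK i (y : model i) : chart_img y -> chart i (chart_inv i y) = y.
Proof. by move=> [x ix <-]; rewrite chartK. Qed.

Lemma chart_ex x : exists i, chart_dom i x.
Proof. exact: acover. Qed.

Lemma chart_img_open i : cinf_open (@chart_img i).
Proof. by have := @aimage_open R M (matlas M) i i; rewrite setIid. Qed.

Lemma smooth_curve_local c :
  (forall t : R, exists2 c' : R -> M, smooth_curve c' & \forall s \near t, c s = c' s) ->
  smooth_curve c.
Proof.
move=> H i; split.
  apply/openP => t it; have [c' sc' /nearP [d d0 cc']] := H t.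
  have it' : chart_dom i (c' t).
    by have := cc' 0; rewrite addr0 normr0 => <-.
  have [r r0 Hr] := (openP _).1 (sc' i).1 t it'.
  exists (Num.min d r) => [|s]; first by rewrite lt_min d0.
  rewrite lt_min => /andP[sd /Hr is']; rewrite /= -(subrKC t s) cc' //.
  by rewrite subrKC.
apply: smooth_on_local => t it; have [c' sc' cc'] := H t.
have it' : chart_dom i (c' t) by rewrite -(nbhs_singleton cc').
have [th [_ _ tht sth]] := smooth_on_ext (sc' i).1 (sc' i).2 it'.
exists (fun s => chart i (c' (th s))) => //.
by apply: filterS2 cc' tht => s -> ->.
Qed.

Lemma smooth_curve_csmooth i c : smooth_curve c -> (forall t, chart_dom i (c t)) ->
  csmooth (fun t => chart i (c t)).
Proof. by move=> /(_ i) [_ sc] ic n t _; apply: sc; exact: ic. Qed.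

Lemma smooth_curve_comp c a : smooth_curve c -> csmooth a -> smooth_curve (c \o a).
Proof.
move=> sc sa i; split; first exact: (csmooth_open sa (sc i).1).
apply: smooth_on_local => t it.
have [th [sth ith tht scth]] := smooth_on_ext (sc i).1 (sc i).2 it.
exists (fun s => chart i (c (th (a s)))); first exact: csmooth_comp scth sa.
have /nearP [d d0 H] := tht; have d2 : 0 < d / 2 by lra.
have [r r0 Hr] := der_cont (csn_norm R) d2 (csmooth_der t sa).
apply/nearP; exists r => // h /Hr /= hr.
have /H : `|a (t + h) - a t| < d by lra.
by rewrite subrKC => ->.
Qed.

Lemma chart_inv_smooth i (c : R -> model i) : csmooth c -> (forall t, chart_img (c t)) ->
  smooth_curve (fun t => chart_inv i (c t)).
Proof.
move=> sc ic j; have := @aimage_open R M (matlas M) i j.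
set O := _ @` _ => oO.
have OE : [set t | chart_dom j (chart_inv i (c t))] = c @^-1` O.
  apply/seteqP; split=> t /=.
    move=> jt; exists (chart_inv i (c t)); last exact: chart_invK.
    by split=> //; exact: chart_img_dom.
  by move=> [x [ix jx] <-]; rewrite [chart_inv _ _]achartK.
have oc : open (c @^-1` O) by exact: oO.
split; first by rewrite [X in open X]OE.
apply: smooth_on_local => t; rewrite -[_ t]/([set t | chart_dom j (chart_inv i (c t))] t) OE => Ot.
have sc' : smooth_on (c @^-1` O) c by move=> n s _; exact: sc.
have [th [sth Oth tht scth]] := smooth_on_ext oc sc' Ot.
exists (fun s => chart j (chart_inv i (c (th s)))).
  by apply: (atrans_smooth scth) => _ [s _ <-]; exact: Oth.
by apply: filterS tht => s ->.
Qed.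

Lemma chart_rep c i t : smooth_curve c -> chart_dom i (c t) ->
  exists g : R -> model i, [/\ csmooth g, forall s, chart_img (g s),
    \forall s \near t, c s = chart_inv i (g s) &
    \forall s \near t, g s = chart i (c s)].
Proof.
move=> sc it; have [th [sth ith tht scth]] := smooth_on_ext (sc i).1 (sc i).2 it.
exists (fun s => chart i (c (th s))); split=> //.
- by move=> s; apply: chart_img_chart; exact: ith.
- by apply: filterS tht => s ths; rewrite chartK; [rewrite ths | exact: ith].
- by apply: filterS tht => s ->.
Qed.

(** This agrees with openness in the natural topology ([natural_openP]) and avoids all reference to
    charts. *)
Definition curve_open (W : set M) := forall c, smooth_curve c -> open (c @^-1` W).

Lemma curve_open_dom i : curve_open (chart_dom i).
Proof. by move=> c /(_ i) []. Qed.

Lemma chart_curve_open i (W : set M) : curve_open W ->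
  cinf_open [set y | chart_img y /\ W (chart_inv i y)].
Proof.
move=> oW; apply: cinf_open_local (@chart_img_open i) _ => c sc ic.
exact: (oW _ (chart_inv_smooth sc ic)).
Qed.

(** In the chart [i], [chain_rule] expresses both derivatives through the same point and the same
    direction. Hence a velocity computed in one chart determines it in every chart, and tangent maps
    are well defined. *)
Lemma mchain (E : htvs R) (W : set M) (h : M -> E) c c' i : curve_open W ->
  (forall c, smooth_curve c -> (forall t, W (c t)) -> csmooth (h \o c)) ->
  smooth_curve c -> smooth_curve c' -> W (c 0) -> c 0 = c' 0 -> chart_dom i (c 0) ->
  cderiv (fun t => chart i (c t)) 0 = cderiv (fun t => chart i (c' t)) 0 ->
  cderiv (h \o c) 0 = cderiv (h \o c') 0 /\ der (h \o c) 0 (cderiv (h \o c) 0).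
Proof.
move=> oW hW sc sc' Wc cc ic dcc.
have [g [sg ig cg gc]] := chart_rep sc ic.
have ic' : chart_dom i (c' 0) by rewrite -cc.
have [g' [sg' ig' cg' gc']] := chart_rep sc' ic'.
pose O := [set y : model i | chart_img y /\ W (chart_inv i y)].
have oO : cinf_open O by exact: chart_curve_open.
have sh : smooth_in O (h \o chart_inv i).
  move=> a sa Oa; apply: (hW (chart_inv i \o a)).
    by apply: chart_inv_smooth => // t; have [] := Oa t.
  by move=> t; have [] := Oa t.
have Og : O (g 0) by split; [exact: ig | rewrite -(nbhs_singleton cg)].
have gg : g 0 = g' 0 by rewrite (nbhs_singleton gc) (nbhs_singleton gc') cc.
have dn (b b' : R -> model i) : (\forall s \near (0 : R), b s = b' s) -> cderiv b 0 = cderiv b' 0.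
  by move=> bb; exact: (nbhs_singleton (cderivn_near 1 bb)).
have dgg : cderiv g 0 = cderiv g' 0 by rewrite (dn _ _ gc) (dn _ _ gc').
have e1 : \forall s \near (0 : R), (h \o chart_inv i \o g) s = (h \o c) s.
  by apply: filterS cg => s /= ->.
have e2 : \forall s \near (0 : R), (h \o chart_inv i \o g') s = (h \o c') s.
  by apply: filterS cg' => s /= ->.
have d1 := chain_rule oO sh sg Og.
have Og' : O (g' 0) by rewrite -gg.
have d2 := chain_rule oO sh sg' Og'.
have := der_near e1 d1; have := der_near e2 d2; rewrite -gg -dgg => {}d2 {}d1.
by rewrite (der_cderiv d1) (der_cderiv d2).
Qed.

End curves_in_manifolds.

Section tangent_vectors.
Context {R : realType} {M : manifold R}.
Implicit Types (c : scurve M) (i j : chart_idx M) (z : tangent M).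

Lemma scurve_eq c c' : (c : R -> M) = c' -> c = c'.
Proof.
by case: c c' => [f sf] [g sg] /= fg; case: g / fg sg => sg; congr Scurve; exact: Prop_irrelevance.
Qed.

Lemma pi_repr c : same_velocity (repr (\pi_(tangent M) c)) c.
Proof. by rewrite -[same_velocity _ _]eqmodE reprK. Qed.

Lemma tbase_pi c : tbase (\pi_(tangent M) c) = c 0.
Proof. by have /asboolP[] := pi_repr c. Qed.

Lemma tchart_pi i c : chart_dom i (c 0) ->
  tchart i (\pi_(tangent M) c) = cderiv (fun t => chart i (c t)) 0.
Proof.
move=> ic; have /asboolP[c0 H] := pi_repr c; rewrite /tchart H //.
by rewrite c0.
Qed.

Lemma tbase_velocity c t : tbase (velocity c t) = c t.
Proof. by rewrite tbase_pi /= addr0. Qed.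

Lemma tchart_velocity i c t : chart_dom i (c t) ->
  tchart i (velocity c t) = cderiv (fun s => chart i (c s)) t.
Proof.
move=> ic; rewrite tchart_pi /= ?addr0 //.
exact: (cderiv_shift (fun s => chart i (c s))).
Qed.

Lemma velocity0 c : velocity c 0 = \pi_(tangent M) c.
Proof.
by congr (\pi _); apply: scurve_eq; apply/funext => s /=; rewrite add0r.
Qed.

Lemma velocity_repr z : velocity (repr z) 0 = z.
Proof. by rewrite velocity0 reprK. Qed.

(** The definition asks for agreement in all charts; by [mchain], applied to the other chart maps,
    one chart suffices. *)
Lemma same_velocity1 c c' i : c 0 = c' 0 -> chart_dom i (c 0) ->
  cderiv (fun t => chart i (c t)) 0 = cderiv (fun t => chart i (c' t)) 0 ->
  same_velocity c c'.
Proof.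
move=> cc ic dcc; apply/asboolP; split=> // j jc.
have [||//] := @mchain R M _ (chart_dom j) (chart j) c c' i _ _ (sc_smooth c) (sc_smooth c') jc cc ic dcc.
  exact: curve_open_dom.
by move=> b sb jb; exact: smooth_curve_csmooth.
Qed.

Lemma tangent_eq z z' i : tbase z = tbase z' -> chart_dom i (tbase z) ->
  tchart i z = tchart i z' -> z = z'.
Proof.
move=> zz iz dzz; rewrite -[z]reprK -[z']reprK; apply/eqP; rewrite eqmodE.
exact: (same_velocity1 (i := i)).
Qed.

Lemma pi_eq c c' i : c 0 = c' 0 -> chart_dom i (c 0) ->
  cderiv (fun t => chart i (c t)) 0 = cderiv (fun t => chart i (c' t)) 0 ->
  \pi_(tangent M) c = \pi_(tangent M) c'.
Proof. by move=> cc ic dcc; apply/eqP; rewrite eqmodE; exact: same_velocity1 dcc. Qed.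

Lemma velocity_near c c' t : (\forall s \near t, c s = c' s) -> velocity c t = velocity c' t.
Proof.
move=> cc; have [i ic] := chart_ex (c t).
apply: (tangent_eq (i := i)); rewrite ?tbase_velocity ?(nbhs_singleton cc) //.
  by rewrite -(nbhs_singleton cc).
rewrite !tchart_velocity -?(nbhs_singleton cc) //.
have cc' : \forall s \near t, chart i (c s) = chart i (c' s) by apply: filterS cc => s ->.
exact: (nbhs_singleton (cderivn_near 1 cc')).
Qed.

Lemma line_curve i (y v : model i) : chart_img y -> exists c : scurve M,
  \forall s \near (0 : R), c s = chart_inv i (y + s *: v) /\ chart_img (y + s *: v).
Proof.
move=> iy; have sl : csmooth (fun t : R => y + t *: v).
  apply: csmoothD (csmooth_cst _) _; exact: (csmoothZ csmooth_id (csmooth_cst _)).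
have ol := chart_img_open sl.
have sl' : smooth_on ((fun t : R => y + t *: v) @^-1` chart_img (i := i)) (fun t => y + t *: v).
  by move=> n s _; exact: sl.
have i0 : ((fun t : R => y + t *: v) @^-1` chart_img (i := i)) 0.
  by rewrite /= scale0r addr0.
have [th [sth ith tht scth]] := smooth_on_ext ol sl' i0.
exists (Scurve (chart_inv_smooth scth ith)); apply: filterS tht => s ths.
by have := ith s; rewrite /= ths.
Qed.

Lemma tchart_inv_ex i (y v : model i) : chart_img y ->
  exists z, tbase z = chart_inv i y /\ tchart i z = v.
Proof.
move=> iy; have [c cE] := line_curve v iy.
have [c0 _] := nbhs_singleton cE; rewrite scale0r addr0 in c0.
exists (\pi_(tangent M) c); rewrite tbase_pi c0; split=> //.
rewrite tchart_pi ?c0; last exact: chart_img_dom.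
apply: der_cderiv; have := derD (der_cst y 0) (der_line v 0); rewrite add0r.
by apply: der_near; apply: filterS cE => s [-> ys]; rewrite chart_invK.
Qed.

Lemma tchart_invP i (y v : model i) : chart_img y ->
  tbase (tchart_inv i y v) = chart_inv i y /\ tchart i (tchart_inv i y v) = v.
Proof.
move=> iy; have [z zP] := tchart_inv_ex v iy.
by rewrite /tchart_inv; case: xgetP => [w _ //|/(_ z)].
Qed.

Lemma tchart_invK i z : chart_dom i (tbase z) ->
  tchart_inv i (chart i (tbase z)) (tchart i z) = z.
Proof.
move=> iz; have [b t] := tchart_invP (tchart i z) (chart_img_chart iz).
by apply: (tangent_eq (i := i)); rewrite ?b ?chartK.
Qed.

End tangent_vectors.

Section tangent_maps.
Context {R : realType}.
Implicit Types M N P : manifold R.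

Lemma tmap_pi M N (f : smap M N) (c : scurve M) :
  tmap f (\pi_(tangent M) c) = \pi_(tangent N) (push f c).
Proof.
rewrite /tmap; set c' := repr _; have /asboolP[c0 H] := pi_repr c; rewrite -/c' in c0 H.
have [i ic] := chart_ex (c' 0); have [j jc] := chart_ex (f (c' 0)).
apply: (pi_eq (i := j)); rewrite /= ?c0 //; first by rewrite -c0.
have [||//] := @mchain R M _ (f @^-1` chart_dom j) (fun x => chart j (f x)) c' c i _ _
  (sc_smooth c') (sc_smooth c) jc c0 ic (H i ic).
  by move=> b sb; exact: (curve_open_dom (sm_smooth f sb)).
by move=> b sb jb; exact: (smooth_curve_csmooth (sm_smooth f sb)).
Qed.

Lemma tmap_velocity M N (f : smap M N) (c : scurve M) t :
  tmap f (velocity c t) = velocity (push f c) t.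
Proof. by rewrite /velocity tmap_pi; congr (\pi _); exact: scurve_eq. Qed.

Lemma tbase_tmap M N (f : smap M N) z : tbase (tmap f z) = f (tbase z).
Proof. by rewrite tbase_pi. Qed.

Lemma tmap_comp M N P (g : smap N P) (f : smap M N) z :
  tmap (smap_comp g f) z = tmap g (tmap f z).
Proof.
rewrite -[z]velocity_repr !tmap_velocity; congr velocity; exact: scurve_eq.
Qed.

Lemma tmap_id M z : tmap (smap_id M) z = z.
Proof.
rewrite -[in LHS](velocity_repr z) tmap_velocity -[RHS]velocity_repr; congr velocity.
Qed.

Lemma smap_eq M N (f g : smap M N) : (f : M -> N) = g -> f = g.
Proof.
by case: f g => [f sf] [g sg] /= fg; case: g / fg sg => sg; congr Smap; exact: Prop_irrelevance.
Qed.

End tangent_maps.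

(** * Plane maps into manifolds and their partial velocities *)

Section plane_maps.
Context {R : realType} {M : manifold R}.
Notation V := (R * R)%type.
Implicit Types (s : V -> M) (i j : chart_idx M).

Definition sm2 s := forall a b : R -> R^o, csmooth a -> csmooth b ->
  smooth_curve (fun t => s (a t, b t)).

Lemma sm2_fst s t : sm2 s -> smooth_curve (fun r => s (r, t)).
Proof. by move=> ss; apply: ss; [exact: csmooth_id | exact: csmooth_cst]. Qed.

Lemma sm2_snd s r : sm2 s -> smooth_curve (fun t => s (r, t)).
Proof. by move=> ss; apply: ss; [exact: csmooth_cst | exact: csmooth_id]. Qed.

Definition tv1 s (ss : sm2 s) (x : V) : tangent M := velocity (Scurve (sm2_fst x.2 ss)) x.1.
Definition tv2 s (ss : sm2 s) (x : V) : tangent M := velocity (Scurve (sm2_snd x.1 ss)) x.2.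

Lemma sm2_chart s (x : V) i : sm2 s -> chart_dom i (s x) ->
  exists F : V -> model i, csm2 F /\
  exists2 d, 0 < d & forall y, box d x y -> chart_dom i (s y) /\ F y = chart i (s y).
Proof.
move=> ss ix; pose W := [set y | chart_dom i (s y)].
have oW (a b : R -> R^o) : csmooth a -> csmooth b -> open [set t | W (a t, b t)].
  by move=> sa sb; exact: (curve_open_dom (ss _ _ sa sb)).
have [|F [sF [d d0 H]]] := csm2_local (F := fun y => chart i (s y)) oW _ ix.
  by move=> a b sa sb ab; exact: (smooth_curve_csmooth (ss _ _ sa sb)).
have [r r0 Hr] := cinf_open_plane oW ix.
exists F; split=> //; exists (Num.min d r); first by rewrite lt_min d0.
by move=> y xy; split; [apply: Hr | apply: H]; apply: box_le xy; rewrite ge_min lexx ?orbT.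
Qed.

Lemma box_near (d : R) (x y : V) : box d x y -> exists2 r : R, 0 < r &
  forall h k : R, `|h| < r -> `|k| < r -> box d x (y.1 + h, y.2 + k).
Proof.
move=> [h1 h2]; exists (Num.min (d - `|y.1 - x.1|) (d - `|y.2 - x.2|)).
  by rewrite lt_min !subr_gt0 h1.
move=> h k; rewrite !lt_min => /andP[k1 _] /andP[_ k2]; split; rewrite /= addrAC.
  by apply: le_lt_trans (ler_normD _ _) _; lra.
by apply: le_lt_trans (ler_normD _ _) _; lra.
Qed.

Lemma tchart_tv1 s (ss : sm2 s) (x : V) i (F : V -> model i) (d : R) :
  (forall y, box d x y -> chart_dom i (s y) /\ F y = chart i (s y)) ->
  forall y, box d x y -> tchart i (tv1 ss y) = pd1 F y.
Proof.
move=> H y xy; rewrite /tv1 tchart_velocity; last by rewrite /= -surjective_pairing; have [] := H y xy.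
have [r r0 Hr] := box_near xy.
have e : \forall u \near y.1, chart i (s (u, y.2)) = F (u, y.2).
  apply/nearP; exists r => // h hr; have := Hr h 0 hr; rewrite normr0 addr0.
  by move=> /(_ r0) /H [_ ->].
exact: (nbhs_singleton (cderivn_near 1 e)).
Qed.

Lemma tchart_tv2 s (ss : sm2 s) (x : V) i (F : V -> model i) (d : R) :
  (forall y, box d x y -> chart_dom i (s y) /\ F y = chart i (s y)) ->
  forall y, box d x y -> tchart i (tv2 ss y) = pd2 F y.
Proof.
move=> H y xy; rewrite /tv2 tchart_velocity; last by rewrite /= -surjective_pairing; have [] := H y xy.
have [r r0 Hr] := box_near xy.
have e : \forall u \near y.2, chart i (s (y.1, u)) = F (y.1, u).
  apply/nearP; exists r => // h hr; have := Hr 0 h; rewrite normr0 addr0.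
  by move=> /(_ r0 hr) /H [_ ->].
exact: (nbhs_singleton (cderivn_near 1 e)).
Qed.

Lemma tbase_tv1 s (ss : sm2 s) x : tbase (tv1 ss x) = s x.
Proof. by rewrite tbase_velocity /= -surjective_pairing. Qed.

Lemma tbase_tv2 s (ss : sm2 s) x : tbase (tv2 ss x) = s x.
Proof. by rewrite tbase_velocity /= -surjective_pairing. Qed.

Lemma curve_in_box (a b : R -> R^o) (d t : R) : csmooth a -> csmooth b -> 0 < d ->
  \forall r \near t, box d (a t, b t) (a r, b r).
Proof.
move=> sa sb d0; have d2 : 0 < d / 2 by lra.
have [r1 r10 H1] := der_cont (csn_norm R) d2 (csmooth_der t sa).
have [r2 r20 H2] := der_cont (csn_norm R) d2 (csmooth_der t sb).
apply/nearP; exists (Num.min r1 r2); first by rewrite lt_min r10.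
move=> h; rewrite lt_min => /andP[/H1 /= h1 /H2 /= h2].
by split => /=; [apply: le_lt_trans h1 _ | apply: le_lt_trans h2 _]; lra.
Qed.

Lemma tv1_smooth s (ss : sm2 s) (a b : R -> R^o) : csmooth a -> csmooth b ->
  tsmooth_curve (fun t => tv1 ss (a t, b t)).
Proof.
move=> sa sb; have bE : @tbase R M \o (fun t => tv1 ss (a t, b t)) = fun t => s (a t, b t).
  by apply/funext => t; exact: tbase_tv1.
split; rewrite bE; first exact: (ss a b sa sb).
move=> i; apply: smooth_on_local => t it.
have [F [sF [d d0 H]]] := sm2_chart ss it.
exists (fun t => pd1 F (a t, b t)); first exact: (csm2_pd1 sF).
apply: filterS (curve_in_box t sa sb d0) => r xr; exact: tchart_tv1 H _ xr.
Qed.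

Lemma sm2_swap s : sm2 s -> sm2 (fun x => s (x.2, x.1)).
Proof. by move=> ss a b sa sb; exact: ss. Qed.

Lemma tv2_swap s (ss : sm2 s) x : tv2 ss x = tv1 (sm2_swap ss) (x.2, x.1).
Proof. by rewrite /tv2 /tv1; congr velocity; exact: scurve_eq. Qed.

Lemma tv2_smooth s (ss : sm2 s) (a b : R -> R^o) : csmooth a -> csmooth b ->
  tsmooth_curve (fun t => tv2 ss (a t, b t)).
Proof.
move=> sa sb; under [X in tsmooth_curve X]eq_fun do rewrite tv2_swap.
exact: tv1_smooth.
Qed.

Lemma tsmooth_local (z : R -> tangent M) :
  (forall t : R, exists2 z' : R -> tangent M, tsmooth_curve z' & \forall r \near t, z r = z' r) ->
  tsmooth_curve z.
Proof.
move=> H; split.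
  apply: smooth_curve_local => t; have [z' [sz' _] zz] := H t.
  by exists (@tbase R M \o z') => //; apply: filterS zz => r /= ->.
move=> i; apply: smooth_on_local => t it; have [z' [bz' sz'] zz] := H t.
have it' : chart_dom i (tbase (z' t)) by rewrite -(nbhs_singleton zz).
have [th [_ _ tht sth]] := smooth_on_ext (bz' i).1 (sz' i) it'.
exists (fun r => tchart i (z' (th r))) => //.
by apply: filterS2 zz tht => r /= -> ->.
Qed.

(** In the chart take the map (q, r) -> g(r) + q w(r), with [g] the base curve and [w] the
    coordinate of the vector, cut off so as to stay in the chart. Smooth curves in the tangent
    bundle thus become partial velocities of plane maps, to which mappings of manifolds can be
    applied. *)
Lemma tsmooth_rep1 (z : R -> tangent M) (t : R) i :
  smooth_curve (@tbase R M \o z) -> chart_dom i (tbase (z t)) ->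
  smooth_on ((@tbase R M \o z) @^-1` chart_dom i) (tchart i \o z) ->
  exists s (ss : sm2 s), \forall r \near t, z r = tv1 ss (0, r).
Proof.
move=> bz it sz; have [g [sg ig gz zg]] := chart_rep bz it.
have [th [sth ith tht sw]] := smooth_on_ext (bz i).1 sz it.
pose w r := tchart i (z (th r)); rewrite -/w in sw.
have sgw (a b : R -> R^o) : csmooth a -> csmooth b -> csmooth (fun r => g (b r) + a r *: w (b r)).
  move=> sa sb; apply: csmoothD; first exact: csmooth_comp.
  by apply: csmoothZ => //; exact: (csmooth_comp sw sb).
have [||d' d'0 Hd'] := @cinf_open_plane R [set x | chart_img (g x.2 + x.1 *: w x.2)] _ (0, t).
- by move=> a b sa sb; apply: chart_img_open; exact: sgw.
- by rewrite /= scale0r addr0.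
have [th1 [s1 e1 r1]] := cutoff_ex 0 d'0.
have [th2 [s2 e2 r2]] := cutoff_ex t d'0.
pose G (x : V) := g (th2 x.2) + th1 x.1 *: w (th2 x.2).
have iG x : chart_img (G x) by apply: (Hd' (th1 x.1, th2 x.2)); split; [exact: r1|exact: r2].
have sG : csm2 G.
  by move=> a b sa sb; apply: (sgw (fun t => th1 (a t)) (fun t => th2 (b t))); exact: csmooth_comp.
have ss : sm2 (fun x => chart_inv i (G x)).
  by move=> a b sa sb; apply: chart_inv_smooth => //; exact: sG.
exists (fun x => chart_inv i (G x)), ss.
have th10 : th1 0 = 0 by apply: e1; rewrite subr0 normr0 divr_ge0 // ltW.
have G0 r : G (0, r) = g (th2 r) by rewrite /G /= th10 scale0r addr0.
have e2' : \forall r \near t, th2 r = r.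
  apply/nearP; exists (d' / 2); first by rewrite divr_gt0.
  by move=> h hd; apply: e2; rewrite addrAC subrr add0r ltW.
near=> r; have e2r : th2 r = r by near: r.
have gzr : (@tbase R M \o z) r = chart_inv i (g r) by near: r.
apply: (tangent_eq (i := i)); rewrite ?tbase_tv1 ?G0 ?e2r //.
  by rewrite -[tbase _]/((@tbase R M \o z) r) gzr; apply: chart_img_dom; exact: ig.
rewrite /tv1 tchart_velocity /=; last by apply: chart_img_dom; exact: iG.
apply/esym/der_cderiv.
have thr : th r = r by near: r.
rewrite -thr -/(w r); have := derD (der_cst (g r) 0) (der_line (w r) 0); rewrite add0r.
apply: der_near; apply/nearP; exists (d' / 2) => [|h hd]; first by rewrite divr_gt0.
by rewrite chart_invK ?iG // /G /= thr e2r e1 // add0r subr0 ltW.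
Unshelve. all: by end_near. Qed.

Lemma tsmooth_rep (z : R -> tangent M) (t : R) : tsmooth_curve z ->
  exists s (ss : sm2 s), \forall r \near t, z r = tv1 ss (0, r).
Proof.
move=> [bz sz]; have [i it] := chart_ex (tbase (z t)).
exact: tsmooth_rep1 bz it (sz i).
Qed.

Lemma tsmooth_chart (z : R -> tangent M) :
  smooth_curve (@tbase R M \o z) ->
  (forall t, exists i, chart_dom i (tbase (z t)) /\
     smooth_on ((@tbase R M \o z) @^-1` chart_dom i) (tchart i \o z)) ->
  tsmooth_curve z.
Proof.
move=> bz sz; apply: tsmooth_local => t; have [i [it szi]] := sz t.
have [s [ss zE]] := tsmooth_rep1 bz it szi.
exists (fun r => tv1 ss (0, r)) => //; exact: tv1_smooth (csmooth_cst _) csmooth_id.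
Qed.

Lemma sm2_chain s (ss : sm2 s) (a b : R -> R^o) (a' b' : R) (t : R) i :
  csmooth a -> csmooth b -> der a t a' -> der b t b' -> chart_dom i (s (a t, b t)) ->
  cderiv (fun r => chart i (s (a r, b r))) t =
  a' *: tchart i (tv1 ss (a t, b t)) + b' *: tchart i (tv2 ss (a t, b t)).
Proof.
move=> sa sb da db it; have [F [sF [d d0 H]]] := sm2_chart ss it.
have b0 : box d (a t, b t) (a t, b t) by exact: box_refl.
rewrite (tchart_tv1 ss H b0) (tchart_tv2 ss H b0); apply: der_cderiv.
apply: der_near (csm2_chain sF da db); apply: filterS (curve_in_box t sa sb d0).
by move=> r /H [_ ->].
Qed.

Lemma tplane_chart (T : V -> tangent M) (x : V) i :
  (forall a b : R -> R^o, csmooth a -> csmooth b -> tsmooth_curve (fun t => T (a t, b t))) ->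
  chart_dom i (tbase (T x)) -> exists F : V -> model i, csm2 F /\
  exists2 d, 0 < d & forall y, box d x y -> F y = tchart i (T y).
Proof.
move=> sT ix; apply: (csm2_local (W := [set y | chart_dom i (tbase (T y))])) => //.
  by move=> a b sa sb; have [sbase _] := sT a b sa sb; exact: (curve_open_dom sbase).
by move=> a b sa sb ab n t _; have [_ H] := sT a b sa sb; apply: H; exact: ab.
Qed.

(** The plane map is affine in a chart, up to a cutoff. It reduces identities between forms on
    arbitrary pairs of tangent vectors to identities between partial derivatives. *)
Lemma plane_tangents (z1 z2 : tangent M) : tbase z1 = tbase z2 ->
  exists s (ss : sm2 s),
    s (0, 0) = tbase z1 /\ tv1 ss (0, 0) = z1 /\ tv2 ss (0, 0) = z2.
Proof.
move=> zz; set x := tbase z1 in zz *; have b1 : tbase z1 = x by [].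
have b2 : tbase z2 = x by [].
have [i ix] := chart_ex x.
set v1 := tchart i z1; set v2 := tchart i z2.
pose y := chart i x; have iy : chart_img y by exact: chart_img_chart.
have sl (r r' : R -> R^o) : csmooth r -> csmooth r' ->
    csmooth (fun t => y + r t *: v1 + r' t *: v2).
  move=> sr sr'; do 2 (apply: csmoothD; last exact: csmoothZ _ (csmooth_cst _)).
  exact: csmooth_cst.
have [||d d0 Hd] := @cinf_open_plane R [set p | chart_img (y + p.1 *: v1 + p.2 *: v2)] _ (0, 0).
- by move=> r r' sr sr'; apply: chart_img_open; exact: sl.
- by rewrite /= !scale0r !addr0.
have [th [sth e r0]] := cutoff_ex 0 d0.
have th0 : th 0 = 0 by apply: e; rewrite subr0 normr0 divr_ge0 // ltW.
pose G (p : R * R) := y + th p.1 *: v1 + th p.2 *: v2.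
have iG p : chart_img (G p).
  by apply: (Hd (th p.1, th p.2)); split; rewrite /=; exact: r0.
have ss : sm2 (fun p => chart_inv i (G p)).
  move=> r r' sr sr'; apply: chart_inv_smooth => //.
  by apply: (sl (fun t => th (r t)) (fun t => th (r' t))); exact: csmooth_comp.
have G0 : G (0, 0) = y by rewrite /G /= th0 !scale0r !addr0.
have s0 : chart_inv i (G (0, 0)) = x by rewrite G0 chartK.
have thn : \forall h \near (0 : R), th h = h.
  apply/nearP; exists (d / 2) => [|h hd]; first by rewrite divr_gt0.
  by apply: e; rewrite add0r subr0 ltW.
have z1E : z1 = tv1 ss (0, 0).
  apply: (tangent_eq (i := i)); rewrite ?tbase_tv1 ?s0 ?b1 //.
  rewrite /tv1 tchart_velocity /=; last by rewrite s0.
  apply/esym/der_cderiv; have := derD (der_cst y 0) (der_line v1 0); rewrite add0r.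
  apply: der_near; apply: filterS thn => h hh.
  by rewrite chart_invK // /G /= th0 hh scale0r addr0.
have z2E : z2 = tv2 ss (0, 0).
  apply: (tangent_eq (i := i)); rewrite ?tbase_tv2 ?s0 ?b2 //.
  rewrite /tv2 tchart_velocity /=; last by rewrite s0.
  apply/esym/der_cderiv; have := derD (der_cst y 0) (der_line v2 0); rewrite add0r.
  apply: der_near; apply: filterS thn => h hh.
  by rewrite chart_invK // /G /= th0 hh scale0r addr0.
exists (fun p => chart_inv i (G p)), ss; split; first exact: s0.
by rewrite -z1E -z2E.
Qed.

End plane_maps.

Section tangent_map_smooth.
Context {R : realType} {M N : manifold R} (f : smap M N).

Lemma sm2_comp s : @sm2 R M s -> sm2 (f \o s).
Proof. by move=> ss a b sa sb; exact: (sm_smooth f (ss _ _ sa sb)). Qed.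

Lemma tmap_tv1 s (ss : sm2 s) x : tmap f (tv1 ss x) = tv1 (sm2_comp ss) x.
Proof. by rewrite /tv1 tmap_velocity; congr velocity; exact: scurve_eq. Qed.

Lemma tmap_tv2 s (ss : sm2 s) x : tmap f (tv2 ss x) = tv2 (sm2_comp ss) x.
Proof. by rewrite /tv2 tmap_velocity; congr velocity; exact: scurve_eq. Qed.

Lemma tmap_smooth z : tsmooth_curve z -> tsmooth_curve ((tmap f) \o z).
Proof.
move=> sz; apply: tsmooth_local => t; have [s [ss zE]] := tsmooth_rep t sz.
exists (fun r => tv1 (sm2_comp ss) (0, r)).
  exact: tv1_smooth (csmooth_cst _) csmooth_id.
by apply: filterS zE => r /= ->; rewrite tmap_tv1.
Qed.

(** If z1 and z2 are the partial velocities of [s], then a z1 + z2 is the velocity of t -> s(a t,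
    t). Composing with [f] preserves this description, so the tangent map is linear, and the
    relation in one chart implies it in all. *)
Lemma tmap_lincomb x a z1 z2 z3 (i : chart_idx M) :
  tbase z1 = x -> tbase z2 = x -> tbase z3 = x -> chart_dom i x ->
  tchart i z3 = a *: tchart i z1 + tchart i z2 ->
  tangent_lincomb (f x) a (tmap f z1) (tmap f z2) (tmap f z3).
Proof.
move=> b1 b2 b3 ix H; split; rewrite ?tbase_tmap ?b1 ?b2 ?b3 // => j jx.
have [s [ss [s0 [z1E z2E]]]] := plane_tangents (etrans b1 (esym b2)).
rewrite b1 in s0.
have sa : csmooth (fun t : R => a *: (t : R^o)) := csmoothZc a (@csmooth_id R).
have sc3 : smooth_curve (fun t => s (a *: (t : R^o), t)).
  exact: (ss (fun t => a *: t) _ sa csmooth_id).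
have da : der (fun t : R => a *: (t : R^o)) 0 a.
  by have := derZ a (der_id 0); rewrite [a *: 1]mulr1.
have a0 : a *: (0 : R^o) = 0 by exact: scaler0.
have z3E : z3 = \pi_(tangent M) (Scurve sc3).
  apply: (tangent_eq (i := i)); rewrite ?tbase_pi /= ?a0 ?s0 ?b3 //.
  rewrite tchart_pi /= ?a0 ?s0 // H.
  rewrite (sm2_chain ss sa csmooth_id da (der_id 0)) ?a0 ?s0 //.
  by rewrite z1E z2E scale1r.
rewrite -z1E -z2E z3E tmap_tv1 tmap_tv2 tmap_pi.
rewrite tchart_pi /= ?a0 ?s0 //.
have := sm2_chain (sm2_comp ss) sa csmooth_id da (der_id 0) (i := j).
rewrite a0 /= s0 scale1r; exact.
Qed.

End tangent_map_smooth.

Lemma lincomb_chart (R : realType) (M : manifold R) x a (z1 z2 z3 : tangent M) i :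
  tbase z1 = x -> tbase z2 = x -> tbase z3 = x -> chart_dom i x ->
  tchart i z3 = a *: tchart i z1 + tchart i z2 -> tangent_lincomb x a z1 z2 z3.
Proof.
by move=> b1 b2 b3 ix H; have := tmap_lincomb (smap_id M) b1 b2 b3 ix H; rewrite !tmap_id.
Qed.

(** * The Maurer-Cartan form *)

Section lie_calculus.
Context {R : realType} (G : lie_group R).
Notation V := (R * R)%type.
Notation u := (unit_chart G).
Notation one := (lg_one G).
Notation mul := (@lg_mul R G).
Notation inv := (@lg_inv R G).
Implicit Types (X Y Z : Lie G) (c g h : R -> G).

Lemma lg_mulA (a b d : G) : mul a (mul b d) = mul (mul a b) d.
Proof. exact: mulgA. Qed.
Lemma lg_mul1 (a : G) : mul a one = a.
Proof. exact: mulg1. Qed.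
Lemma lg_1mul (a : G) : mul one a = a.
Proof. exact: mul1g. Qed.
Lemma lg_mulV (a : G) : mul a (inv a) = one.
Proof. exact: mulgV. Qed.
Lemma lg_Vmul (a : G) : mul (inv a) a = one.
Proof. exact: mulVg. Qed.
Lemma lg_invM (a b : G) : inv (mul a b) = mul (inv b) (inv a).
Proof. exact: invMg. Qed.
Lemma lg_inv1 : inv one = one.
Proof. exact: invg1. Qed.
Lemma lg_invK (a : G) : inv (inv a) = a.
Proof. exact: invgK. Qed.
Lemma lg_mulKV (a b : G) : mul (mul a (inv b)) b = a.
Proof. by rewrite -lg_mulA lg_Vmul lg_mul1. Qed.
Lemma lg_mulK (a b : G) : mul (mul a b) (inv b) = a.
Proof. by rewrite -lg_mulA lg_mulV lg_mul1. Qed.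

Lemma unit_dom : chart_dom u one.
Proof. exact: projT2 (cid (acover (matlas G) one)). Qed.

Lemma unit_img : chart_img (chart u one).
Proof. exact: chart_img_chart unit_dom. Qed.

Lemma mul_smooth c g : smooth_curve c -> smooth_curve g ->
  smooth_curve (fun t => mul (c t) (g t)).
Proof. exact: lg_mul_smooth. Qed.

Lemma inv_smooth c : smooth_curve c -> smooth_curve (fun t => inv (c t)).
Proof. exact: lg_inv_smooth. Qed.

Lemma sm2_mul (s r : V -> G) : sm2 s -> sm2 r -> sm2 (fun x => mul (s x) (r x)).
Proof. by move=> ss sr a b sa sb; apply: mul_smooth; [exact: ss|exact: sr]. Qed.

Lemma sm2_inv (s : V -> G) : sm2 s -> sm2 (fun x => inv (s x)).
Proof. by move=> ss a b sa sb; apply: inv_smooth; exact: ss. Qed.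

Lemma to_TeP X : tbase (to_Te G X) = one /\ of_Te G (to_Te G X) = X.
Proof.
have [b t] := tchart_invP X unit_img; split=> //.
by rewrite [LHS]b chartK //; exact: unit_dom.
Qed.

Lemma of_TeK X : of_Te G (to_Te G X) = X. Proof. by have [] := to_TeP X. Qed.

Lemma tbase_to_Te X : tbase (to_Te G X) = one. Proof. by have [] := to_TeP X. Qed.

Lemma to_TeK (z : tangent G) : tbase z = one -> to_Te G (of_Te G z) = z.
Proof.
move=> bz; apply: (tangent_eq (i := u)); rewrite ?tbase_to_Te ?bz //; first exact: unit_dom.
exact: of_TeK.
Qed.

(* delta^r g, read in the chart at e *)
Definition dlog g t : Lie G := cderiv (fun s => chart u (mul (g s) (inv (g t)))) t.

Lemma mc_velocity (c : scurve G) t : maurer_cartan (velocity c t) = dlog c t.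
Proof.
rewrite /maurer_cartan tmap_velocity tbase_velocity /of_Te tchart_velocity //=.
by rewrite lg_mulV; exact: unit_dom.
Qed.

Lemma rtrans1 : rtrans one = smap_id G.
Proof. by apply: smap_eq; apply/funext => x; exact: lg_mul1. Qed.

Lemma ltrans1 : ltrans one = smap_id G.
Proof. by apply: smap_eq; apply/funext => x; exact: lg_1mul. Qed.

Lemma mc_one (z : tangent G) : tbase z = one -> maurer_cartan z = of_Te G z.
Proof. by move=> bz; rewrite /maurer_cartan bz lg_inv1 rtrans1 tmap_id. Qed.

Lemma mc_rtrans a (z : tangent G) : maurer_cartan (tmap (rtrans a) z) = maurer_cartan z.
Proof.
rewrite /maurer_cartan -tmap_comp tbase_tmap; congr (of_Te G (tmap _ z)).
by apply: smap_eq; apply/funext => x /=; rewrite lg_invM !lg_mulA lg_mulK.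
Qed.

Lemma mc_inv (z : tangent G) : z = tmap (rtrans (tbase z)) (to_Te G (maurer_cartan z)).
Proof.
rewrite /maurer_cartan to_TeK; last by rewrite tbase_tmap /= lg_mulV.
rewrite -tmap_comp (_ : smap_comp _ _ = smap_id G) ?tmap_id //.
by apply: smap_eq; apply/funext => x /=; rewrite lg_mulKV.
Qed.

Lemma mc_inj (z z' : tangent G) : tbase z = tbase z' -> maurer_cartan z = maurer_cartan z' -> z = z'.
Proof. by move=> b m; rewrite (mc_inv z) (mc_inv z') b m. Qed.

(** Locally z(r) is the first partial velocity of a plane map [s] at (0, r). Dividing s(q, r) on the
    right by s(0, r) moves the base point to the unit for every [r], where the form is just the
    coordinate in the unit chart. *)
Lemma mc_smooth (z : R -> tangent G) : tsmooth_curve z -> csmooth (fun t => maurer_cartan (z t)).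
Proof.
move=> sz n t _.
suff : smooth_on setT (fun t => maurer_cartan (z t)) by exact.
apply: smooth_on_local => {}t _; have [s [ss zE]] := tsmooth_rep t sz.
pose w (x : V) := mul (s x) (inv (s (0, x.2))).
have sw : sm2 w.
  apply: sm2_mul => //; apply: sm2_inv => a b sa sb.
  exact: ss (csmooth_cst _) sb.
have w1 r : w (0, r) = one by rewrite /w lg_mulV.
exists (fun r => tchart u (tv1 sw (0, r))).
  have [_ H] := tv1_smooth sw (csmooth_cst 0) csmooth_id.
  move=> k r _; apply: H; rewrite /= tbase_tv1 w1; exact: unit_dom.
apply: filterS zE => r ->.
rewrite /maurer_cartan tbase_tv1 tmap_velocity /of_Te; congr tchart.
by congr velocity; exact: scurve_eq.
Qed.

Definition conj (a : G) : smap G G := smap_comp (ltrans a) (rtrans (inv a)).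
Definition Ad (a : G) X : Lie G := of_Te G (tmap (conj a) (to_Te G X)).

Lemma conj_one a : conj a one = one.
Proof. by rewrite /= lg_1mul lg_mulV. Qed.

Lemma Ad1 X : Ad one X = X.
Proof.
rewrite /Ad (_ : conj one = smap_id G) ?tmap_id ?of_TeK //.
by apply: smap_eq; apply/funext => x /=; rewrite lg_1mul lg_inv1 lg_mul1.
Qed.

Lemma Ad_mul a b X : Ad (mul a b) X = Ad a (Ad b X).
Proof.
rewrite {1}/Ad (_ : conj (mul a b) = smap_comp (conj a) (conj b)); last first.
  by apply: smap_eq; apply/funext => x /=; rewrite lg_invM !lg_mulA.
rewrite tmap_comp /Ad to_TeK //; first by rewrite tbase_tmap tbase_to_Te conj_one.
Qed.

Lemma Ad_linear a (k : R) X Y : Ad a (k *: X + Y) = k *: Ad a X + Ad a Y.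
Proof.
have H : tchart u (to_Te G (k *: X + Y)) = k *: tchart u (to_Te G X) + tchart u (to_Te G Y).
  by rewrite -!/(of_Te G _) !of_TeK.
have [_ _ _] := tmap_lincomb (conj a) (tbase_to_Te X) (tbase_to_Te Y) (tbase_to_Te _) unit_dom H.
by apply; rewrite conj_one; exact: unit_dom.
Qed.

Lemma Ad0 a : Ad a 0 = 0.
Proof.
have := Ad_linear a (-1) 0 0; rewrite scaler0 addr0 scaleN1r addNr; exact.
Qed.

Lemma to_Te_smooth (X : R -> Lie G) : csmooth X -> tsmooth_curve (fun t => to_Te G (X t)).
Proof.
move=> sX; apply: tsmooth_chart.
  rewrite (_ : _ \o _ = fun=> one); first exact: smooth_curve_cst.
  by apply/funext => t; exact: tbase_to_Te.
move=> t; exists u; rewrite tbase_to_Te; split; first exact: unit_dom.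
rewrite (_ : tchart u \o _ = X); last by apply/funext => r; exact: of_TeK.
by move=> n r _; exact: sX.
Qed.

Lemma translate_smooth (z : R -> tangent G) g h : tsmooth_curve z ->
  smooth_curve g -> smooth_curve h ->
  tsmooth_curve (fun t => tmap (ltrans (g t)) (tmap (rtrans (h t)) (z t))).
Proof.
move=> sz sg sh; apply: tsmooth_local => t; have [s [ss zE]] := tsmooth_rep t sz.
have sw : sm2 (fun x => mul (g x.2) (mul (s x) (h x.2))).
  apply: sm2_mul; last apply: sm2_mul => //.
    by move=> a b _ sb; exact: (smooth_curve_comp sg sb).
  by move=> a b _ sb; exact: (smooth_curve_comp sh sb).
exists (fun r => tv1 sw (0, r)); first exact: tv1_smooth (csmooth_cst _) csmooth_id.
apply: filterS zE => r ->; rewrite !tmap_velocity /tv1; congr velocity.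
exact: scurve_eq.
Qed.

Lemma Ad_smooth g (X : R -> Lie G) : smooth_curve g -> csmooth X ->
  csmooth (fun t => Ad (g t) (X t)).
Proof.
move=> sg sX.
have := mc_smooth (translate_smooth (to_Te_smooth sX) sg (inv_smooth sg)).
rewrite (_ : (fun t => maurer_cartan _) = fun t => Ad (g t) (X t)) //.
apply/funext => t; rewrite -tmap_comp mc_one //.
by rewrite tbase_tmap tbase_to_Te conj_one.
Qed.

Lemma Ad_velocity a (c : scurve G) : c 0 = one ->
  Ad a (of_Te G (\pi_(tangent G) c)) =
  cderiv (fun r => chart u (mul a (mul (c r) (inv a)))) 0.
Proof.
move=> c0; rewrite /Ad to_TeK ?tbase_pi // tmap_pi /of_Te tchart_pi //.
by rewrite /= c0 lg_1mul lg_mulV; exact: unit_dom.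
Qed.

(** The two factors get separate parameters; the diagonal derivative is the sum of the partial ones,
    and the second is conjugated by g(t). *)
Lemma dlog_mul g h t : smooth_curve g -> smooth_curve h ->
  dlog (fun r => mul (g r) (h r)) t = dlog g t + Ad (g t) (dlog h t).
Proof.
move=> sg sh; set k := inv (mul (g t) (h t)).
pose s (x : V) := mul (mul (g x.1) (h x.2)) k.
have ss : sm2 s.
  apply: sm2_mul; last by move=> a b _ _; exact: smooth_curve_cst.
  by apply: sm2_mul => a b sa sb; [exact: (smooth_curve_comp sg sa)|exact: (smooth_curve_comp sh sb)].
have s1 : s (t, t) = one by rewrite /s lg_mulV.
rewrite /dlog -/k -[LHS]/(cderiv (fun r => chart u (s (r, r))) t).
have dt : chart_dom u (s (t, t)) by rewrite s1; exact: unit_dom.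
rewrite (sm2_chain ss csmooth_id csmooth_id (der_id t) (der_id t) dt) !scale1r; congr (_ + _).
  rewrite /tv1 tchart_velocity //=; congr (cderiv _ t); apply/funext => r.
  by rewrite /s /= /k lg_invM !lg_mulA lg_mulK.
pose c := Scurve (mul_smooth (smooth_curve_shift t sh) (@smooth_curve_cst R G (inv (h t)))).
have c0 : c 0 = one by rewrite /= addr0 lg_mulV.
rewrite -[X in Ad _ X](cderiv_shift (fun r => chart u (mul (h r) (inv (h t))))).
have <- : of_Te G (\pi_(tangent G) c) = cderiv (fun r => chart u (mul (h (t + r)) (inv (h t)))) 0.
  by rewrite /of_Te tchart_pi // c0; exact: unit_dom.
rewrite Ad_velocity // /tv2 tchart_velocity //= -cderiv_shift.
congr (cderiv _ 0); apply/funext => r.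
by rewrite /s /= /k lg_invM !lg_mulA.
Qed.

Lemma dlog_cst a t : dlog (fun=> a) t = 0.
Proof. exact: der_cderiv (der_cst _ t). Qed.

Lemma dlog_mulr g a t : dlog (fun r => mul (g r) a) t = dlog g t.
Proof.
rewrite /dlog; congr (cderiv _ t); apply/funext => r.
by rewrite lg_invM lg_mulA lg_mulK.
Qed.

Lemma dlog_inv g t : smooth_curve g ->
  dlog (fun r => inv (g r)) t = - Ad (inv (g t)) (dlog g t).
Proof.
move=> sg; have := dlog_mul t (inv_smooth sg) sg.
rewrite (_ : (fun r => mul _ _) = fun=> one); last by apply/funext => r; exact: lg_Vmul.
by rewrite dlog_cst => /esym/eqP; rewrite addr_eq0 => /eqP.
Qed.

(** As the Maurer-Cartan form is injective on each tangent space, [g] has the velocity of a constant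
    curve; it is locally constant in charts, and [cousin] makes this global. *)
Lemma dlog0_cst g : smooth_curve g -> (forall t, dlog g t = 0) -> forall s t, g s = g t.
Proof.
move=> sg g0.
have loc t : exists2 d : R, 0 < d & forall s, `|s - t| < d -> g s = g t.
  have [i it] := chart_ex (g t); have [d d0 H] := (openP _).1 (sg i).1 t it.
  exists d => // s st; have is' := H s st.
  suff E : chart i (g s) = chart i (g t) by rewrite -(chartK is') E chartK.
  have D r : `|r - t| < d -> der (fun r => chart i (g r)) r 0.
    move=> /H ir.
    have E : velocity (Scurve sg) r = \pi_(tangent G) (scst (g r)).
      apply: mc_inj; first by rewrite tbase_velocity tbase_pi.
      by rewrite mc_velocity g0 -velocity0 mc_velocity dlog_cst.
    have : tchart i (velocity (Scurve sg) r) = 0.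
      by rewrite E tchart_pi //; exact: (der_cderiv (der_cst (chart i (g r)) 0)).
    rewrite tchart_velocity // => <-; have [v /derP dv] := (sg i).2 0%N r ir.
    by rewrite (der_cderiv dv).
  pose d' := `|s - t|; apply: (@der0_cst R _ (fun r => chart i (g r)) (t - d') (t + d') _ s t).
  - move=> r tr rt; apply: D; apply: le_lt_trans st.
    by rewrite ler_norml -/d'; apply/andP; split; lra.
  - by have := ler_norm (t - s); rewrite distrC -/d'; lra.
  - by have := ler_norm (s - t); rewrite -/d'; lra.
  - by have : 0 <= d' := normr_ge0 _; lra.
  - by have : 0 <= d' := normr_ge0 _; lra.
move=> s t; wlog st : s t / s <= t.
  by move=> H; case: (leP s t) => [/H //|/ltW/H ->].
apply: (cousin (P := fun x y => g x = g y) st) => [x y z _ _ _ _ -> //|r _ _].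
have [d d0 H] := loc r; exists d => // x y _ xr ry _ dx dy.
by rewrite !H // ltr_norml; apply/andP; split; lra.
Qed.

(** The quotient h^-1 g has logarithmic derivative Ad(h^-1)(dlog g - dlog h) = 0. This is the
    uniqueness of evolutions up to a constant right factor. *)
Lemma dlog_eq g h : smooth_curve g -> smooth_curve h -> (forall t, dlog g t = dlog h t) ->
  forall s, g s = mul (h s) (mul (inv (h 0)) (g 0)).
Proof.
move=> sg sh gh s.
have sk : smooth_curve (fun t => mul (inv (h t)) (g t)) by apply: mul_smooth => //; exact: inv_smooth.
have H : mul (inv (h s)) (g s) = mul (inv (h 0)) (g 0).
  apply: (dlog0_cst sk) => t; rewrite dlog_mul //; last exact: inv_smooth.
  by rewrite dlog_inv // gh addNr.
by rewrite -H lg_mulA lg_mulV lg_1mul.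
Qed.

Lemma dlog_uniq g h s0 : smooth_curve g -> smooth_curve h -> (forall t, dlog g t = dlog h t) ->
  g s0 = h s0 -> forall s, g s = h s.
Proof.
move=> sg sh gh g0 s; have H := dlog_eq sg sh gh.
have : mul (inv (h 0)) (g 0) = one.
  by have := H s0; rewrite g0 => /(congr1 (mul (inv (h s0)))); rewrite lg_mulA lg_Vmul lg_1mul.
by rewrite [g s]H => ->; rewrite lg_mul1.
Qed.

Definition lfield X (a : G) : Lie G := tchart u (tmap (ltrans a) (to_Te G X)).

Lemma lfield_tsmooth X g : smooth_curve g -> tsmooth_curve (fun t => tmap (ltrans (g t)) (to_Te G X)).
Proof.
move=> sg; have := translate_smooth (to_Te_smooth (csmooth_cst X)) sg (@smooth_curve_cst R G one).
by rewrite rtrans1; under [X in tsmooth_curve X]eq_fun do rewrite tmap_id.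
Qed.

Lemma lfield_smooth X g : smooth_curve g -> (forall t, chart_dom u (g t)) ->
  csmooth (lfield X \o g).
Proof.
move=> sg ug n t _; have [_ H] := lfield_tsmooth X sg; apply: H.
by rewrite /= tbase_tmap tbase_to_Te /= lg_mul1; exact: ug.
Qed.

(** The bracket is defined by derivatives along straight coordinate lines; this allows any curve
    with the same velocity, in particular one adapted to the group. *)
Lemma lfield_chain X Y (c : scurve G) : c 0 = one -> of_Te G (\pi_(tangent G) c) = Y ->
  cderiv (fun s => left_field X (chart u one + s *: Y)) 0 = cderiv (lfield X \o c) 0.
Proof.
move=> c0 cY; have [c' cE] := line_curve Y unit_img.
have [c'0 _] := nbhs_singleton cE; rewrite scale0r addr0 chartK in c'0; last exact: unit_dom.
have uc : chart_dom u (c 0) by rewrite c0; exact: unit_dom.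
have [|||-> _] := @mchain R G _ (chart_dom u) (lfield X) c c' u (curve_open_dom (i := u)) _
   (sc_smooth c) (sc_smooth c') uc _ uc.
- by move=> g sg; exact: lfield_smooth.
- by rewrite c0.
- rewrite -tchart_pi // -/(of_Te G _) cY; apply/esym/der_cderiv.
  have := derD (der_cst (chart u one) 0) (der_line Y 0); rewrite add0r; apply: der_near.
  by apply: filterS cE => s [-> ys]; rewrite chart_invK.
have e : \forall s \near (0 : R), left_field X (chart u one + s *: Y) = (lfield X \o c') s.
  by apply: filterS cE => s [cs _]; rewrite /= /lfield cs.
exact: (nbhs_singleton (cderivn_near 1 e)).
Qed.

End lie_calculus.

(** * Derivative of the adjoint action and the Maurer-Cartan equation *)

Section maurer_cartan_equation.
Context {R : realType} (G : lie_group R).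
Notation V := (R * R)%type.
Notation u := (unit_chart G).
Notation one := (lg_one G).
Notation mul := (@lg_mul R G).
Notation inv := (@lg_inv R G).
Implicit Types (X Y Z : Lie G) (g h : R -> G).

Lemma cderiv_near (E : htvs R) (f f' : R -> E) t :
  (\forall s \near t, f s = f' s) -> cderiv f t = cderiv f' t.
Proof. by move=> ff; exact: (nbhs_singleton (cderivn_near 1 ff)). Qed.

Lemma plane_diag (E : htvs R) (F : V -> E) (T : V -> E) (t : R) d : csm2 F -> 0 < d ->
  (forall y, box d (t, t) y -> F y = T y) ->
  cderiv (fun s => T (s, s)) t =
  cderiv (fun s => T (s, t)) t + cderiv (fun s => T (t, s)) t.
Proof.
move=> sF d0 FT.
have n1 : \forall s \near t, F (s, s) = T (s, s).
  by apply: filterS (curve_in_box t csmooth_id csmooth_id d0) => s /FT.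
have n2 : \forall s \near t, F (s, t) = T (s, t).
  by apply: filterS (curve_in_box t csmooth_id (csmooth_cst (t : R^o)) d0) => s /FT.
have n3 : \forall s \near t, F (t, s) = T (t, s).
  by apply: filterS (curve_in_box t (csmooth_cst (t : R^o)) csmooth_id d0) => s /FT.
rewrite -(cderiv_near n1) -(cderiv_near n2) -(cderiv_near n3).
by apply: der_cderiv; have := csm2_chain sF (der_id t) (der_id t); rewrite !scale1r.
Qed.

Lemma tmap_of (a b : R -> R^o) g h (z : V -> tangent G) :
  smooth_curve g -> smooth_curve h -> csmooth a -> csmooth b ->
  tsmooth_curve (fun t => z (a t, b t)) ->
  tsmooth_curve (fun t => tmap (ltrans (g (a t))) (tmap (rtrans (h (b t))) (z (a t, b t)))).
Proof.
move=> sg sh sa sb sz; apply: (translate_smooth sz (g := g \o a) (h := h \o b));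
  exact: smooth_curve_comp.
Qed.

(* The derivative of [s |-> Ad (g s) Y] is split with two parameters, and the
   derivative in the right factor is obtained from [x g g^-1 = x]. *)
Lemma Ad_der_one g Y : smooth_curve g -> g 0 = one ->
  cderiv (fun s => Ad (g s) Y) 0 = lie_bracket (dlog g 0) Y.
Proof.
move=> sg g0; set X := dlog g 0.
pose gc := Scurve sg; pose yc := repr (to_Te G Y).
have y0 : yc 0 = one by exact: tbase_to_Te.
have yE : \pi_(tangent G) yc = to_Te G Y by exact: reprK.
have gX : of_Te G (\pi_(tangent G) gc) = X.
  by rewrite -velocity0 -mc_one ?tbase_velocity // mc_velocity.
have gE : \pi_(tangent G) gc = to_Te G X by rewrite -gX to_TeK // tbase_pi.
rewrite /lie_bracket (lfield_chain Y (c := gc) g0 gX).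
rewrite (lfield_chain X (c := yc) y0); last by rewrite yE of_TeK.
pose T1 (x : V) := tmap (ltrans (g x.1)) (tmap (rtrans (inv (g x.2))) (to_Te G Y)).
have sT1 a b : csmooth a -> csmooth b -> tsmooth_curve (fun t => T1 (a t, b t)).
  move=> sa sb; apply: (tmap_of (z := fun=> to_Te G Y) sg (inv_smooth sg) sa sb).
  exact: to_Te_smooth (csmooth_cst Y).
pose T2 (x : V) := tmap (ltrans one) (tmap (rtrans (mul (g x.1) (inv (g x.2)))) (to_Te G Y)).
have sT2 a b : csmooth a -> csmooth b -> tsmooth_curve (fun t => T2 (a t, b t)).
  move=> sa sb; apply: (translate_smooth (to_Te_smooth (csmooth_cst Y)) (g := fun=> one)
    (h := fun t => mul (g (a t)) (inv (g (b t))))).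
    exact: (@smooth_curve_cst R G).
  apply: mul_smooth; first exact: (smooth_curve_comp sg sa).
  by apply: inv_smooth; exact: (smooth_curve_comp sg sb).
have d1 : chart_dom u (tbase (T1 (0, 0))).
  by rewrite !tbase_tmap tbase_to_Te /= g0 lg_inv1 !lg_1mul; exact: unit_dom.
have d2 : chart_dom u (tbase (T2 (0, 0))).
  by rewrite !tbase_tmap tbase_to_Te /= g0 lg_inv1 !lg_1mul; exact: unit_dom.
have [F1 [sF1 [r1 r10 H1]]] := tplane_chart sT1 d1.
have [F2 [sF2 [r2 r20 H2]]] := tplane_chart sT2 d2.
have e1 := plane_diag sF1 r10 H1; have e2 := plane_diag sF2 r20 H2.
rewrite /= in e1 e2.
have -> : (fun s => Ad (g s) Y) = fun s => tchart u (T1 (s, s)).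
  by apply/funext => s; rewrite /Ad /T1 -tmap_comp.
have E1 : cderiv (fun s => tchart u (T1 (s, 0))) 0 = cderiv (lfield Y \o gc) 0.
  congr (cderiv _ 0); apply/funext => s.
  by rewrite /T1 /= g0 lg_inv1 rtrans1 tmap_id.
suff E2 : cderiv (fun s => tchart u (T1 (0, s))) 0 = - cderiv (lfield X \o yc) 0.
  by rewrite e1 E1 E2.
have e0 : cderiv (fun s => tchart u (T2 (s, s))) 0 = 0.
  rewrite (_ : (fun s => _) = fun=> Y); first exact: der_cderiv (der_cst Y 0).
  by apply/funext => s; rewrite /T2 /= lg_mulV rtrans1 ltrans1 !tmap_id; exact: of_TeK.
move: e2; rewrite e0 => /esym/eqP; rewrite addrC addr_eq0 => /eqP e2.
transitivity (cderiv (fun s => tchart u (T2 (0, s))) 0).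
  congr (cderiv _ 0); apply/funext => s.
  by rewrite /T1 /T2 /= g0 lg_1mul.
rewrite e2; apply: (congr1 (fun x : Lie G => - x)).
(* Symmetry of second derivatives of y(t) g(s): the t-derivative at t = 0 is [Y] right translated by
   g(s), the s-derivative at s = 0 is the left invariant field of [X] at y(t). *)
pose B (x : V) := mul (yc x.2) (g x.1).
have sB : sm2 B.
  move=> a b sa sb; apply: mul_smooth; first exact: (smooth_curve_comp (sc_smooth yc) sb).
  exact: (smooth_curve_comp sg sa).
have uB : chart_dom u (B (0, 0)) by rewrite /B y0 g0 lg_1mul; exact: unit_dom.
have [F [sF [d d0 H]]] := sm2_chart sB uB.
transitivity (pd1 (pd2 F) (0, 0)).
  apply: cderiv_near; apply: filterS (curve_in_box 0 csmooth_id (csmooth_cst (0 : R^o)) d0) => s sd.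
  rewrite -(tchart_tv2 sB H sd) /T2 /= g0 lg_inv1 lg_mul1 ltrans1 tmap_id -yE tmap_pi.
  by rewrite /tv2 velocity0; congr (tchart u (\pi _)); exact: scurve_eq.
rewrite (pd12C sF); apply/esym/cderiv_near.
apply: filterS (curve_in_box 0 (csmooth_cst (0 : R^o)) csmooth_id d0) => s sd.
rewrite -(tchart_tv1 sB H sd) /= /lfield -gE tmap_pi.
by rewrite /tv1 velocity0; congr (tchart u (\pi _)); exact: scurve_eq.
Qed.

(** The curve g(t + r) g(t)^-1 passes through the unit at r = 0 and has the same logarithmic
    derivative there, and [Ad] is multiplicative; this reduces to [Ad_der_one]. *)
Lemma Ad_der g Y t : smooth_curve g ->
  der (fun s => Ad (g s) Y) t (lie_bracket (dlog g t) (Ad (g t) Y)).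
Proof.
move=> sg; pose g' r := mul (g (t + r)) (inv (g t)).
have sg' : smooth_curve g'.
  by apply: mul_smooth; [exact: smooth_curve_shift | exact: smooth_curve_cst].
have g'0 : g' 0 = one by rewrite /g' addr0 lg_mulV.
have -> : lie_bracket (dlog g t) (Ad (g t) Y) = cderiv (fun s => Ad (g s) Y) t.
  have := Ad_der_one (Ad (g t) Y) sg' g'0.
  have -> : dlog g' 0 = dlog g t.
    rewrite /g' dlog_mulr /dlog -[RHS]cderiv_shift addr0.
    by [].
  move=> <-; rewrite -[RHS]cderiv_shift; congr (cderiv _ 0); apply/funext => r.
  by rewrite -Ad_mul /g' lg_mulKV.
exact/csmooth_der/Ad_smooth/csmooth_cst.
Qed.

Lemma lie_bracketC X Y : lie_bracket X Y = - lie_bracket Y X.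
Proof. by rewrite /lie_bracket opprB. Qed.

(** The bracket [X, .] is the derivative of [Ad] along a curve with velocity [X], and each
    [Ad (g s)] is linear. *)
Lemma lie_bracket_linearr X (k : R) Y Z :
  lie_bracket X (k *: Y + Z) = k *: lie_bracket X Y + lie_bracket X Z.
Proof.
pose g := repr (to_Te G X).
have g0 : g 0 = one by exact: tbase_to_Te.
have gX : dlog g 0 = X.
  by rewrite -mc_velocity velocity_repr mc_one ?tbase_to_Te // of_TeK.
have D W := Ad_der W 0 (sc_smooth g); rewrite gX g0 in D.
have {}D W : der (fun s => Ad (g s) W) 0 (lie_bracket X W) by have := D W; rewrite Ad1.
apply: der_uniq (D _) _; under eq_fun do rewrite Ad_linear.
exact: (derD (derZ k (D Y)) (D Z)).
Qed.

Lemma lie_bracketBl X Y Z : lie_bracket (X - Y) Z = lie_bracket X Z - lie_bracket Y Z.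
Proof.
have E : lie_bracket Z (X - Y) = lie_bracket Z X - lie_bracket Z Y.
  have -> : X - Y = (-1) *: Y + X by rewrite scaleN1r addrC.
  by rewrite (lie_bracket_linearr Z) scaleN1r addrC.
by rewrite (lie_bracketC _ Z) E opprB (lie_bracketC X Z) (lie_bracketC Y Z) opprK addrC.
Qed.

Lemma csm2_Ad g (W : R -> Lie G) : smooth_curve g -> csmooth W ->
  csm2 (fun x : V => Ad (g x.1) (W x.2)).
Proof.
move=> sg sW a b sa sb; apply: Ad_smooth; first exact: (smooth_curve_comp sg sa).
exact: csmooth_comp.
Qed.

Lemma cderiv_linear (E E' : htvs R) (L : E -> E') (f : R -> E) t : (forall k x y, L (k *: x + y) = k *: L x + L y) ->
  (forall c : R -> E, csmooth c -> csmooth (L \o c)) -> csmooth f ->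
  der (L \o f) t (L (cderiv f t)).
Proof.
move=> Ll Ls sf; pose f' r := f (t + r).
have sf' : csmooth f'.
  by apply: csmooth_comp => //; exact: csmoothD (csmooth_cst _) csmooth_id.
have oT : cinf_open [set: E].
  by move=> c sc; rewrite preimage_setT; exact: openT.
have sL : smooth_in [set: E] L by move=> c sc _; exact: Ls.
apply: der_shift0; have := chain_rule oT sL sf' I.
suff -> : cderiv (fun r => L (f' 0 + r *: cderiv f' 0)) 0 = L (cderiv f t) by [].
rewrite /f' (cderiv_shift f); apply: der_cderiv.
have -> : (fun r => L (f (t + 0) + r *: cderiv f t)) = fun r => L (f (t + 0)) + r *: L (cderiv f t).
  by apply/funext => r; rewrite addrC Ll addrC.
by have := derD (der_cst (L (f (t + 0))) 0) (der_line (L (cderiv f t)) 0); rewrite add0r.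
Qed.

Lemma Ad_der_mul g (W : R -> Lie G) t : smooth_curve g -> csmooth W ->
  der (fun s => Ad (g s) (W s)) t
    (lie_bracket (dlog g t) (Ad (g t) (W t)) + Ad (g t) (cderiv W t)).
Proof.
move=> sg sW; have sF := csm2_Ad sg sW.
have := csm2_chain sF (der_id t) (der_id t); rewrite !scale1r.
have -> : pd1 (fun x : V => Ad (g x.1) (W x.2)) (t, t) = lie_bracket (dlog g t) (Ad (g t) (W t)).
  exact: der_cderiv (Ad_der (W t) t sg).
have -> // : pd2 (fun x : V => Ad (g x.1) (W x.2)) (t, t) = Ad (g t) (cderiv W t).
apply: der_cderiv; apply: (cderiv_linear (L := Ad (g t)) (f := W)) => //.
- by move=> k x y; exact: Ad_linear.
- by move=> c sc; apply: Ad_smooth sc; exact: smooth_curve_cst.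
Qed.

Definition mc1 (s : V -> G) (ss : sm2 s) (x : V) := maurer_cartan (tv1 ss x).
Definition mc2 (s : V -> G) (ss : sm2 s) (x : V) := maurer_cartan (tv2 ss x).

Lemma csm2_mc1 s (ss : sm2 s) : csm2 (mc1 ss).
Proof. by move=> a b sa sb; apply: mc_smooth; exact: tv1_smooth. Qed.

Lemma csm2_mc2 s (ss : sm2 s) : csm2 (mc2 ss).
Proof. by move=> a b sa sb; apply: mc_smooth; exact: tv2_smooth. Qed.

Lemma mc1E s (ss : sm2 s) x : mc1 ss x = dlog (fun r => s (r, x.2)) x.1.
Proof. by rewrite /mc1 /tv1 mc_velocity. Qed.

Lemma mc2E s (ss : sm2 s) x : mc2 ss x = dlog (fun r => s (x.1, r)) x.2.
Proof. by rewrite /mc2 /tv2 mc_velocity. Qed.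

(** Factor s(q, t) = w(q, t) s(s0, t), so that [w] is the unit on the line q = s0. There the
    components of [w] are ordinary partial derivatives in the unit chart and their mixed terms
    cancel by symmetry; what remains is the derivative of Ad(w) acting on the second component of
    [s], a bracket. *)
Lemma mc_equation s (ss : sm2 s) (x : V) :
  pd1 (mc2 ss) x - pd2 (mc1 ss) x = lie_bracket (mc1 ss x) (mc2 ss x).
Proof.
case: x => s0 t0; pose w (x : V) := mul (s x) (inv (s (s0, x.2))).
have sg : smooth_curve (fun t => s (s0, t)) by exact: sm2_snd.
have sw : sm2 w.
  apply: sm2_mul => // a b _ sb; apply: inv_smooth; exact: (smooth_curve_comp sg sb).
have w1 t : w (s0, t) = one by rewrite /w lg_mulV.
have uw : chart_dom u (w (s0, t0)) by rewrite w1; exact: unit_dom.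
have [F [sF [d d0 H]]] := sm2_chart sw uw.
have b0 : box d (s0, t0) (s0, t0) by exact: box_refl.
pose Z := mc2 ss (s0, t0).
(* the derivative of the first factor of s = w s(s0, .) *)
have E1 : pd2 (mc1 ss) (s0, t0) = pd2 (pd1 F) (s0, t0).
  apply: cderiv_near => /=.
  apply: filterS (curve_in_box t0 (csmooth_cst (s0 : R^o)) csmooth_id d0) => t td.
  rewrite -(tchart_tv1 sw H td) -[tchart u _]mc_one ?tbase_tv1 //.
  by rewrite -/(mc1 sw _) !mc1E /w /= dlog_mulr.
have wt : smooth_curve (fun r => w (r, t0)) by exact: sm2_fst.
have E2 : pd1 (mc2 ss) (s0, t0) = cderiv (fun r => mc2 sw (r, t0)) s0 +
    lie_bracket (mc1 ss (s0, t0)) Z.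
  have <- : cderiv (fun r => Ad (w (r, t0)) Z) s0 = lie_bracket (mc1 ss (s0, t0)) Z.
    have dw : dlog (fun r => w (r, t0)) s0 = mc1 ss (s0, t0).
      by rewrite mc1E /w /= dlog_mulr.
    by have := Ad_der Z s0 wt; rewrite w1 Ad1 dw => D; exact: der_cderiv D.
  apply: der_cderiv => /=.
  have -> : (fun r => mc2 ss (r, t0)) = fun r => mc2 sw (r, t0) + Ad (w (r, t0)) Z.
    apply/funext => r; rewrite /Z !mc2E /= -dlog_mul //; last exact: sm2_snd.
    congr (cderiv _ t0); apply/funext => q.
    by rewrite /w /= !lg_mulKV.
  apply: derD; first exact: (pd1_der s0 t0 (csm2_mc2 sw)).
  exact/csmooth_der/Ad_smooth/csmooth_cst.
suff E3 : cderiv (fun r => mc2 sw (r, t0)) s0 = pd1 (pd2 F) (s0, t0).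
  by rewrite E1 E2 E3 (pd12C sF) addrAC subrr add0r.
(* The vector and the translation receive separate parameters. With the vector at q = s0 it is the
   velocity of the constant curve [w (s0, .)], so varying the translation contributes 0. *)
pose T (x : V) := tmap (ltrans one) (tmap (rtrans (inv (w (x.2, t0)))) (tv2 sw (x.1, t0))).
have sT a b : csmooth a -> csmooth b -> tsmooth_curve (fun t => T (a t, b t)).
  move=> sa sb; apply: (translate_smooth (g := fun=> one) (h := fun t => inv (w (b t, t0)))).
  - exact: (tv2_smooth sw sa (csmooth_cst (t0 : R^o))).
  - exact: (@smooth_curve_cst R G).
  - apply: inv_smooth; exact: (smooth_curve_comp wt sb).
have uT : chart_dom u (tbase (T (s0, s0))).
  by rewrite !tbase_tmap tbase_tv2 /= w1 lg_inv1 !lg_1mul; exact: unit_dom.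
have [F2 [sF2 [r r0 H2]]] := tplane_chart sT uT.
have := plane_diag sF2 r0 H2; rewrite /=.
have -> : (fun q => tchart u (T (q, q))) = fun r => mc2 sw (r, t0).
  by apply/funext => q; rewrite /T /mc2 /maurer_cartan tbase_tv2 /= ltrans1 tmap_id.
have -> : cderiv (fun q => tchart u (T (s0, q))) s0 = 0.
  have n : \forall q \near s0, tchart u (T (s0, q)) = 0.
    have uw' : chart_dom u (inv (w (s0, t0))) by rewrite w1 lg_inv1; exact: unit_dom.
    have [e e0 He] := (openP _).1 (curve_open_dom (i := u) (inv_smooth wt)) s0 uw'.
    apply/nearP; exists e => // h he; have {}He := He (s0 + h).
    rewrite /T /= ltrans1 tmap_id tmap_velocity tchart_velocity /=; last first.
      by rewrite w1 lg_1mul; apply: He; rewrite addrAC subrr add0r.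
    have -> : (fun t => chart u (mul (w (s0, t)) (inv (w (s0 + h, t0))))) =
        fun=> chart u (inv (w (s0 + h, t0))).
      by apply/funext => t; rewrite w1 lg_1mul.
    exact: der_cderiv (der_cst _ _).
  rewrite (cderiv_near n); exact: der_cderiv (der_cst (0 : Lie G) s0).
rewrite addr0 => ->; apply: cderiv_near => /=.
apply: filterS (curve_in_box s0 csmooth_id (csmooth_cst (t0 : R^o)) d0) => q qd.
rewrite -(tchart_tv2 sw H qd) /T /= ltrans1 tmap_id w1 lg_inv1 rtrans1 tmap_id.
by [].
Qed.

End maurer_cartan_equation.

(** * Evolutions and flat forms *)

Section evolutions.
Context {R : realType} (G : lie_group R).
Notation V := (R * R)%type.
Notation u := (unit_chart G).
Notation one := (lg_one G).
Notation mul := (@lg_mul R G).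
Notation inv := (@lg_inv R G).

Lemma evolvesP (X : cinf_line (Lie G)) (g : scurve G) : evolves X g ->
  g 0 = one /\ forall t, dlog g t = X t.
Proof.
move=> [g0 gX]; split=> // t.
by rewrite -mc_velocity gX mc_rtrans mc_one ?tbase_to_Te // of_TeK.
Qed.

Lemma dlog_dilate (g : R -> G) (k t : R) : smooth_curve g ->
  dlog (fun r => g (k * r)) t = k *: dlog g (k * t).
Proof.
move=> sg; apply: der_cderiv.
apply: (der_comp (a := fun r => k * r : R^o) (f := fun q => chart u (mul (g q) (inv (g (k * t)))))).
  by have := derZ k (der_id t); rewrite scaleRE mulr1.
have sk : smooth_curve (fun q => mul (g q) (inv (g (k * t)))).
  by apply: mul_smooth => //; exact: smooth_curve_cst.
have uk : chart_dom u (mul (g (k * t)) (inv (g (k * t)))) by rewrite lg_mulV; exact: unit_dom.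
by have [v /derP dv] := (sk u).2 0%N (k * t) uk; rewrite /dlog (der_cderiv dv).
Qed.

(** Regularity restated for plain functions: [ev] takes the value [one] on curves that are not
    smooth, and its smoothness is tested on plane maps through [csm2_cinf]. *)
Lemma regular_ev : regular G -> exists ev : (R -> Lie G) -> G,
  (forall X : R -> Lie G, csmooth X -> exists g : R -> G,
     [/\ smooth_curve g, g 0 = one, forall t, dlog g t = X t & ev X = g 1]) /\
  (forall X : V -> Lie G, csm2 X -> smooth_curve (fun s => ev (fun t => X (s, t)))).
Proof.
move=> [ev [evP evs]].
pose ev' (X : R -> Lie G) : G := if pselect (csmooth X) is left H then ev (CinfLine H) else one.
exists ev'; split=> [X sX|X sX].
  rewrite /ev'; case: pselect => // {}sX; have [g gX gE] := evP (CinfLine sX).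
  have [g0 gd] := evolvesP gX; exists g; split=> //; exact: sc_smooth.
have := evs _ (csm2_cinf sX); rewrite (_ : _ \o _ = fun s => ev' (fun t => X (s, t))) //.
apply/funext => s; rewrite /ev'; case: pselect => [H|[]]; last exact: csm2_snd.
by congr ev; exact: cinf_line_eq.
Qed.

Section with_ev.
Variable ev : (R -> Lie G) -> G.
Hypothesis evP : forall X : R -> Lie G, csmooth X -> exists g : R -> G,
     [/\ smooth_curve g, g 0 = one, forall t, dlog g t = X t & ev X = g 1].
Hypothesis evs : forall X : V -> Lie G, csm2 X -> smooth_curve (fun s => ev (fun t => X (s, t))).

(* reparametrizing the evolution up to time t as an evolution up to time 1 *)
Definition evplane (X : V -> Lie G) (x : V) : G := ev (fun r => x.2 *: X (x.1, x.2 * r)).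

Lemma evplane_sm2 X : csm2 X -> sm2 (evplane X).
Proof.
move=> sX a b sa sb.
have sY : csm2 (fun p : V => b p.1 *: X (a p.1, b p.1 * p.2)).
  move=> a' b' sa' sb'; apply: (csmoothZ (a := fun t => b (a' t))); first exact: csmooth_comp.
  apply: (sX (fun t => a (a' t)) (fun t => b (a' t) * b' t)); first exact: csmooth_comp.
  by apply: csmoothM => //; exact: csmooth_comp.
exact: evs sY.
Qed.

Lemma evplaneP X s g : csm2 X -> smooth_curve g -> g 0 = one ->
  (forall t, dlog g t = X (s, t)) -> forall t, evplane X (s, t) = g t.
Proof.
move=> sX sg g0 gX t.
have sY : csmooth (fun r => t *: X (s, t * r)).
  apply: csmoothZc; apply: (csmooth_comp (f := fun r => X (s, r)) (a := fun r => t * r : R^o)).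
    exact: csm2_snd.
  exact: (csmoothZc t csmooth_id).
have [k [sk k0 kd]] := evP sY; rewrite /evplane /= => ->.
have sgt : smooth_curve (fun r => g (t * r)).
  apply: (smooth_curve_comp (a := fun r => t * r : R^o) sg); exact: (csmoothZc t csmooth_id).
have H r : k r = g (t * r).
  apply: (dlog_uniq (s0 := 0) sk sgt); last by rewrite mulr0 g0 k0.
  by move=> q; rewrite kd dlog_dilate // gX.
by rewrite H mulr1.
Qed.

Lemma evplane_spec X (sX : csm2 X) :
  [/\ forall s, evplane X (s, 0) = one,
      forall s t, dlog (fun r => evplane X (s, r)) t = X (s, t) &
      forall s, evplane X (s, 1) = ev (fun t => X (s, t))].
Proof.
have H s : exists g : R -> G, [/\ g 0 = one, forall t, dlog g t = X (s, t),
    forall t, evplane X (s, t) = g t & ev (fun t => X (s, t)) = g 1].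
  have [g [sg g0 gd gE]] := evP (csm2_snd s sX).
  by exists g; split=> //; exact: evplaneP.
split=> [s|s t|s]; have [g [g0 gd gE g1]] := H s.
- by rewrite gE.
- by rewrite -gd; congr (dlog _ t); apply/funext.
- by rewrite gE g1.
Qed.

End with_ev.

End evolutions.

(** * Differential forms evaluated on plane maps *)

Section forms.
Context {R : realType} {M : manifold R} {E : convenient R}.
Notation V := (R * R)%type.
Variables (w : tangent M -> E) (ow : one_form w).

Lemma form_linear (i : chart_idx M) (x : M) (a : R) z1 z2 z3 :
  tbase z1 = x -> tbase z2 = x -> tbase z3 = x -> chart_dom i x ->
  tchart i z3 = a *: tchart i z1 + tchart i z2 -> w z3 = a *: w z1 + w z2.
Proof.
move=> b1 b2 b3 ix H; have [lw _] := ow; apply: (lw x).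
exact: lincomb_chart b1 b2 b3 ix H.
Qed.

Lemma form_chart_linear (i : chart_idx M) (y : model i) : chart_img y -> forall (k : R) v v',
  w (tchart_inv i y (k *: v + v')) = k *: w (tchart_inv i y v) + w (tchart_inv i y v').
Proof.
move=> iy k v v'; have P v := tchart_invP v iy.
apply: (form_linear (P v).1 (P v').1 (P _).1 (chart_img_dom iy)).
by rewrite !(P _).2.
Qed.

Lemma form_zero (c : scurve M) : (forall t, c t = c 0) -> w (\pi_(tangent M) c) = 0.
Proof.
move=> cc; have [i ic] := chart_ex (c 0); set z := \pi _.
have bz : tbase z = c 0 by exact: tbase_pi.
have tz : tchart i z = 0.
  rewrite tchart_pi //; have -> : (fun t => chart i (c t)) = fun=> chart i (c 0).
    by apply/funext => t; rewrite cc.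
  exact: der_cderiv (der_cst (chart i (c 0)) 0).
(* With zero coordinates z is the combination - z + z of itself, so w(z) = - w(z) + w(z) = 0. *)
have := form_linear (a := -1) bz bz bz ic; rewrite tz scaler0 addr0 => /(_ erefl).
by rewrite scaleN1r addNr.
Qed.

Lemma tchart_inv_smooth (i : chart_idx M) (y v : R -> model i) : csmooth y -> csmooth v ->
  (forall t, chart_img (y t)) -> tsmooth_curve (fun t => tchart_inv i (y t) (v t)).
Proof.
move=> sy sv iy; have bE t : tbase (tchart_inv i (y t) (v t)) = chart_inv i (y t).
  by have [] := tchart_invP (v t) (iy t).
apply: tsmooth_chart.
  rewrite (_ : _ \o _ = fun t => chart_inv i (y t)); last by apply/funext.
  exact: chart_inv_smooth.
move=> t; exists i; rewrite bE; split; first exact: chart_img_dom.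
rewrite (_ : tchart i \o _ = v); first by move=> n r _; exact: sv.
by apply/funext => r; have [] := tchart_invP (v r) (iy r).
Qed.

Lemma form_chart_smooth (i : chart_idx M) (y v : R -> model i) : csmooth y -> csmooth v ->
  (forall t, chart_img (y t)) -> csmooth (fun t => w (tchart_inv i (y t) (v t))).
Proof. by move=> sy sv iy; have [_ sw] := ow; exact: (sw _ (tchart_inv_smooth sy sv iy)). Qed.

Lemma csm2_form1 s (ss : @sm2 R M s) : csm2 (fun x => w (tv1 ss x)).
Proof. by move=> a b sa sb; have [_ sw] := ow; exact: (sw _ (tv1_smooth ss sa sb)). Qed.

Lemma csm2_form2 s (ss : @sm2 R M s) : csm2 (fun x => w (tv2 ss x)).
Proof. by move=> a b sa sb; have [_ sw] := ow; exact: (sw _ (tv2_smooth ss sa sb)). Qed.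

(** Base point and vector are varied separately. The first term is one half of the exterior
    derivative in the chart; the second contains only the mixed second derivative of [F], which
    cancels upon antisymmetrization in [ext_d_plane]. *)
Lemma pd1_form2 s (ss : @sm2 R M s) (x : V) (i : chart_idx M) (F : V -> model i) (d : R) :
  csm2 F -> 0 < d -> (forall y, box d x y -> chart_dom i (s y) /\ F y = chart i (s y)) ->
  pd1 (fun x => w (tv2 ss x)) x =
  cderiv (fun r => w (tchart_inv i (F x + r *: pd1 F x) (pd2 F x))) 0 +
  w (tchart_inv i (F x) (pd1 (pd2 F) x)).
Proof.
case: x => s0 t0 sF d0 H.
have iF y : box d (s0, t0) y -> chart_img (F y).
  by move=> /H [iy ->]; exact: chart_img_chart.
have i0 : chart_img (F (s0, t0)) by apply: iF; exact: box_refl.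
pose T (x : V) := w (tchart_inv i (F (x.1, t0)) (pd2 F (x.2, t0))).
have Ts (a b : R -> R^o) : csmooth a -> csmooth b -> (forall t, chart_img (F (a t, t0))) ->
    csmooth (fun t => T (a t, b t)).
  move=> sa sb ab; apply: form_chart_smooth => //.
    exact: (sF _ _ sa (csmooth_cst (t0 : R^o))).
  exact: (csm2_pd2 sF sb (csmooth_cst (t0 : R^o))).
have [||F2 [sF2 [r r0 H2]]] := @csm2_local R E [set x | chart_img (F (x.1, t0))] T (s0, s0) _ _ i0.
- by move=> a b sa sb; apply: chart_img_open; exact: (sF _ _ sa (csmooth_cst (t0 : R^o))).
- by move=> a b sa sb; exact: Ts.
have n0 : \forall q \near s0, w (tv2 ss (q, t0)) = T (q, q).
  apply: filterS (curve_in_box s0 csmooth_id (csmooth_cst (t0 : R^o)) d0) => q qd.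
  rewrite /T /= -(tchart_tv2 ss H qd); have [iq ->] := H _ qd.
  by rewrite -[s (q, t0)](tbase_tv2 ss) tchart_invK // tbase_tv2.
rewrite /pd1 /= (cderiv_near n0) (plane_diag sF2 r0 H2); congr (_ + _).
  pose h y := w (tchart_inv i y (pd2 F (s0, t0))).
  have sh : smooth_in (@chart_img R M i) h.
    by move=> c sc ic; exact: (form_chart_smooth sc (csmooth_cst _) ic).
  pose c r := F (s0 + r, t0).
  have sc : csmooth c.
    apply: (sF (fun r => s0 + r) (fun=> t0)); last exact: csmooth_cst.
    exact: csmoothD (csmooth_cst (s0 : R^o)) csmooth_id.
  have Oc : chart_img (c 0) by rewrite /c addr0.
  have := chain_rule (@chart_img_open R M i) sh sc Oc.
  rewrite /c addr0 (cderiv_shift (fun q => F (q, t0))) => D.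
  rewrite -[LHS]cderiv_shift; exact: der_cderiv D.
apply: der_cderiv.
apply: (cderiv_linear (L := fun v => w (tchart_inv i (F (s0, t0)) v)) (f := fun q => pd2 F (q, t0))).
- by move=> k v v'; exact: form_chart_linear.
- by move=> c sc; exact: (form_chart_smooth (csmooth_cst _) sc).
- exact: csm2_fst (csm2_pd2 sF).
Qed.

Lemma tv1_swap s (ss : @sm2 R M s) x : tv1 ss x = tv2 (sm2_swap ss) (x.2, x.1).
Proof. by rewrite /tv2 /tv1; congr velocity; exact: scurve_eq. Qed.

Lemma ext_d_plane s (ss : @sm2 R M s) (x : V) (i : chart_idx M) : chart_dom i (s x) ->
  pd1 (fun x => w (tv2 ss x)) x - pd2 (fun x => w (tv1 ss x)) x =
  ext_d i w (tv1 ss x) (tv2 ss x).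
Proof.
move=> ix; have [F [sF [d d0 H]]] := sm2_chart ss ix.
pose F' (y : V) := F (y.2, y.1).
have sF' : csm2 F' by move=> a b sa sb; exact: sF.
have H' y : box d (x.2, x.1) y -> chart_dom i (s (y.2, y.1)) /\ F' y = chart i (s (y.2, y.1)).
  by move=> [h1 h2]; apply: H.
have bx : box d x x by exact: box_refl.
have [_ Fx] := H _ bx.
rewrite (pd1_form2 ss sF d0 H).
have -> : pd2 (fun x => w (tv1 ss x)) x = pd1 (fun x => w (tv2 (sm2_swap ss) x)) (x.2, x.1).
  by rewrite /pd1 /pd2 /=; congr (cderiv _ _); apply/funext => r; rewrite tv1_swap.
rewrite (pd1_form2 (sm2_swap ss) sF' d0 H').
have F'x : F' (x.2, x.1) = F x by rewrite /F' /= -surjective_pairing.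
have p1 y : pd1 F' y = pd2 F (y.2, y.1) by [].
have p2 y : pd2 F' y = pd1 F (y.2, y.1) by [].
have p12 : pd1 (pd2 F') (x.2, x.1) = pd2 (pd1 F) x by [].
rewrite F'x p12 p1 p2 /= -surjective_pairing (pd12C sF).
have cancel (A B C : E) : (A + C) - (B + C) = A - B by rewrite opprD addrACA subrr addr0.
rewrite cancel /ext_d tbase_tv1 -Fx.
by rewrite (tchart_tv1 ss H bx) (tchart_tv2 ss H bx).
Qed.

End forms.

Section flat_forms.
Context {R : realType} (G : lie_group R).
Notation V := (R * R)%type.
Variable M : manifold R.

Lemma perm_I2 (s : 'S_2) : s != 1%g -> s = tperm ord0 ord_max.
Proof.
have I2 (k : 'I_2) : k = ord0 \/ k = ord_max.
  by case: k => [[|[|//]] k2]; [left|right]; exact: val_inj.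
move=> s1; have s0 : s ord0 = ord_max.
  case: (I2 (s ord0)) => // s00; exfalso; move/eqP: s1; apply.
  apply/permP => k; rewrite perm1; case: (I2 k) => ->; first exact: s00.
  case: (I2 (s ord_max)) => // sm; have := perm_inj (etrans sm (esym s00)).
  by [].
apply/permP => k; case: (I2 k) => ->; rewrite ?tpermL ?tpermR //.
case: (I2 (s ord_max)) => // sm; have := perm_inj (etrans sm (esym s0)).
by [].
Qed.

Lemma sum_perm2 (W : zmodType) (F : 'S_2 -> W) :
  \sum_(s : 'S_2) F s = F 1%g + F (tperm ord0 ord_max).
Proof.
rewrite (bigD1 (1%g : 'S_2)) //= (bigD1 (tperm (ord0 : 'I_2) ord_max)) /=.
  by rewrite big1 ?addr0 // => s /andP[/perm_I2 ->]; rewrite eqxx.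
apply/eqP => /permP /(_ ord0); rewrite tpermL perm1.
by [].
Qed.

(** The two permutations contribute [xi z1, xi z2] - [xi z2, xi z1], twice the bracket, and the
    factorials are 1. *)
Lemma wedge_bracket11 (xi : tangent M -> Lie G) z1 z2 :
  2^-1 *: wedge_bracket (@lie_bracket R G) (fun z : 'I_1 -> tangent M => xi (z ord0))
    (fun z : 'I_1 -> tangent M => xi (z ord0))
    (fun a : 'I_(1 + 1) => if a == ord0 then z1 else z2) =
  lie_bracket (xi z1) (xi z2).
Proof.
rewrite /wedge_bracket (sum_perm2 (fun _ => _)).
have e0 : lshift 1 (ord0 : 'I_1) = (ord0 : 'I_2) by apply: val_inj.
have e1 : rshift 1 (ord0 : 'I_1) = (ord_max : 'I_2) by apply: val_inj.
rewrite odd_perm1 odd_tperm !perm1 e0 e1 tpermL tpermR !eqxx /= !expr0 expr1 scale1r scaleN1r.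
rewrite (lie_bracketC (xi z2)) opprK invr1 scale1r.
have half (x : Lie G) : 2^-1 *: (x + x) = x :> Lie G by lmod_with R (Lie G); field.
exact: half.
Qed.

Lemma flatE (xi : tangent M -> Lie G) : flat xi <-> forall z1 z2 (i : chart_idx M),
  tbase z1 = tbase z2 -> chart_dom i (tbase z1) ->
  ext_d i xi z1 z2 = lie_bracket (xi z1) (xi z2).
Proof.
split=> [H z1 z2 i zz iz|H xi1 z1 z2 i zz iz].
  by have := H z1 z2 i zz iz; rewrite wedge_bracket11 => /eqP; rewrite subr_eq0 => /eqP.
by rewrite wedge_bracket11 (H z1 z2 i zz iz) subrr.
Qed.

Lemma flat_plane (xi : tangent M -> Lie G) s (ss : @sm2 R M s) (x : V) :
  one_form xi -> flat xi ->
  pd1 (fun x => xi (tv2 ss x)) x - pd2 (fun x => xi (tv1 ss x)) x =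
  lie_bracket (xi (tv1 ss x)) (xi (tv2 ss x)).
Proof.
move=> ox /flatE fx; have [i ix] := chart_ex (s x).
rewrite (ext_d_plane ox ss ix); apply: fx; rewrite ?tbase_tv1 ?tbase_tv2 //.
Qed.

Lemma rlog_velocity (f : smap M G) (c : scurve M) t :
  rlog_deriv f (velocity c t) = dlog (f \o c) t.
Proof. by rewrite /rlog_deriv tmap_velocity mc_velocity. Qed.

Lemma rlog_one_form (f : smap M G) : one_form (rlog_deriv f).
Proof.
split=> [x a z1 z2 z3 [b1 b2 b3 H]|z sz].
  have [i ix] := chart_ex x.
  have [c1 c2 c3 L] := tmap_lincomb f b1 b2 b3 ix (H i ix).
  have [j jx] := chart_ex (f x).
  have [_ _ _ ] := tmap_lincomb (rtrans (lg_inv (f x))) c1 c2 c3 jx (L j jx).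
  rewrite /rlog_deriv /maurer_cartan !tbase_tmap b1 b2 b3; apply.
  by rewrite /= lg_mulV; exact: unit_dom.
exact: mc_smooth (tmap_smooth f sz).
Qed.

(** Any two tangent vectors at a point are the partial velocities of a plane map, and for its image
    under [f] flatness is the Maurer-Cartan equation. *)
Lemma rlog_flat (f : smap M G) : flat (rlog_deriv f).
Proof.
apply/flatE => z1 z2 i zz iz.
have [s [ss [s0 [e1 e2]]]] : exists s (ss : @sm2 R M s),
    s (0, 0) = tbase z1 /\ tv1 ss (0, 0) = z1 /\ tv2 ss (0, 0) = z2.
  exact: plane_tangents.
have is0 : chart_dom i (s (0, 0)) by rewrite s0.
rewrite -e1 -e2 -(ext_d_plane (rlog_one_form f) ss is0).
have E1 : (fun x => rlog_deriv f (tv1 ss x)) = mc1 (sm2_comp f ss).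
  by apply/funext => x; rewrite /rlog_deriv tmap_tv1.
have E2 : (fun x => rlog_deriv f (tv2 ss x)) = mc2 (sm2_comp f ss).
  by apply/funext => x; rewrite /rlog_deriv tmap_tv2.
rewrite E1 E2 mc_equation.
by rewrite /mc1 /mc2 -tmap_tv1 -tmap_tv2.
Qed.

End flat_forms.

(** * Local solutions *)

Section star_neighbourhoods.
Context {R : realType} {M : manifold R}.
Notation V := (R * R)%type.
Implicit Types (x z : M) (i : chart_idx M).

Lemma chart_cinf_open i (U : set (model i)) : cinf_open U ->
  curve_open [set z | chart_dom i z /\ U (chart i z)].
Proof.
move=> oU c sc; rewrite openE => t [it Ut]; rewrite /interior.
have [g [sg ig cg gc]] := chart_rep sc it.
have Ug : \forall s \near t, U (g s).
  by apply: open_nbhs_nbhs; split; [exact: oU | rewrite /= (nbhs_singleton gc)].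
apply: filterS2 Ug cg => s Us /= ->; split; first exact: chart_img_dom.
by rewrite chart_invK.
Qed.

(** For a curve [c], the points (s, t) with y0 + t (c(s) - y0) in [U] form an open set of the plane;
    if it contains the segment {s0} x [0, 1], then by [cousin] it contains a strip around that
    segment. *)
Lemma star_open (E : htvs R) (U : set E) (y0 : E) : cinf_open U ->
  cinf_open [set y | forall t : R, 0 <= t -> t <= 1 -> U (y0 + t *: (y - y0))].
Proof.
move=> oU c sc; apply/openP => s0 H0.
pose W := [set p : V | U (y0 + p.2 *: (c p.1 - y0))].
have oW (a b : R -> R^o) : csmooth a -> csmooth b -> open [set t | W (a t, b t)].
  move=> sa sb; apply: (oU (fun t => y0 + b t *: (c (a t) - y0))).
  apply: csmoothD (csmooth_cst _) _; apply: csmoothZ => //.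
  by apply: csmoothB (csmooth_cst _); exact: csmooth_comp.
pose P (x y : R) := exists2 d : R, 0 < d & forall s, `|s - s0| < d ->
  forall t, x <= t -> t <= y -> W (s, t).
have [||d d0 H] := @cousin R 0 1 P ler01.
- move=> x y z _ xy yz _ [d d0 H] [d' d'0 H']; exists (Num.min d d').
    by rewrite lt_min d0.
  move=> s; rewrite lt_min => /andP[sd sd'] t xt tz; case: (lerP t y) => ty.
    exact: H.
  by apply: H' => //; exact: ltW.
- move=> t t0 t1; have [d d0 H] := cinf_open_plane oW (x := (s0, t)) (H0 t t0 t1).
  exists d => // x y _ xt ty _ dx dy; exists d => // s sd r xr ry; apply: H; split=> //=.
  by rewrite ltr_distl (lt_le_trans dx xr) (le_lt_trans ry dy).
by exists d => // s sd t t0 t1; exact: (H s sd t t0 t1).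
Qed.

(* [W] is star-shaped with centre [x] in some chart, with rays [rho z] that are
   constant outside [0, 1] *)
Definition star_at x (W : set M) (rho : M -> R -> M) :=
  [/\ curve_open W, W x &
   [/\ forall z, rho z 0 = x, forall z, W z -> rho z 1 = z,
       forall r, rho x r = x, forall z r, W z -> W (rho z r) &
       forall c, smooth_curve c -> (forall t, W (c t)) ->
         @sm2 R M (fun p => rho (c p.1) p.2)]].

Lemma star_ex x (O : set M) : curve_open O -> O x ->
  exists W rho, star_at x W rho /\ W `<=` O.
Proof.
move=> oO Ox; have [i ix] := chart_ex x; pose y0 := chart i x.
pose U := [set y : model i | chart_img y /\ O (chart_inv i y)].
have oU : cinf_open U by exact: chart_curve_open.
pose S := [set y : model i | forall t : R, 0 <= t -> t <= 1 -> U (y0 + t *: (y - y0))].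
have Uy0 : U y0 by split; [exact: chart_img_chart | rewrite /y0 chartK].
have SU y : S y -> U y.
  by move=> /(_ 1 ler01 (lexx 1)); rewrite scale1r addrCA subrr addr0.
have Sray y r : S y -> S (y0 + step r *: (y - y0)).
  move=> Sy t t0 t1; rewrite addrAC subrr add0r scalerA; apply: Sy.
    by rewrite mulr_ge0 // step_ge0.
  by rewrite mulr_ile1 // ?step_ge0 ?step_le1.
have W_S z : chart_dom i z /\ S (chart i z) -> U (chart i z) by move=> [_ /SU].
exists [set z | chart_dom i z /\ S (chart i z)].
(* The factor [step r] lies in [0, 1] for every real [r], so the rays are smooth on the whole line,
   constant outside [0, 1] and never leave the star. *)
exists (fun z r => chart_inv i (y0 + step r *: (chart i z - y0))).
split; last by move=> z Wz; have [iz _] := Wz; have [_] := W_S _ Wz; rewrite chartK.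
split.
- by apply: chart_cinf_open; exact: star_open.
- by split=> // t _ _; rewrite subrr scaler0 addr0.
split.
- by move=> z; rewrite step_le0 // scale0r addr0 chartK.
- by move=> z [iz _]; rewrite step_ge1 // scale1r addrCA subrr addr0 chartK.
- by move=> r; rewrite subrr scaler0 addr0 chartK.
- move=> z r [iz Sz]; have Sr := Sray _ r Sz; have [ir _] := SU _ Sr.
  by split; [exact: chart_img_dom | rewrite chart_invK].
move=> c sc Wc a b sa sb; apply: chart_inv_smooth => [|t].
  apply: csmoothD (csmooth_cst _) _; apply: csmoothZ.
    by apply: csmooth_comp => //; exact: csmooth_step_fun.
  apply: csmoothB (csmooth_cst _).
  apply: (csmooth_comp (f := fun t => chart i (c t))) => //.
  by apply: smooth_curve_csmooth => // t; have [] := Wc t.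
by have [_ Sc] := Wc (a t); have [] := SU _ (Sray _ (b t) Sc).
Qed.

End star_neighbourhoods.

Section radial_solutions.
Context {R : realType} (G : lie_group R) {M : manifold R}.
Notation V := (R * R)%type.
Notation one := (lg_one G).
Notation mul := (@lg_mul R G).
Notation inv := (@lg_inv R G).

(* junk unless [c] is smooth *)
Definition vel (c : R -> M) (t : R) : tangent M :=
  if pselect (smooth_curve c) is left H then velocity (Scurve H) t
  else \pi_(tangent M) (scst (c t)).

Lemma velE (c : R -> M) (sc : smooth_curve c) t : vel c t = velocity (Scurve sc) t.
Proof. by rewrite /vel; case: pselect => // H; congr velocity; exact: scurve_eq. Qed.

Variable ev : (R -> Lie G) -> G.
Hypothesis evP : forall X : R -> Lie G, csmooth X -> exists g : R -> G,
     [/\ smooth_curve g, g 0 = one, forall t, dlog g t = X t & ev X = g 1].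
Hypothesis evs : forall X : V -> Lie G, csm2 X -> smooth_curve (fun s => ev (fun t => X (s, t))).

Definition radial (rho : M -> R -> M) (xi : tangent M -> Lie G) (z : M) : G :=
  ev (fun t => xi (vel (rho z) t)).

Variables (x : M) (W : set M) (rho : M -> R -> M).
Hypothesis stW : star_at x W rho.

(** Form and endpoint vary jointly: the forms along the rays make up one smooth plane map, to which
    [evs] applies. With a constant family this gives the smoothness of the local solution itself. *)
Lemma radial_smooth (c : R -> flat_form G M) (r : R -> R^o) (z : R -> M) :
  Omega_curves c -> csmooth r -> smooth_curve z -> (forall t, W (z t)) ->
  smooth_curve (fun s => radial rho (c (r s)) (z s)).
Proof.
move=> oc sr sz Wz; have [_ _ [_ _ _ _ /(_ z sz Wz) ss]] := stW.
pose X (p : V) := c (r p.1) (tv2 ss p).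
have sX : csm2 X.
  move=> a b sa sb; apply: (oc (fun t => r (a t))); first exact: csmooth_comp.
  exact: tv2_smooth.
have := evs sX; rewrite (_ : (fun s => _) = fun s => radial rho (c (r s)) (z s)) //.
apply/funext => s; rewrite /radial; congr ev; apply/funext => t.
by rewrite /X /= (velE (sm2_snd s ss)).
Qed.

Variable xi : tangent M -> Lie G.
Hypotheses (oxi : one_form xi) (fxi : flat xi).

Lemma radial_centre : radial rho xi x = one.
Proof.
have [_ Wx [_ _ rx _ rs]] := stW.
have sx : smooth_curve (rho x).
  by rewrite (_ : rho x = fun=> x) ?[_ x]funeqE; [exact: smooth_curve_cst | apply/funext].
have X0 : (fun t => xi (vel (rho x) t)) = fun=> 0.
  apply/funext => t; rewrite (velE sx) /velocity; apply: form_zero => // s /=.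
  by rewrite !rx.
have [g [sg g0 gd gE]] := evP (csmooth_cst (0 : Lie G)).
by rewrite /radial X0 gE (dlog0_cst sg gd 1 0) g0.
Qed.

(* Y = delta^r g(d/ds) - xi(d/ds) satisfies dY/dt = [X, Y] along each ray, by
   the Maurer-Cartan equation for [g] and the flatness of [xi]; as dg/dt = X g,
   this means that Ad(g^-1) Y is constant, hence 0. *)
Lemma radial_dlog (z : scurve M) s : (forall t, W (z t)) ->
  dlog (fun s => radial rho xi (z s)) s = xi (velocity z s).
Proof.
move=> Wz; have [_ _ [r0 r1 _ _ /(_ z (sc_smooth z) Wz) ss]] := stW.
pose X (p : V) := xi (tv2 ss p); have sX : csm2 X by exact: csm2_form2.
have [g0 gd g1] := evplane_spec evP sX; have sg := evplane_sm2 evs sX.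
set g := evplane ev X in g0 gd g1 sg.
have m2 : mc2 sg = X by apply/funext => -[q t]; rewrite mc2E gd.
pose Y (p : V) := mc1 sg p - xi (tv1 ss p).
have sY1 : csm2 (mc1 sg) by exact: csm2_mc1.
have sY2 : csm2 (fun p => xi (tv1 ss p)) by exact: csm2_form1.
have sY : csm2 Y by move=> a b sa sb; apply: csmoothB; [exact: sY1 | exact: sY2].
have dY t : der (fun t => Y (s, t)) t (lie_bracket (X (s, t)) (Y (s, t))).
  have := derB (pd2_der s t sY1) (pd2_der s t sY2).
  have e1 := mc_equation sg (s, t); have e2 := flat_plane ss (s, t) oxi fxi.
  rewrite m2 in e1; rewrite -/X in e2.
  have -> : pd2 (mc1 sg) (s, t) = pd1 X (s, t) - lie_bracket (mc1 sg (s, t)) (X (s, t)).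
    by rewrite -e1 opprB addrC subrK.
  have -> : pd2 (fun p => xi (tv1 ss p)) (s, t) =
      pd1 X (s, t) - lie_bracket (xi (tv1 ss (s, t))) (X (s, t)).
    by rewrite -e2 opprB addrC subrK.
  rewrite [in X in _ -> X](lie_bracketC (X (s, t))) lie_bracketBl.
  have alg (A B C : Lie G) : (A - B) - (A - C) = - (B - C) by lmod_with R (Lie G); ring.
  by rewrite alg.
have Y0 : Y (s, 0) = 0.
  rewrite /Y mc1E /=; have -> : (fun r => g (r, 0)) = fun=> one by apply/funext => r; exact: g0.
  rewrite dlog_cst sub0r /tv1 /velocity form_zero ?oppr0 // => t /=.
  by rewrite !r0.
have Y1 : Y (s, 1) = 0.
  pose h t := g (s, t); have sh : smooth_curve h by exact: sm2_snd.
  have sYs : csmooth (fun t => Y (s, t)) by exact: csm2_snd.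
  pose Z t := Ad (inv (h t)) (Y (s, t)).
  have sZ : csmooth Z by apply: Ad_smooth => //; exact: inv_smooth.
  have YZ t : Y (s, t) = Ad (h t) (Z t) by rewrite /Z -Ad_mul lg_mulV Ad1.
  have dZ t : der Z t 0.
    have := Ad_der_mul t sh sZ; rewrite gd -YZ => d1.
    have d2 := dY t; have e : (fun t => Y (s, t)) = fun t => Ad (h t) (Z t) by apply/funext.
    rewrite e in d2; have := der_uniq d1 d2 => /eqP.
    rewrite -subr_eq0 addrAC subrr add0r => /eqP AZ.
    have := csmooth_der t sZ.
    by rewrite -[cderiv Z t]Ad1 -(lg_Vmul (h t)) Ad_mul AZ Ad0.
  rewrite YZ (der0_cst (fun t _ _ => dZ t) (s := 1) (t := 0) (a := 0) (b := 1)) ?ler01 ?lexx //.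
  by rewrite /Z Y0 !Ad0.
move: Y1; rewrite /Y mc1E /= => /eqP; rewrite subr_eq0 => /eqP.
have -> : (fun r => g (r, 1)) = fun r => radial rho xi (z r).
  apply/funext => r; rewrite g1 /radial; congr ev; apply/funext => t.
  by rewrite /X (velE (sm2_snd r ss)).
move=> ->; congr xi; rewrite /tv1; congr velocity; apply: scurve_eq; apply/funext => r /=.
by rewrite r1.
Qed.

End radial_solutions.

(** * Development along paths *)

Section natural_topology_of_curves.
Context {R : realType} {M : manifold R}.
Implicit Types (g : R -> M) (W : set M).

Lemma curve_openI W W' : curve_open W -> curve_open W' -> curve_open (W `&` W').
Proof. by move=> oW oW' c sc; rewrite preimage_setI; apply: openI; [exact: oW | exact: oW']. Qed.

Lemma curve_openT : curve_open (setT : set M).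
Proof. by move=> c sc; rewrite preimage_setT; exact: openT. Qed.

(** Connects the topology in [simply_connected] with the sets tested on smooth curves, which alone
    are used in the integration. *)
Lemma natural_openP W : @natural_open R M (matlas M) W <-> curve_open W.
Proof.
have imgE i : [set y | @chart_img R M i y /\ W (chart_inv i y)] =
    achart (matlas M) i @` (adom (matlas M) i `&` W).
  apply/seteqP; split=> y /=.
    move=> [iy Wy]; exists (chart_inv i y); first by split=> //; exact: chart_img_dom.
    exact: chart_invK.
  move=> [z [iz Wz] <-]; split; first exact: chart_img_chart.
  by rewrite [chart_inv _ _]chartK.
split=> [nW c sc|oW i]; last by rewrite -imgE; exact: chart_curve_open.
apply/openP => t Wt; have [i it] := chart_ex (c t).
have oi : curve_open [set z | chart_dom i z /\ (chart_img (chart i z) /\ W (chart_inv i (chart i z)))].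
  apply: (@chart_cinf_open R M i [set y | chart_img y /\ W (chart_inv i y)]).
  by rewrite imgE; exact: nW.
have /openP /(_ t) [|d d0 H] := oi c sc.
  by split=> //; split; [exact: chart_img_chart | rewrite chartK].
by exists d => // s /H [is_ [_]]; rewrite chartK.
Qed.

(* continuous paths [a, b] -> M for the topology with open sets [curve_open] *)
Definition cpath (a b : R) g := forall t, a <= t -> t <= b ->
  forall W, curve_open W -> W (g t) ->
  exists2 d : R, 0 < d & forall s, a <= s -> s <= b -> `|s - t| < d -> W (g s).

Definition csquare (H : R * R -> M) := forall s t, 0 <= s <= 1 -> 0 <= t <= 1 ->
  forall W, curve_open W -> W (H (s, t)) ->
  exists2 d : R, 0 < d & forall s' t', 0 <= s' <= 1 -> 0 <= t' <= 1 ->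
    `|s' - s| < d -> `|t' - t| < d -> W (H (s', t')).

Lemma cpathP (g : R -> mtop M) :
  {within [set` `[(0 : R), 1]], continuous g} <-> cpath 0 1 g.
Proof.
apply: (iff_trans (subspace_continuousP _ _)); split=> [H t t0 t1 W oW Wt|H t].
  have tI : [set` `[(0 : R), 1]] t by rewrite /= in_itv /= t0.
  have nW : nbhs (g t : mtop M) W.
    by apply: open_nbhs_nbhs; split => //; exact/natural_openP.
  have /nearP [d d0 Hd] := H t tI W nW; exists d => // s s0 s1 sd.
  by rewrite -(subrKC t s); apply: (Hd _ sd); rewrite subrKC /= in_itv /= s0.
rewrite /= in_itv /= => /andP[t0 t1] O; rewrite nbhsE => -[W [/natural_openP oW Wt] WO].
have [d d0 Hd] := H t t0 t1 W oW Wt; apply/nearP; exists d => // h hd.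
rewrite /= in_itv /= => /andP[h0 h1]; apply: WO; apply: Hd => //.
by rewrite addrAC subrr add0r.
Qed.

Lemma csquareP (H : R * R -> mtop M) :
  {within [set` `[(0 : R), 1]] `*` [set` `[(0 : R), 1]], continuous H} -> csquare H.
Proof.
move=> /subspace_continuousP cH s t sI tI W oW Wst.
have st : ([set` `[(0 : R), 1]] `*` [set` `[(0 : R), 1]]) (s, t).
  by split; rewrite /= in_itv.
have nW : nbhs (H (s, t) : mtop M) W.
  by apply: open_nbhs_nbhs; split => //; exact/natural_openP.
have [[A B] [/= /nbhs_ballP[d1 d10 A1] /nbhs_ballP[d2 d20 B2]] AB] := cH _ st W nW.
exists (Num.min d1 d2); first by rewrite lt_min d10.
move=> s' t' s'I t'I; rewrite !lt_min => /andP[ds _] /andP[_ dt].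
apply: (AB (s', t')); last by split; rewrite /= in_itv.
split; [apply: A1 | apply: B2]; by rewrite /ball /= distrC.
Qed.

Lemma smooth_cpath (c : R -> M) a b : smooth_curve c -> cpath a b c.
Proof.
move=> sc t _ _ W oW Wt; have /openP /(_ t Wt) [d d0 H] := oW c sc.
by exists d => // s _ _; exact: H.
Qed.

Lemma cpath_sub a b a' b' g : a <= a' -> b' <= b -> cpath a b g -> cpath a' b' g.
Proof.
move=> aa bb cg t at_ tb W oW Wt.
have [d d0 H] := cg t (le_trans aa at_) (le_trans tb bb) W oW Wt.
by exists d => // s as_ sb; apply: H; [exact: le_trans as_ | exact: le_trans bb].
Qed.

Definition cat_path g g' (t : R) := if t <= 2^-1 then g (2 * t) else g' (2 * t - 1).

Lemma cat_pathl g g' t : t <= 2^-1 -> cat_path g g' t = g (2 * t).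
Proof. by rewrite /cat_path => ->. Qed.

Lemma cat_pathr g g' t : g 1 = g' 0 -> 2^-1 <= t -> cat_path g g' t = g' (2 * t - 1).
Proof.
rewrite /cat_path; case: ltgtP => // <- gg _.
by rewrite divff ?pnatr_eq0 // subrr.
Qed.

Lemma cpath_rev g : cpath 0 1 g -> cpath 0 1 (fun t => g (1 - t)).
Proof.
move=> cg t t0 t1 W oW Wt; have [||d d0 H] := cg (1 - t) _ _ W oW Wt; [lra|lra|].
exists d => // s s0 s1 sd; apply: H; [lra|lra|].
by rewrite opprB addrC addrA subrK distrC.
Qed.

Lemma cpath_cat g g' : g 1 = g' 0 -> cpath 0 1 g -> cpath 0 1 g' ->
  cpath 0 1 (cat_path g g').
Proof.
move=> gg cg cg' t t0 t1 W oW Wt.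
have [d d0 Hd] : exists2 d : R, 0 < d & forall s, 0 <= s -> s <= 2^-1 -> `|s - t| < d ->
    W (cat_path g g' s).
  have [t2|t2] := lerP t 2^-1; last first.
    exists (t - 2^-1); first by rewrite subr_gt0.
    by move=> s _ s2; rewrite ltr_distl => /andP[]; lra.
  rewrite cat_pathl // in Wt; have [||d d0 H] := cg (2 * t) _ _ W oW Wt; [lra|lra|].
  exists (d / 2) => [|s s0 s2 sd]; first by rewrite divr_gt0.
  rewrite cat_pathl //; apply: H; [lra|lra|].
  by rewrite -mulrBr normrM gtr0_norm // mulrC -ltr_pdivlMr.
have [d' d'0 Hd'] : exists2 d : R, 0 < d & forall s, 2^-1 <= s -> s <= 1 -> `|s - t| < d ->
    W (cat_path g g' s).
  have [t2|t2] := lerP 2^-1 t; last first.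
    exists (2^-1 - t); first by rewrite subr_gt0.
    by move=> s s2 _; rewrite ltr_distl => /andP[]; lra.
  rewrite cat_pathr // in Wt; have [||e e0 H] := cg' (2 * t - 1) _ _ W oW Wt; [lra|lra|].
  exists (e / 2) => [|s s0 s2 sd]; first by rewrite divr_gt0.
  rewrite cat_pathr //; apply: H; [lra|lra|].
  rewrite (_ : _ - _ = 2 * (s - t)); last by ring.
  by rewrite normrM gtr0_norm // mulrC -ltr_pdivlMr.
exists (Num.min d d') => [|s s0 s1]; first by rewrite lt_min d0.
rewrite lt_min => /andP[sd sd']; have [s2|s2] := lerP s 2^-1; first exact: Hd.
by apply: Hd' => //; exact: ltW.
Qed.

End natural_topology_of_curves.

Section development.
Context {R : realType} (G : lie_group R) {M : manifold R}.
Notation one := (lg_one G).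
Notation mul := (@lg_mul R G).
Notation inv := (@lg_inv R G).
Implicit Types (W : set M) (f : M -> G) (g : R -> M) (u : R -> G).

(** The increment from b to a. It is invariant under right multiplication of both arguments, so
    increments of local solutions do not depend on their constants of integration. *)
Definition gdiv (a b : G) : G := mul a (inv b).

Lemma gdivM (a b c : G) : mul (gdiv a b) (gdiv b c) = gdiv a c.
Proof. by rewrite /gdiv lg_mulA lg_mulKV. Qed.

Lemma gdivV (a b : G) : inv (gdiv a b) = gdiv b a.
Proof. by rewrite /gdiv lg_invM lg_invK. Qed.

Lemma gdivR (a b c : G) : gdiv (mul a c) (mul b c) = gdiv a b.
Proof. by rewrite /gdiv lg_invM lg_mulA lg_mulK. Qed.

Lemma gdivaa (a : G) : gdiv a a = one. Proof. exact: lg_mulV. Qed.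

Lemma gdivK (a b : G) : mul (gdiv a b) b = a. Proof. exact: lg_mulKV. Qed.

Lemma gdiv_eq (a b c a' b' c' : G) : gdiv a c = gdiv a' c' -> gdiv b c = gdiv b' c' ->
  gdiv a b = gdiv a' b'.
Proof. by move=> ac bc; rewrite -(gdivM a c b) -(gdivV b c) ac bc gdivV gdivM. Qed.

Definition sol W (xi : tangent M -> Lie G) f := forall c : scurve M, (forall t, W (c t)) ->
  smooth_curve (f \o c) /\ forall s, dlog (f \o c) s = xi (velocity c s).

Definition solvable xi := forall x (O : set M), curve_open O -> O x ->
  exists W rho f, [/\ star_at x W rho, W `<=` O & sol W xi f].

Variable xi : tangent M -> Lie G.

Lemma sol_sub W W' f : W' `<=` W -> sol W xi f -> sol W' xi f.
Proof. by move=> WW sf c Wc; apply: sf => t; exact: WW. Qed.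

Lemma star_uniq x W rho f f' : star_at x W rho -> sol W xi f -> sol W xi f' ->
  forall z, W z -> gdiv (f z) (f x) = gdiv (f' z) (f' x).
Proof.
move=> [_ Wx [r0 r1 _ rW rs]] sf sf' z Wz.
have sz : smooth_curve (rho z).
  exact: (sm2_snd 0 (rs (fun=> z) (smooth_curve_cst z) (fun=> Wz))).
have [s1 d1] := sf (Scurve sz) (fun r => rW z r Wz).
have [s2 d2] := sf' (Scurve sz) (fun r => rW z r Wz).
have := dlog_eq s1 s2 (fun t => etrans (d1 t) (esym (d2 t))) 1.
by rewrite /= r0 r1 // => ->; rewrite /gdiv !lg_mulA lg_mulK.
Qed.

(** Two solutions have equal increments on a small star inside both domains, where rays are smooth
    curves. A continuous path is covered by such stars and increments multiply, so no
    differentiation along the path is involved. *)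
Lemma sol_path a b g W W' f f' : a <= b -> cpath a b g -> curve_open W -> curve_open W' ->
  (forall s, a <= s -> s <= b -> W (g s)) -> (forall s, a <= s -> s <= b -> W' (g s)) ->
  sol W xi f -> sol W' xi f' ->
  gdiv (f (g b)) (f (g a)) = gdiv (f' (g b)) (f' (g a)).
Proof.
move=> ab cg oW oW' Wg Wg' sf sf'.
apply: (cousin (P := fun x y => gdiv (f (g y)) (f (g x)) = gdiv (f' (g y)) (f' (g x))) ab).
  by move=> x y z _ _ _ _ e1 e2; rewrite -(gdivM _ (f (g y))) e1 e2 gdivM.
move=> t at_ tb; have [S [rho [stS SW]]] : exists S rho, star_at (g t) S rho /\ S `<=` W `&` W'.
  by apply: star_ex; [exact: curve_openI | split; [exact: Wg | exact: Wg']].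
have [oS St _] := stS; have [d d0 H] := cg t at_ tb S oS St; exists d => // x y ax xt ty yb dx dy.
have SE z : a <= z -> z <= b -> `|z - t| < d ->
    gdiv (f (g z)) (f (g t)) = gdiv (f' (g z)) (f' (g t)).
  move=> az zb zd; apply: (star_uniq stS); last exact: H.
    by apply: sol_sub sf => w /SW [].
  by apply: sol_sub sf' => w /SW [].
have xd : `|x - t| < d by rewrite ltr_distl dx; lra.
have yd : `|y - t| < d by rewrite ltr_distl dy andbT; lra.
by apply: gdiv_eq (SE y _ _ yd) (SE x _ _ xd); lra.
Qed.

(* [u] develops [g]: it varies like any local solution along [g] *)
Definition lift (a b : R) g u := forall x y, a <= x -> x <= y -> y <= b ->
  forall W f, curve_open W -> sol W xi f -> (forall s, x <= s -> s <= y -> W (g s)) ->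
  gdiv (u y) (u x) = gdiv (f (g y)) (f (g x)).

Lemma lift_ext a b g g' u : (forall s, a <= s -> s <= b -> g s = g' s) ->
  lift a b g u -> lift a b g' u.
Proof.
move=> gg lu x y ax xy yb W f oW sf Wg.
rewrite -!gg ?(le_trans ax xy) ?(le_trans xy yb) //; apply: (lu x y ax xy yb W) => //.
by move=> s xs sy; rewrite gg ?(le_trans ax xs) ?(le_trans sy yb) //; exact: Wg.
Qed.

Lemma lift_glue a m b g u u' : lift a m g u -> lift m b g u' ->
  exists u, lift a b g u.
Proof.
(* Both pieces are normalized to the unit at the junction [m]; right multiplication does not affect
   increments. *)
move=> lu lu'; exists (fun s => if s <= m then gdiv (u s) (u m) else gdiv (u' s) (u' m)).
move=> x y ax xy yb W f oW sf Wg; case: (lerP y m) => ym.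
  by rewrite (le_trans xy ym) gdivR; apply: (lu x y ax xy ym W).
case: (lerP x m) => xm; last by rewrite gdivR; apply: (lu' x y (ltW xm) xy yb W).
rewrite {1}/gdiv gdivV.
rewrite (lu' m y (lexx m) (ltW ym) yb W f oW sf) => [|s ms sy]; last first.
  by apply: Wg => //; exact: le_trans ms.
rewrite (lu x m ax xm (lexx m) W f oW sf) ?gdivM // => s xs sm.
by apply: Wg => //; exact: le_trans (ltW ym).
Qed.

Lemma lift_uniq a b g u u' : a <= b -> solvable xi -> cpath a b g ->
  lift a b g u -> lift a b g u' -> gdiv (u b) (u a) = gdiv (u' b) (u' a).
Proof.
move=> ab sv cg lu lu'.
apply: (cousin (P := fun x y => gdiv (u y) (u x) = gdiv (u' y) (u' x)) ab).
  by move=> x y z _ _ _ _ e1 e2; rewrite -(gdivM _ (u y)) e1 e2 gdivM.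
move=> t at_ tb; have [W [rho [f [[oW Wt _] _ sf]]]] := sv (g t) setT curve_openT I.
have [d d0 H] := cg t at_ tb W oW Wt; exists d => // x y ax xt ty yb dx dy.
have Wg s : x <= s -> s <= y -> W (g s).
  by move=> xs sy; apply: H; [lra|lra|rewrite ltr_distl; lra].
have xy := le_trans xt ty.
by rewrite (lu x y ax xy yb W f oW sf Wg) (lu' x y ax xy yb W f oW sf Wg).
Qed.

Lemma lift_ex a b g : a <= b -> solvable xi -> cpath a b g -> exists u, lift a b g u.
Proof.
move=> ab sv cg; apply: (cousin (P := fun x y => exists u, lift x y g u) ab).
  by move=> x y z _ _ _ _ [u lu] [u' lu']; exact: lift_glue lu lu'.
move=> t at_ tb; have [W [rho [f [[oW Wt _] _ sf]]]] := sv (g t) setT curve_openT I.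
have [d d0 H] := cg t at_ tb W oW Wt; exists d => // x y ax xt ty yb dx dy.
exists (f \o g) => p q xp pq qy W' f' oW' sf' Wg'.
apply: (sol_path pq _ oW oW' _ Wg' sf sf').
  by apply: cpath_sub cg; lra.
by move=> s ps sq; apply: H; [lra|lra|rewrite ltr_distl; lra].
Qed.

Lemma lift_sub a b a' b' g u : a <= a' -> b' <= b -> lift a b g u -> lift a' b' g u.
Proof. by move=> aa bb lu x y ax xy yb; apply: lu; lra. Qed.

Lemma lift_affine a b (k c : R) g u : 0 < k -> lift (k * a + c) (k * b + c) g u ->
  lift a b (fun t => g (k * t + c)) (fun t => u (k * t + c)).
Proof.
move=> k0 lu x y ax xy yb W f oW sf Wg.
apply: (lu _ _ _ _ _ W f oW sf); rewrite ?lerD2r ?ler_pM2l //.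
move=> s xs sy; have -> : s = k * ((s - c) / k) + c by field; rewrite gt_eqF.
by apply: Wg; [rewrite ler_pdivlMr // | rewrite ler_pdivrMr //]; rewrite mulrC; lra.
Qed.

Lemma lift_rev g u : lift 0 1 g u -> lift 0 1 (fun t => g (1 - t)) (fun t => u (1 - t)).
Proof.
move=> lu x y ax xy yb W f oW sf Wg.
rewrite -gdivV -[RHS]gdivV; congr inv; apply: (lu _ _ _ _ _ W f oW sf); [lra|lra|lra|].
by move=> s xs sy; rewrite -(subKr 1 s); apply: Wg; lra.
Qed.

Lemma lift_cst a b g u : a <= b -> solvable xi -> (forall t, a <= t -> t <= b -> g t = g a) ->
  lift a b g u -> gdiv (u b) (u a) = one.
Proof.
move=> ab sv gc lu; have [W [rho [f [[oW Wt _] _ sf]]]] := sv (g a) setT curve_openT I.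
rewrite (lu a b (lexx a) ab (lexx b) W f oW sf); first by rewrite (gc b) // gdivaa.
by move=> s as_ sb; rewrite gc.
Qed.

Definition transport g (a : G) := exists2 u, lift 0 1 g u & gdiv (u 1) (u 0) = a.

Hypothesis sv : solvable xi.

Lemma transport_ex g : cpath 0 1 g -> exists a, transport g a.
Proof. by move=> /(lift_ex ler01 sv) [u lu]; exists (gdiv (u 1) (u 0)), u. Qed.

Lemma transport_uniq g a a' : cpath 0 1 g -> transport g a -> transport g a' -> a = a'.
Proof. by move=> cg [u lu <-] [u' lu' <-]; exact: lift_uniq ler01 sv cg lu lu'. Qed.

Lemma transport_rev g a : transport g a -> transport (fun t => g (1 - t)) (inv a).
Proof.
move=> [u lu <-]; exists (fun t => u (1 - t)); first exact: lift_rev.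
by rewrite subrr subr0 gdivV.
Qed.

(** A lift of the concatenated path, restricted to each half and reparametrized, is a lift of that
    piece; uniqueness of transport identifies the two increments. *)
Lemma transport_cat g g' a a' : g 1 = g' 0 -> cpath 0 1 g -> cpath 0 1 g' ->
  transport g a -> transport g' a' -> transport (cat_path g g') (mul a' a).
Proof.
move=> gg cg cg' ta ta'; have ck := cpath_cat gg cg cg'.
have [w lw] := lift_ex ler01 sv ck; exists w => //; rewrite -(gdivM _ (w 2^-1)).
have i2 : 2 * 2^-1 = 1 :> R by rewrite divff // pnatr_eq0.
congr mul.
  have t2 : transport g' (gdiv (w 1) (w 2^-1)).
    exists (fun t => w (2^-1 * t + 2^-1)); last by congr gdiv; congr w; lra.
    apply: (@lift_ext 0 1 (fun t => cat_path g g' (2^-1 * t + 2^-1))).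
      by move=> s s0 s1; rewrite cat_pathr //; [congr g'; lra | lra].
    by apply: lift_affine; [lra | apply: lift_sub lw; lra].
  exact: transport_uniq cg' t2 ta'.
have t1 : transport g (gdiv (w 2^-1) (w 0)).
  exists (fun t => w (2^-1 * t + 0)); last by congr gdiv; congr w; lra.
  apply: (@lift_ext 0 1 (fun t => cat_path g g' (2^-1 * t + 0))).
    by move=> s s0 s1; rewrite cat_pathl //; [congr g; lra | lra].
  by apply: lift_affine; [lra | apply: lift_sub lw; lra].
exact: transport_uniq cg t1 ta.
Qed.

(** Transport around two adjacent sides of a rectangle equals transport around the other two. The
    relation is additive under cutting in either direction, so [cousin] in each variable reduces it
    to small rectangles, where both sides are the increment of one local solution between opposite
    corners. The lifts on different lines are chosen independently. *)
Lemma transport_square (H : R * R -> M) (U V : R -> R -> G) : csquare H ->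
  (forall s, 0 <= s <= 1 -> lift 0 1 (fun t => H (s, t)) (U s)) ->
  (forall t, 0 <= t <= 1 -> lift 0 1 (fun s => H (s, t)) (V t)) ->
  mul (gdiv (V 1 1) (V 1 0)) (gdiv (U 0 1) (U 0 0)) =
  mul (gdiv (U 1 1) (U 1 0)) (gdiv (V 0 1) (V 0 0)).
Proof.
move=> cH lU lV.
pose Q s s' t t' := mul (gdiv (V t' s') (V t' s)) (gdiv (U s t') (U s t)) =
  mul (gdiv (U s' t') (U s' t)) (gdiv (V t s') (V t s)).
suff : Q 0 1 0 1 by [].
apply: (cousin (P := fun s s' => Q s s' 0 1) ler01).
  move=> s s' s'' _ _ _ _ e1 e2; rewrite /Q -(gdivM _ (V 1 s')) -lg_mulA e1 lg_mulA e2.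
  by rewrite -lg_mulA gdivM.
move=> s s0 s1.
have [||d d0 Hd] := @cousin R 0 1 (fun t t' => exists2 d : R, 0 < d & forall p q,
    0 <= p -> p <= s -> s <= q -> q <= 1 -> s - d < p -> q < s + d -> Q p q t t') ler01.
- move=> x y z _ _ _ _ [d d0 e1] [d' d'0 e2]; exists (Num.min d d').
    by rewrite lt_min d0.
  move=> p q p0 ps sq q1; rewrite ltrBlDr -ltrBlDl lt_min => /andP[dp dp'].
  rewrite -ltrBlDl lt_min => /andP[dq dq'].
  have {}e1 : Q p q x y by apply: e1 => //; lra.
  have {}e2 : Q p q y z by apply: e2 => //; lra.
  by rewrite /Q -(gdivM (U p z) (U p y)) lg_mulA e2 -lg_mulA e1 lg_mulA gdivM.
- move=> t t0 t1; have sI : 0 <= s <= 1 by rewrite s0.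
  have tI : 0 <= t <= 1 by rewrite t0.
  have [W [rho [f [[oW Wt _] _ sf]]]] := sv (x := H (s, t)) curve_openT I.
  have [d d0 Hd] := cH s t sI tI W oW Wt; exists d => // x y x0 xt ty y1 dx dy.
  exists d => // p q p0 ps sq q1 dp dq.
  have WH a b : p <= a -> a <= q -> x <= b -> b <= y -> W (H (a, b)).
    by move=> pa aq xb by_; apply: Hd; rewrite ?ltr_distl; lra.
  have EU a : p <= a -> a <= q -> gdiv (U a y) (U a x) = gdiv (f (H (a, y))) (f (H (a, x))).
    move=> pa aq; have aI : 0 <= a <= 1 by lra.
    apply: (lU a aI x y _ _ _ W f oW sf); [lra|lra|lra|] => b xb by_; exact: WH.
  have EV b : x <= b -> b <= y -> gdiv (V b q) (V b p) = gdiv (f (H (q, b))) (f (H (p, b))).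
    move=> xb by_; have bI : 0 <= b <= 1 by lra.
    apply: (lV b bI p q _ _ _ W f oW sf); [lra|lra|lra|] => a pa aq; exact: WH.
  by rewrite /Q !EU ?EV ?gdivM //; lra.
by exists d => // p q p0 ps sq q1 dp dq; exact: Hd.
Qed.

Hypothesis scM : simply_connected M.

(** On the square of a contracting homotopy three sides are constant and have trivial transport,
    hence so has the fourth, which is [g]. *)
Lemma transport_loop g a : cpath 0 1 g -> g 0 = g 1 -> transport g a -> a = one.
Proof.
move=> cg g01 ta; have [_ /(_ g)] := scM.
case=> [|//|H [/csquareP cH H0 H1 HI]]; first exact/cpathP.
have I01 t : 0 <= t -> t <= 1 -> t \in `[(0 : R), 1] by move=> t0 t1; rewrite in_itv /= t0.
have cr s : 0 <= s <= 1 -> cpath 0 1 (fun t => H (s, t)).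
  move=> sI t t0 t1 W oW Wt; have tI : 0 <= t <= 1 by rewrite t0.
  have [d d0 Hd] := cH s t sI tI W oW Wt; exists d => // t' t'0 t'1 td.
  by apply: Hd; rewrite ?t'0 // subrr normr0.
have cc t : 0 <= t <= 1 -> cpath 0 1 (fun s => H (s, t)).
  move=> tI s s0 s1 W oW Wt; have sI : 0 <= s <= 1 by rewrite s0.
  have [d d0 Hd] := cH s t sI tI W oW Wt; exists d => // s' s'0 s'1 sd.
  by apply: Hd; rewrite ?s'0 // subrr normr0.
have [U lU] : {U : R -> R -> G & forall s, 0 <= s <= 1 -> lift 0 1 (fun t => H (s, t)) (U s)}.
  apply: (@choice _ _ (fun s u => 0 <= s <= 1 -> lift 0 1 (fun t => H (s, t)) u)) => s.
  have [/cr /(lift_ex ler01 sv) [u lu]|nI] := boolP (0 <= s <= 1); first by exists u.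
  by exists (fun=> one).
have [V lV] : {V : R -> R -> G & forall t, 0 <= t <= 1 -> lift 0 1 (fun s => H (s, t)) (V t)}.
  apply: (@choice _ _ (fun t u => 0 <= t <= 1 -> lift 0 1 (fun s => H (s, t)) u)) => t.
  have [/cc /(lift_ex ler01 sv) [u lu]|nI] := boolP (0 <= t <= 1); first by exists u.
  by exists (fun=> one).
have I0 : 0 <= (0 : R) <= 1 by rewrite lexx ler01.
have I1 : 0 <= (1 : R) <= 1 by rewrite lexx ler01.
have := transport_square cH lU lV.
rewrite (lift_cst ler01 sv _ (lU 1 I1)); last first.
  by move=> t t0 t1; rewrite !H1 // I01.
rewrite (lift_cst ler01 sv _ (lV 0 I0)); last first.
  by move=> s s0 s1; rewrite (HI s _).1 ?(HI 0 _).1 // I01.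
rewrite (lift_cst ler01 sv _ (lV 1 I1)); last first.
  by move=> s s0 s1; rewrite (HI s _).2 ?(HI 0 _).2 // I01.
rewrite !lg_1mul => e; rewrite -e; apply: transport_uniq cg ta _.
exists (U 0) => //; apply: lift_ext (lU 0 I0) => t t0 t1.
by rewrite H0 // I01.
Qed.

Lemma development x0 : exists F : M -> G, F x0 = one /\
  forall x W rho f, star_at x W rho -> sol W xi f ->
    forall z, W z -> gdiv (F z) (F x) = gdiv (f z) (f x).
Proof.
(* The value at [x] is the transport along any path from [x0]. Two paths differ by a loop, whose
   transport is trivial; appending a ray of a star shows that [F] varies like the local solution
   there. *)
pose T x a := exists g, [/\ cpath 0 1 g, g 0 = x0, g 1 = x & transport g a].
have Tuniq x a a' : T x a -> T x a' -> a = a'.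
  move=> [g [cg g0 g1 ta]] [g' [cg' g'0 g'1 ta']].
  have e : g 1 = g' (1 - 0) by rewrite subr0 g1.
  have tc := transport_cat e cg (cpath_rev cg') ta (transport_rev ta').
  have := transport_loop (cpath_cat e cg (cpath_rev cg')) _ tc.
  rewrite cat_pathl ?invr_ge0 // cat_pathr ?subr0 ?g1 //; last by lra.
  rewrite mulr0 mulr1 (_ : 1 - (2 - 1) = 0) ?g0 ?g'0; last by lra.
  move=> /(_ erefl) e'; rewrite -(lg_1mul a) -(lg_mulV a') -lg_mulA e'.
  by rewrite lg_mul1.
have [F FT] : {F : M -> G & forall x, T x (F x)}.
  apply: choice => x; have [/(_ x0 x) [g [/cpathP cg g0 g1]] _] := scM.
  by have [a ta] := transport_ex cg; exists a, g.
exists F; split=> [|x W rho f stW sf z Wz].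
  apply: (Tuniq x0 _ _ (FT x0)); exists (fun=> x0).
  have c0 : cpath 0 1 (fun=> x0) by apply: smooth_cpath; exact: smooth_curve_cst.
  split=> //; have [u lu] := lift_ex ler01 sv c0; exists u => //.
  exact: lift_cst ler01 sv _ lu.
have [g [cg g0 g1 ta]] := FT x.
have [oW _ [r0 r1 _ rW rs]] := stW.
have sz : smooth_curve (rho z).
  exact: (sm2_snd 0 (rs (fun=> z) (smooth_curve_cst z) (fun=> Wz))).
have cz : cpath 0 1 (rho z) by exact: smooth_cpath.
have [u lu] := lift_ex ler01 sv cz.
have tz : transport (rho z) (gdiv (f z) (f x)).
  exists u => //; rewrite (lu 0 1 (lexx 0) ler01 (lexx 1) W f oW sf) ?r0 ?r1 //.
  by move=> s _ _; exact: rW.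
have e : g 1 = rho z 0 by rewrite r0.
have -> : F z = mul (gdiv (f z) (f x)) (F x).
  apply: (Tuniq z _ _ (FT z)); exists (cat_path g (rho z)); split.
  - exact: cpath_cat.
  - by rewrite cat_pathl ?invr_ge0 // mulr0.
  - by rewrite cat_pathr //; [rewrite (_ : 2 * 1 - 1 = 1) ?r1 //; lra | lra].
  - exact: transport_cat.
by rewrite {1}/gdiv lg_mulK.
Qed.

End development.

(** * The evolution operator *)

Section evolution_operator.
Context {R : realType} (G : lie_group R) {M : manifold R}.
Notation V := (R * R)%type.
Notation one := (lg_one G).
Notation mul := (@lg_mul R G).
Notation inv := (@lg_inv R G).

Lemma curve_shrink (c : R -> M) (W : set M) t : smooth_curve c -> curve_open W -> W (c t) ->
  exists th : R -> R^o, [/\ csmooth th, forall s, W (c (th s)) & \forall s \near t, th s = s].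
Proof.
move=> sc oW Wt; have /openP /(_ t Wt) [d d0 Hd] := oW c sc.
have [th [sth thE thd]] := cutoff_ex t d0; exists th; split=> // [s|].
  by apply: Hd; exact: thd.
apply/nearP; exists (d / 2) => [|h hd]; first by rewrite divr_gt0.
by apply: thE; rewrite addrAC subrr add0r ltW.
Qed.

Lemma sol_mulr (W : set M) (xi : tangent M -> Lie G) f a : sol W xi f ->
  sol W xi (fun z => mul (f z) a).
Proof.
move=> sf c Wc; have [sc dc] := sf c Wc; split=> [|s]; last by rewrite [LHS]dlog_mulr dc.
exact: mul_smooth sc (smooth_curve_cst _).
Qed.

(** A curve leaves the small domains, so it is first reparametrized by [curve_shrink] to stay in one
    of them with the same germ. *)
Lemma sol_local (xi : tangent M -> Lie G) (F : M -> G) :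
  (forall x, exists W f, [/\ curve_open W, W x, sol W xi f & forall z, W z -> F z = f z]) ->
  sol setT xi F.
Proof.
move=> H c _; have loc t : exists g : R -> G,
    [/\ smooth_curve g, \forall s \near t, F (c s) = g s & dlog g t = xi (velocity c t)].
  have [W [f [oW Wt sf FE]]] := H (c t).
  have [th [sth Wth thE]] := curve_shrink (sc_smooth c) oW Wt.
  have sct := smooth_curve_comp (sc_smooth c) sth.
  have [sg dg] := sf (Scurve sct) Wth; exists (f \o (c \o th)); split=> //.
    by apply: filterS thE => s thE /=; rewrite thE FE // -thE; exact: Wth.
  rewrite [LHS]dg; congr xi; apply: velocity_near.
  by apply: filterS thE => s /= ->.
split=> [|t].
  by apply: smooth_curve_local => t; have [g [sg gE _]] := loc t; exists g.
have [g [sg gE <-]] := loc t; apply: cderiv_near.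
by rewrite -(nbhs_singleton gE); apply: filterS gE => s /= ->.
Qed.

Lemma sol_rlog (f : smap M G) : sol setT (rlog_deriv f) f.
Proof. by move=> c _; split=> [|s]; [exact: sm_smooth (sc_smooth c) | rewrite rlog_velocity]. Qed.

Lemma rlog_sol (xi : tangent M -> Lie G) (f : smap M G) : sol setT xi f -> rlog_deriv f = xi.
Proof.
move=> sf; apply/funext => z; rewrite -[z]velocity_repr rlog_velocity.
by have [] := sf (repr z) (fun=> I).
Qed.

(** Both mappings are solutions on all of [M] for the same form, so they have the same increment
    along a path from [x0]. *)
Lemma rlog_uniq (f f' : smap M G) x0 : simply_connected M ->
  rlog_deriv f = rlog_deriv f' -> f x0 = f' x0 -> f = f'.
Proof.
move=> [sc _] ff e0; apply: smap_eq; apply/funext => x.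
have [g [/cpathP cg g0 g1]] := sc x0 x.
have sf' : sol setT (rlog_deriv f) f' by rewrite ff; exact: sol_rlog.
have TT s : 0 <= s -> s <= 1 -> setT (g s) by [].
have := sol_path ler01 cg (@curve_openT R M) (@curve_openT R M) TT TT (sol_rlog f) sf'.
rewrite g0 g1 => e.
by rewrite -(gdivK (f x) (f x0)) e e0 gdivK.
Qed.

Hypothesis rG : regular G.

Lemma evolution_ex (x0 : M) : simply_connected M ->
  exists E : flat_form G M -> smap M G,
    [/\ forall xi, rlog_deriv (E xi) = xi, forall xi, E xi x0 = one &
        forall (c : R -> flat_form G M) (z : R -> M), Omega_curves c -> smooth_curve z ->
          smooth_curve (fun s => E (c s) (z s))].
Proof.
move=> scM; have [ev [evP evs]] := regular_ev rG.
have radial_sol x W rho (xi : flat_form G M) : star_at x W rho -> sol W xi (radial ev rho xi).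
  move=> stW c Wc; split=> [|s].
    have oc : Omega_curves (fun _ : R => xi) by move=> r z _ sz; exact: (ff_form xi).2.
    exact: (radial_smooth evs stW oc (@csmooth_id R) (sc_smooth c) Wc).
  exact: (radial_dlog evP evs stW (ff_form xi) (ff_flat xi)).
have sv (xi : flat_form G M) : solvable xi.
  move=> x O oO Ox; have [W [rho [stW WO]]] := star_ex oO Ox.
  by exists W, rho, (radial ev rho xi); split; [exact: stW | exact: WO | exact: (radial_sol _ _ _ xi stW)].
have [E HE] : {E : flat_form G M -> smap M G & forall xi,
    rlog_deriv (E xi) = xi /\ E xi x0 = one}.
  apply: (@choice _ _ (fun (xi : flat_form G M) (f : smap M G) =>
    rlog_deriv f = xi /\ f x0 = one)) => xi.
  have [F [F0 FE]] := development (sv xi) scM x0.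
  have sF : sol setT xi F.
    apply: sol_local => x; have [W [rho [f [stW _ sf]]]] := sv xi x setT curve_openT I.
    exists W, (fun z => mul (f z) (mul (inv (f x)) (F x))); have [oW Wx _] := stW; split=> //.
      exact: sol_mulr.
    by move=> z Wz; rewrite lg_mulA -[mul (f z) _]/(gdiv _ _) -(FE x W rho f stW sf z Wz) gdivK.
  have Fs c : smooth_curve c -> smooth_curve (F \o c).
    by move=> sc; have [] := sF (Scurve sc) (fun=> I).
  by exists (Smap Fs); split=> //; exact: rlog_sol.
exists E; split=> [xi|xi|]; [by have [] := HE xi|by have [] := HE xi|].
have EW x W rho (xi : flat_form G M) z : star_at x W rho -> W z ->
    E xi z = mul (radial ev rho xi z) (E xi x).
  move=> stW Wz; have sE : sol W xi (E xi).
    by have := @sol_rlog (E xi); rewrite (HE xi).1; apply: sol_sub.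
  have := star_uniq stW sE (radial_sol _ _ _ xi stW) Wz.
  rewrite (radial_centre evP stW (ff_form xi)) => e.
  by rewrite -(gdivK (E xi z) (E xi x)) e /gdiv lg_inv1 lg_mul1.
(* Smooth dependence on the form at a fixed point. By [EW] it spreads between the centre and every
   point of a star, it is trivial at [x0], and [cousin] carries it along a path. The
   reparametrization [r] is included because localizing in time replaces [c] by its composite with a
   cutoff. *)
pose A x := forall (c : R -> flat_form G M) (r : R -> R^o), Omega_curves c -> csmooth r ->
  smooth_curve (fun s => E (c (r s)) x).
have AW x W rho z : star_at x W rho -> W z -> (A x <-> A z).
  move=> stW Wz; have sr (c : R -> flat_form G M) (r : R -> R^o) : Omega_curves c -> csmooth r ->
      smooth_curve (fun s => radial ev rho (c (r s)) z).
    move=> oc sc; exact: (radial_smooth evs stW oc sc (smooth_curve_cst z) (fun=> Wz)).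
  split=> [Ax|Az] c r oc sc.
    have -> : (fun s => E (c (r s)) z) = fun s => mul (radial ev rho (c (r s)) z) (E (c (r s)) x).
      by apply/funext => s; exact: EW stW Wz.
    by apply: mul_smooth; [exact: sr | exact: Ax].
  have -> : (fun s => E (c (r s)) x) = fun s => mul (inv (radial ev rho (c (r s)) z)) (E (c (r s)) z).
    by apply/funext => s; rewrite (EW _ _ _ _ _ stW Wz) lg_mulA lg_Vmul lg_1mul.
  by apply: mul_smooth; [apply: inv_smooth; exact: sr | exact: Az].
have A0 : A x0.
  move=> c r _ _; rewrite (_ : (fun s => _) = fun=> one); first exact: smooth_curve_cst.
  by apply/funext => s; have [_] := HE (c (r s)).
have AT x : A x.
  have [sc _] := scM; have [g [/cpathP cg g0 g1]] := sc x0 x.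
  have : A (g 0) -> A (g 1); last by rewrite g0 g1; apply.
  apply: (cousin (P := fun a b => A (g a) -> A (g b)) ler01).
    by move=> a b d _ _ _ _ ab bd /ab.
  move=> t t0 t1; have [W [rho [stW _]]] := star_ex curve_openT (I : setT (g t)).
  have [oW Wt _] := stW; have [d d0 Hd] := cg t t0 t1 W oW Wt.
  exists d => // a b a0 at_ tb b1 da db /(AW _ _ _ _ stW) Ag.
  apply/(AW _ _ _ _ stW); first by apply: Hd; rewrite ?ltr_distl; lra.
  by apply: Ag; apply: Hd; rewrite ?ltr_distl; lra.
move=> c z oc sz; apply: smooth_curve_local => t.
have [W [rho [stW _]]] := star_ex curve_openT (I : setT (z t)).
have [oW Wt _] := stW; have [th [sth Wth thE]] := curve_shrink sz oW Wt.
(* Joint variation of form and point is separated: the point moves only in the radial factor, and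
   the second factor is evaluated at the fixed centre z(t). *)
exists (fun s => mul (radial ev rho (c (th s)) (z (th s))) (E (c (th s)) (z t))).
  apply: mul_smooth; last exact: AT.
  exact: (radial_smooth evs stW oc sth (smooth_curve_comp sz sth) Wth).
by apply: filterS thE => s e; rewrite -(EW _ _ _ _ _ stW (Wth s)) e.
Qed.

End evolution_operator.

(** * Homomorphisms, functors and naturality *)

Section homomorphisms.
Context {R : realType} {G H : lie_group R} (phi : lie_hom G H).

Lemma lie_hom1 : phi (lg_one G) = lg_one H.
Proof.
have := lh_morph phi (lg_one G) (lg_one G); rewrite lg_mul1 => e.
by rewrite -[LHS](lg_mulK _ (phi (lg_one G))) -e lg_mulV.
Qed.

Lemma lie_homV a : phi (lg_inv a) = lg_inv (phi a).
Proof.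
have := lh_morph phi (lg_inv a) a; rewrite lg_Vmul lie_hom1 => e.
by rewrite -[LHS](lg_mulK _ (phi a)) -e lg_1mul.
Qed.

(** A homomorphism intertwines right translation by a with right translation by phi(a), so it
    intertwines the two Maurer-Cartan forms. *)
Lemma lie_hom'_mc (z : tangent G) :
  lie_hom' phi (maurer_cartan z) = maurer_cartan (tmap phi z).
Proof.
rewrite /lie_hom' /maurer_cartan to_TeK ?tbase_tmap ?[rtrans _ _]lg_mulV //.
have -> : rtrans (lg_inv (phi (tbase z))) = rtrans (phi (lg_inv (tbase z))) by rewrite lie_homV.
rewrite -!tmap_comp; have -> // : smap_comp phi (rtrans (lg_inv (tbase z))) =
  smap_comp (rtrans (phi (lg_inv (tbase z)))) phi.
by apply: smap_eq; apply/funext => x; exact: lh_morph.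
Qed.

Lemma lie_hom'_smooth (X : R -> Lie G) : csmooth X -> csmooth (fun t => lie_hom' phi (X t)).
Proof.
move=> sX; have := mc_smooth (tmap_smooth phi (to_Te_smooth sX)).
rewrite (_ : (fun t => _) = fun t => lie_hom' phi (X t)) //; apply/funext => t.
by rewrite mc_one // tbase_tmap tbase_to_Te lie_hom1.
Qed.

End homomorphisms.

Lemma lie_hom'_id (R : realType) (G : lie_group R) X : lie_hom' (lie_hom_id G) X = X.
Proof. by rewrite /lie_hom' tmap_id of_TeK. Qed.

Lemma lie_hom'_comp (R : realType) (G H K : lie_group R) (psi : lie_hom H K)
  (phi : lie_hom G H) X : lie_hom' (lie_hom_comp psi phi) X = lie_hom' psi (lie_hom' phi X).
Proof.
rewrite /lie_hom' to_TeK; last by rewrite tbase_tmap tbase_to_Te lie_hom1.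
by rewrite tmap_comp.
Qed.

Lemma flat_form_eq (R : realType) (G : lie_group R) (M : manifold R) (xi eta : flat_form G M) :
  ff_fun xi = eta -> xi = eta.
Proof.
case: xi eta => [f of_ ff] [g og fg] /= e; case: g / e og fg => og fg.
by congr FlatForm; exact: Prop_irrelevance.
Qed.

Lemma fr_smooth_generated (R : realType) (S T : Type) (C : set (R -> S)) (D : set (R -> T))
    (f : S -> T) : (forall c, C c -> D (f \o c)) ->
  fr_smooth (X := frolicher_of_curves C) (Y := frolicher_of_curves D) f.
Proof. by move=> CD c cc g Dg; apply: (cc (g \o f)) => c' /CD; exact: Dg. Qed.

Section naturality.
Context {R : realType}.
Implicit Types (M N : sc_manifold R) (G H : reg_lie_group R).

Lemma is_Evol_ex G M : exists E : Omega_flat M G -> Cinf M G, is_Evol E.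
Proof.
have [E [dE E0 sE]] := evolution_ex (@rl_regular R G) (scm_pt M) (@scm_sc R M).
exists E; split=> // c cc _ [c' [f [l [bl ->]]]].
(* The structure on flat forms is generated by curves, so it suffices that this function is smooth
   along the generating curves. There (s, t) -> f(E(c(s))(c'(t))) is a smooth plane map and [l] acts
   on its rows. *)
apply: (cc (fun xi => l (Cinf_probe c' f (E xi)))) => {cc}c oc.
pose F (p : R * R) := f (E (c p.1) (c' p.2)).
have sF : csm2 F.
  move=> a b sa sb; apply: sf_smooth; apply: (sE (fun t => c (a t)) (fun t => c' (b t))).
    by move=> r z sr sz; apply: (oc (fun t => a (r t))) => //; exact: csmooth_comp.
  exact: smooth_curve_comp (sc_smooth c') sb.
have := functional_smooth sF bl; rewrite (_ : (fun s => _) = fun s => l (Cinf_probe c' f (E (c s)))) //.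
by apply/funext => s; congr l; exact: cinf_line_eq.
Qed.

Lemma is_Evol_eq G M (E : Omega_flat M G -> Cinf M G) (xi : flat_form G M) (f : smap M G) :
  is_Evol E -> rlog_deriv f = xi -> f (scm_pt M) = lg_one G -> f = E xi.
Proof.
move=> [_ dE E0] df f0.
exact: (rlog_uniq (@scm_sc R M) (etrans df (esym (dE xi))) (etrans f0 (esym (E0 xi)))).
Qed.

Lemma rlog_pull M N G H (h : smap N M) (phi : lie_hom G H) (f : smap M G) :
  rlog_deriv (smap_comp phi (smap_comp f h)) = Omega_pull h phi (rlog_deriv f).
Proof. by apply/funext => z; rewrite /rlog_deriv /Omega_pull lie_hom'_mc !tmap_comp. Qed.

(** As every flat form is a logarithmic derivative, its pullback is the logarithmic derivative of
    phi o f o h ([rlog_pull]), hence a flat form. *)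
Lemma flat_form_rlog G M (xi : flat_form G M) : exists2 f : smap M G,
  rlog_deriv f = xi & f (scm_pt M) = lg_one G.
Proof. by have [E [_ dE E0]] := is_Evol_ex G M; exists (E xi); [exact: dE | exact: E0]. Qed.

Lemma pull_one_form M N G H (h : smap N M) (phi : lie_hom G H) (xi : flat_form G M) :
  one_form (Omega_pull h phi xi).
Proof. by have [f <- _] := flat_form_rlog xi; rewrite -rlog_pull; exact: rlog_one_form. Qed.

Lemma pull_flat M N G H (h : smap N M) (phi : lie_hom G H) (xi : flat_form G M) :
  flat (Omega_pull h phi xi).
Proof. by have [f <- _] := flat_form_rlog xi; rewrite -rlog_pull; exact: rlog_flat. Qed.

Definition flat_pull M N G H (h : pt_map N M) (phi : lie_hom G H)
    (xi : Omega_flat M G) : Omega_flat N H :=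
  FlatForm (pull_one_form h phi xi) (pull_flat h phi xi).

Lemma flat_pull_functorial : functorial flat_pull.
Proof.
split=> [M N G H h phi|M G xi|M N P G H K h k phi psi xi].
- apply: fr_smooth_generated => c oc r z sr sz; apply: lie_hom'_smooth.
  by apply: oc => //; exact: tmap_smooth.
- apply: flat_form_eq; apply/funext => z /=.
  by rewrite /Omega_pull lie_hom'_id tmap_id.
- apply: flat_form_eq; apply/funext => z /=.
  by rewrite /Omega_pull lie_hom'_comp tmap_comp.
Qed.

Lemma Cinf_fmap_functorial : functorial (@Cinf_fmap R).
Proof.
split=> [M N G H h phi|M G f|M N P G H K h k phi psi f]; [|exact: smap_eq|exact: smap_eq].
move=> c cc _ [c' [f [l [bl ->]]]].
have sf' (e : R -> G) : smooth_curve e -> csmooth ((f \o phi) \o e).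
  by move=> se; exact: sf_smooth (sm_smooth phi se).
(* Probing phi o k o h with [c'] and [f] is probing [k] with h o c' and f o phi. *)
have := cc (fun k => l (Cinf_probe (push h c') (Sfun sf') k)).
rewrite (_ : _ \o c = (fun k => l (Cinf_probe c' f k)) \o (Cinf_fmap h phi \o c)).
  by apply; exists (push h c'), (Sfun sf'), l.
by apply/funext => s /=; congr l; exact: cinf_line_eq.
Qed.

(** Both mappings have the same logarithmic derivative and send the base point to the unit, so
    uniqueness applies. Stating it for any [eta] with the right underlying function covers the cases
    where [h] or [phi] is the identity, in which the pulled back form is written differently. *)
Lemma Evol_natural M N G H (h : pt_map N M) (phi : lie_hom G H)
    (E : Omega_flat M G -> Cinf M G) (E' : Omega_flat N H -> Cinf N H) (xi : flat_form G M)
    (eta : flat_form H N) : is_Evol E -> is_Evol E' -> ff_fun eta = Omega_pull h phi xi ->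
  smap_comp phi (smap_comp (E xi : smap M G) h) = E' eta.
Proof.
move=> [_ dE E0] isE' e; apply: is_Evol_eq => //.
  by rewrite rlog_pull e; congr Omega_pull; exact: dE.
by rewrite /= pt_base E0 lie_hom1.
Qed.

End naturality.

Theorem theorem3p3 (R : realType) :
  (* existence and uniqueness of Evol *)
  (forall (G : reg_lie_group R) (M : sc_manifold R),
     exists! Evol : Omega_flat M G -> Cinf M G, is_Evol Evol)
  /\
  (* Omega^1_flat and C^oo are functors and Evol is natural *)
  (exists Omega_fmap : forall (M N : sc_manifold R) (G H : reg_lie_group R),
       pt_map N M -> lie_hom G H -> Omega_flat M G -> Omega_flat N H,
     [/\ forall (M N : sc_manifold R) (G H : reg_lie_group R)
             (h : pt_map N M) (phi : lie_hom G H) (xi : flat_form G M),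
           ff_fun (Omega_fmap M N G H h phi xi) = Omega_pull h phi xi,
         functorial Omega_fmap,
         functorial (@Cinf_fmap R) &
         forall Evol : forall (M : sc_manifold R) (G : reg_lie_group R),
             Omega_flat M G -> Cinf M G,
           (forall M G, is_Evol (Evol M G)) ->
           forall (M N : sc_manifold R) (G H : reg_lie_group R)
             (h : pt_map N M) (phi : lie_hom G H) (xi : Omega_flat M G),
             Cinf_fmap h phi (Evol M G xi) =
             Evol N H (Omega_fmap M N G H h phi xi)])
  /\
  (* naturality in each variable *)
  (forall Evol : forall (M : sc_manifold R) (G : reg_lie_group R),
       Omega_flat M G -> Cinf M G,
     (forall M G, is_Evol (Evol M G)) ->
     (forall (M N : sc_manifold R) (G : reg_lie_group R) (h : pt_map N M)
         (xi : flat_form G M),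
        exists (p : one_form (fun z => xi (tmap h z)))
               (q : flat (fun z => xi (tmap h z))),
          Evol N G (FlatForm p q) = smap_comp (Evol M G xi) h)
     /\
     (forall (M : sc_manifold R) (G H : reg_lie_group R) (phi : lie_hom G H)
         (xi : flat_form G M),
        exists (p : one_form (fun z => lie_hom' phi (xi z)))
               (q : flat (fun z => lie_hom' phi (xi z))),
          Evol M H (FlatForm p q) = smap_comp phi (Evol M G xi))).
Proof.
split; [|split].
- move=> G M; have [E isE] := is_Evol_ex G M; exists E; split=> // E' isE'.
  by apply/funext => xi; apply: is_Evol_eq isE' _ _; have [_ dE E0] := isE; [exact: dE | exact: E0].
- exists (@flat_pull R); split=> //.
  + exact: flat_pull_functorial.
  + exact: Cinf_fmap_functorial.
  + by move=> E isE M N G H h phi xi; exact: Evol_natural (isE M G) (isE N H) _.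
move=> E isE; split=> [M N G h xi|M G H phi xi].
  have e : Omega_pull h (lie_hom_id G) xi = fun z => xi (tmap h z).
    by apply/funext => z; rewrite /Omega_pull lie_hom'_id.
  have p : one_form (fun z => xi (tmap h z)) by rewrite -e; exact: pull_one_form.
  have q : flat (fun z => xi (tmap h z)) by rewrite -e; exact: pull_flat.
  exists p, q; rewrite -(Evol_natural (isE M G) (isE N G) (esym e : ff_fun (FlatForm p q) = _)).
  exact: smap_eq.
have e : Omega_pull (pt_map_id M) phi xi = fun z => lie_hom' phi (xi z).
  by apply/funext => z; rewrite /Omega_pull tmap_id.
have p : one_form (fun z => lie_hom' phi (xi z)) by rewrite -e; exact: pull_one_form.
have q : flat (fun z => lie_hom' phi (xi z)) by rewrite -e; exact: pull_flat.
exists p, q; rewrite -(Evol_natural (isE M G) (isE M H) (esym e : ff_fun (FlatForm p q) = _)).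
exact: smap_eq.
Qed.
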